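(* Let $d\ge 2$. Then $$I_d=(f^{(d)})+\mathscr{I}_d^3,$$ where $(f^{(d)})=f^{(d)}\cdot R_d$ is the principal ideal generated by $f^{(d)}$ and $\mathscr I_d^3$ is the third power of the ideal $\mathscr I_d$.
   Context: Let $d\ge2$ and let $R_d=\mathbb Z[u_1^{\pm1},\dots,u_d^{\pm1}]$ be the ring of Laurent polynomials with integer coefficients. Elements $w=(w_{\mathbf n})\in\mathbb R^{\mathbb Z^d}$ are identified with formal series $\sum_{\mathbf n}w_{\mathbf n}u^{\mathbf n}$, $u^{\mathbf n}=u_1^{n_1}\cdots u_d^{n_d}$; in particular $h\in R_d$ is identified with its finitely supported integer coefficient sequence. For $h\in R_d$ and $w\in\mathbb R^{\mathbb Z^d}$ the product is $(h\cdot w)_{\mathbf n}=\sum_{\mathbf k}h_{\mathbf k}w_{\mathbf n-\mathbf k}$. Let $f^{(d)}=2d-\sum_{i=1}^d(u_i+u_i^{-1})\in R_d$ and $F^{(d)}(\mathbf t)=2d-2\sum_{j=1}^d\cos(2\pi t_j)$ for $\mathbf t\in\mathbb T^d=(\mathbb R/\mathbb Z)^d$; write $\langle\mathbf n,\mathbf t\rangle=\sum_j n_jt_j$. Define $w^{(d)}\in\mathbb R^{\mathbb Z^d}$ by $w^{(2)}_{\mathbf n}=\int_{\mathbb T^2}\frac{e^{-2\pi i\langle\mathbf n,\mathbf t\rangle}-1}{F^{(2)}(\mathbf t)}\,d\mathbf t$ for $d=2$, and $w^{(d)}_{\mathbf n}=\int_{\mathbb T^d}\frac{e^{-2\pi i\langle\mathbf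 n,\mathbf t\rangle}}{F^{(d)}(\mathbf t)}\,d\mathbf t$ for $d\ge3$ (a multiple of the lattice Green's function of simple random walk; it satisfies $f^{(d)}\cdot w^{(d)}=1$, i.e. equals the indicator of $\mathbf 0$). Define $I_d=\{g\in R_d: g\cdot w^{(d)}\in\ell^1(\mathbb Z^d)\}$ and $\mathscr I_d=\{h\in R_d: h(1,\dots,1)=0\}=(1-u_1)R_d+\dots+(1-u_d)R_d$. *)

(* Defs.v *)
(* Laurent polynomials as formal Z-linear combinations of
   monomials u^n (n : list Z of length d), real sequences on Z^d as
   functions list Z -> R, and integrals over T^d = [0,1)^d as iterated
   (outermost improper) Riemann integrals. *)
From Stdlib Require Import Reals ZArith List ClassicalEpsilon.
Import ListNotations.
Open Scope R_scope.

Definition pt := list Z.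
Definition vadd (a b : pt) : pt := map (fun p => (fst p + snd p)%Z) (combine a b).
Definition vsub (a b : pt) : pt := map (fun p => (fst p - snd p)%Z) (combine a b).

(* an element of R_d is a formal sum  sum c * u^k  over a list of pairs (c,k) *)
Definition LP := list (Z * pt).
Definition wfLP (d : nat) (h : LP) : Prop := Forall (fun p => length (snd p) = d) h.

Definition coef (h : LP) (n : pt) : Z :=
  fold_right (fun p acc => if list_eq_dec Z.eq_dec (snd p) n
                           then (fst p + acc)%Z else acc) 0%Z h.
Definition LPeq (h1 h2 : LP) : Prop := forall n, coef h1 n = coef h2 n.
Definition LPadd (h1 h2 : LP) : LP := h1 ++ h2.
Definition LPmul (h1 h2 : LP) : LP :=
  flat_map (fun p => map (fun q => ((fst p * fst q)%Z, vadd (snd p) (snd q))) h2) h1.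
Definition eval1 (h : LP) : Z := fold_right (fun p acc => (fst p + acc)%Z) 0%Z h.

Definition zerovec (d : nat) : pt := repeat 0%Z d.
Definition unitvec (d i : nat) : pt :=
  map (fun j => if Nat.eqb j i then 1%Z else 0%Z) (seq 0 d).

Definition fLap (d : nat) : LP :=
  (Z.of_nat (2 * d), zerovec d)
  :: flat_map (fun i => [((-1)%Z, unitvec d i); ((-1)%Z, map Z.opp (unitvec d i))]) (seq 0 d).

Definition augI (d : nat) (h : LP) : Prop := wfLP d h /\ eval1 h = 0%Z.

Definition augI3 (d : nat) (b : LP) : Prop :=
  exists T : list (LP * LP * LP),
    Forall (fun '(x, y, z) => augI d x /\ augI d y /\ augI d z) T /\
    LPeq b (fold_right (fun '(x, y, z) acc => LPmul (LPmul x y) z ++ acc) [] T).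

Definition act (h : LP) (w : pt -> R) : pt -> R :=
  fun n => fold_right (fun p acc => IZR (fst p) * w (vsub n (snd p)) + acc) 0 h.

Definition ell1 (d : nat) (g : pt -> R) : Prop :=
  exists B : R, forall S : list pt, NoDup S -> Forall (fun n => length n = d) S ->
    fold_right (fun n acc => Rabs (g n) + acc) 0 S <= B.

Definition RInt (g : R -> R) (a b v : R) : Prop :=
  exists pr : Riemann_integrable g a b, RiemannInt pr = v.

Definition ImpInt01 (g : R -> R) (v : R) : Prop :=
  (forall eps, 0 < eps < /2 -> exists x, RInt g eps (1 - eps) x) /\
  (forall e, 0 < e -> exists delta, 0 < delta /\
     forall eps x, 0 < eps < delta -> eps < /2 -> RInt g eps (1 - eps) x ->
       Rabs (x - v) < e).

Definition upd (t : nat -> R) (k : nat) (s : R) : nat -> R :=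
  fun j => if Nat.eqb j k then s else t j.

Fixpoint CubeInt (k : nat) (f : (nat -> R) -> R) (v : R) : Prop :=
  match k with
  | O => v = f (fun _ => 0)
  | S k' => exists g : R -> R,
      (forall s, 0 < s < 1 -> CubeInt k' (fun t => f (upd t k' s)) (g s)) /\
      ImpInt01 g v
  end.

Definition tdot (d : nat) (n : pt) (t : nat -> R) : R :=
  fold_right (fun j acc => IZR (nth j n 0%Z) * t j + acc) 0 (seq 0 d).

Definition Fsym (d : nat) (t : nat -> R) : R :=
  2 * INR d - 2 * fold_right (fun j acc => cos (2 * PI * t j) + acc) 0 (seq 0 d).

(* real part of e^{-2 pi i <n,t>} (resp. minus 1 for d = 2) divided by F *)
Definition integrand (d : nat) (n : pt) (t : nat -> R) : R :=
  if Nat.eqb d 2 then (cos (2 * PI * tdot d n t) - 1) / Fsym d t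
  else cos (2 * PI * tdot d n t) / Fsym d t.

Definition wgreen (d : nat) (n : pt) : R :=
  epsilon (inhabits 0) (fun v => CubeInt d (integrand d n) v).

Definition Id (d : nat) (g : LP) : Prop := wfLP d g /\ ell1 d (act g (wgreen d)).

(* Main.v *)
(** Write X_i = u_i - 1 and let F be the symbol of f, so that convolution with the Green
    function w is division by F on the Fourier side and f w = 1.

    If h is a product of three elements of the augmentation ideal, its symbol is O(F), so
    expanding 1/F as a geometric series in 1 - F/(4d) gives
    h w = (1/4d) sum_m h P^m, where P is the lazy simple random walk on Z^d.
    Since || x P^m ||_1 = O(m^(-1/2)) for x in the augmentation ideal, distributing P^m over
    the three factors of h gives || h P^m ||_1 = O(m^(-3/2)), so h w is summable.

    Conversely, if v = g w is summable then g = f v, and pairing g with the eigenfunctions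
    cos(c - <theta, n>) of f, whose eigenvalues are O(theta^2), shows that g annihilates the
    polynomials 1, n_i, n_i n_j (i <> j) and n_i^2 - n_j^2. By the second order Taylor
    expansion of u^n modulo the cube of the augmentation ideal, g is then congruent to a
    multiple of sum_i X_i^2, which is congruent to -f. *)
Require Import Defs.
From Stdlib Require Import Reals ZArith List ClassicalEpsilon.
From Stdlib Require Import Lra Lia Psatz Setoid Morphisms Ring Classical.
From Coquelicot Require Import Coquelicot.
Import ListNotations.
Open Scope R_scope.

(** * Finite sums and the Laurent polynomial ring *)

(** The Neumann series is never interchanged with the integral. Stopped after M terms, it misses h w
    at each point by at most a constant times the return probability of the walk at time M, which
    tends to 0; for a fixed finite set of points M goes to infinity, and the bound on the l^1 sum
    does not depend on the set. Laziness serves twice: it keeps 4d - F nonnegative, so the remainder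
    has a sign, and it makes each coordinate part of the walk a unit times (1 + u_j)^2, which
    reduces the decay of differences to one binomial estimate. Since w is a choice of a value of an
    iterated integral, existence has to be shown first. Once the outermost coordinate is fixed in
    (0,1), F stays away from 0 and the inner integrands are Lipschitz, so only the outermost
    integral is truly improper. For d >= 3 it is controlled by a product of powers with exponent
    -3/4: above -1, hence integrable in each variable, while three of them have total exponent 9/4,
    which covers the zero of order 2 of F. In the converse, the waves are combined into
    eigenfunctions that are small with theta, so that the pairing with g is o(theta^2). *)

Definition sumL {A} (S : list A) (F : A -> R) : R :=
  fold_right (fun n acc => F n + acc) 0 S.


Lemma sumL_ext {A} (S : list A) (F G : A -> R) :
  (forall x, In x S -> F x = G x) -> sumL S F = sumL S G.
Proof.
  induction S as [|x S IH]; simpl; intros H; [reflexivity|].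
  rewrite H, IH; auto.
Qed.

Lemma sumL_app {A} (S T : list A) F : sumL (S ++ T) F = sumL S F + sumL T F.
Proof. induction S as [|x S IH]; simpl; [ring|rewrite IH; ring]. Qed.

Lemma sumL_plus {A} (S : list A) F G : sumL S (fun x => F x + G x) = sumL S F + sumL S G.
Proof. induction S as [|x S IH]; simpl; [ring|rewrite IH; ring]. Qed.

Lemma sumL_scal {A} (S : list A) c F : sumL S (fun x => c * F x) = c * sumL S F.
Proof. induction S as [|x S IH]; simpl; [ring|rewrite IH; ring]. Qed.

Lemma sumL_minus {A} (S : list A) F G : sumL S (fun x => F x - G x) = sumL S F - sumL S G.
Proof. induction S as [|x S IH]; simpl; [ring|rewrite IH; ring]. Qed.

Lemma sumL_0 {A} (S : list A) : sumL S (fun _ => 0) = 0.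
Proof. induction S as [|x S IH]; simpl; [reflexivity|rewrite IH; ring]. Qed.

Lemma sumL_zero {A} (S : list A) F : (forall x, In x S -> F x = 0) -> sumL S F = 0.
Proof. intros H. rewrite <- (sumL_0 S). apply sumL_ext. exact H. Qed.

Lemma sumL_le {A} (S : list A) F G :
  (forall x, In x S -> F x <= G x) -> sumL S F <= sumL S G.
Proof.
  induction S as [|x S IH]; simpl; intros H; [lra|].
  pose proof (H x (or_introl eq_refl)).
  assert (sumL S F <= sumL S G) by auto. unfold sumL in *. lra.
Qed.

Lemma sumL_ge0 {A} (S : list A) F : (forall x, In x S -> 0 <= F x) -> 0 <= sumL S F.
Proof. intros H. rewrite <- (sumL_0 S). apply sumL_le. exact H. Qed.

Lemma sumL_abs {A} (S : list A) F : Rabs (sumL S F) <= sumL S (fun x => Rabs (F x)).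
Proof.
  induction S as [|x S IH]; simpl; [rewrite Rabs_R0; lra|].
  eapply Rle_trans; [apply Rabs_triang|]. unfold sumL in *. lra.
Qed.

Lemma sumL_swap {A B} (S : list A) (T : list B) F :
  sumL S (fun x => sumL T (fun y => F x y)) = sumL T (fun y => sumL S (fun x => F x y)).
Proof.
  induction S as [|x S IH]; simpl.
  - symmetry. apply sumL_0.
  - rewrite sumL_plus. unfold sumL in *. rewrite IH. reflexivity.
Qed.

Lemma sumL_map {A B} (g : A -> B) (S : list A) F : sumL (map g S) F = sumL S (fun x => F (g x)).
Proof. induction S as [|x S IH]; simpl; [reflexivity|rewrite IH; reflexivity]. Qed.

Lemma sumL_flat_map {A B} (g : A -> list B) (S : list A) F :
  sumL (flat_map g S) F = sumL S (fun x => sumL (g x) F).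
Proof. induction S as [|x S IH]; simpl; [reflexivity|rewrite sumL_app, IH; reflexivity]. Qed.

Lemma sumL_const {A} (S : list A) c : sumL S (fun _ => c) = INR (length S) * c.
Proof.
  induction S as [|x S IH]; simpl sumL; [simpl; ring|].
  rewrite IH. simpl length. rewrite S_INR. ring.
Qed.

Lemma sumL_single {A} (dec : forall x y : A, {x = y} + {x <> y}) (S : list A) a F :
  NoDup S -> In a S -> sumL S (fun x => if dec a x then F x else 0) = F a.
Proof.
  induction S as [|x S IH]; simpl; intros ND Hin; [tauto|].
  inversion ND as [|? ? Hx ND']; subst.
  destruct (dec a x) as [<-|ne].
  - rewrite (sumL_zero S); [ring|].
    intros y Hy. destruct (dec a y) as [<-|]; [contradiction|reflexivity].
  - destruct Hin as [->|Hin]; [congruence|]. rewrite IH by auto. ring.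
Qed.

Lemma sumL_single_out {A} (dec : forall x y : A, {x = y} + {x <> y}) (S : list A) a F :
  ~ In a S -> sumL S (fun x => if dec a x then F x else 0) = 0.
Proof.
  intros H. apply sumL_zero. intros x Hx.
  destruct (dec a x) as [<-|]; [contradiction|reflexivity].
Qed.


(** * Pairing Laurent polynomials with test functions *)

Definition pt_dec : forall x y : pt, {x = y} + {x <> y} := list_eq_dec Z.eq_dec.

(** Coefficients, the augmentation, the action on w and the Fourier symbol are all values of this
    pairing, so one calculus serves for all of them. *)
Definition ev (h : LP) (phi : pt -> R) : R := sumL h (fun p => IZR (fst p) * phi (snd p)).

Lemma act_ev h w n : act h w n = ev h (fun k => w (vsub n k)).
Proof. reflexivity. Qed.

Lemma ev_app h1 h2 phi : ev (h1 ++ h2) phi = ev h1 phi + ev h2 phi.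
Proof. apply sumL_app. Qed.

Lemma ev_mul h1 h2 phi :
  ev (LPmul h1 h2) phi = ev h1 (fun k => ev h2 (fun l => phi (vadd k l))).
Proof.
  unfold ev, LPmul. rewrite sumL_flat_map. apply sumL_ext. intros [a k] _. simpl.
  rewrite sumL_map, <- sumL_scal. apply sumL_ext. intros [b l] _. simpl.
  rewrite mult_IZR. ring.
Qed.

Lemma ev_ext d h phi psi :
  wfLP d h -> (forall k, length k = d -> phi k = psi k) -> ev h phi = ev h psi.
Proof.
  intros W H. apply sumL_ext. intros p Hp.
  unfold wfLP in W. rewrite Forall_forall in W. rewrite H; auto.
Qed.

Lemma ev_ext' h phi psi : (forall k, phi k = psi k) -> ev h phi = ev h psi.
Proof. intros H. apply sumL_ext. intros p _. rewrite H. reflexivity. Qed.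

Lemma ev_plus h phi psi : ev h (fun k => phi k + psi k) = ev h phi + ev h psi.
Proof. unfold ev. rewrite <- sumL_plus. apply sumL_ext. intros; ring. Qed.

Lemma ev_scal h c phi : ev h (fun k => c * phi k) = c * ev h phi.
Proof. unfold ev. rewrite <- sumL_scal. apply sumL_ext. intros; ring. Qed.

Lemma ev_minus h phi psi : ev h (fun k => phi k - psi k) = ev h phi - ev h psi.
Proof. unfold ev. rewrite <- sumL_minus. apply sumL_ext. intros; ring. Qed.

Lemma ev_sumL {A} h (S : list A) (Phi : A -> pt -> R) :
  ev h (fun k => sumL S (fun x => Phi x k)) = sumL S (fun x => ev h (Phi x)).
Proof.
  unfold ev. rewrite <- sumL_swap. apply sumL_ext. intros p _. symmetry. apply sumL_scal.
Qed.

Lemma ev_swap h1 h2 Phi :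
  ev h1 (fun k => ev h2 (fun l => Phi k l)) = ev h2 (fun l => ev h1 (fun k => Phi k l)).
Proof.
  unfold ev at 2. rewrite ev_sumL. apply sumL_ext. intros p _. apply ev_scal.
Qed.

Lemma ev_0 h : ev h (fun _ => 0) = 0.
Proof. apply sumL_zero. intros; ring. Qed.

Definition dirac (n k : pt) : R := if pt_dec k n then 1 else 0.

Lemma coef_ev h n : IZR (coef h n) = ev h (dirac n).
Proof.
  induction h as [|[a k] h IH]; [reflexivity|].
  unfold ev, dirac, pt_dec in *. simpl.
  destruct (list_eq_dec Z.eq_dec k n); simpl; rewrite ?plus_IZR, IH; ring.
Qed.

Lemma eval1_ev h : IZR (eval1 h) = ev h (fun _ => 1).
Proof.
  induction h as [|[a k] h IH]; [reflexivity|].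
  unfold ev in *. simpl. rewrite plus_IZR, IH. ring.
Qed.

Lemma ev_coef h (S : list pt) phi :
  NoDup S -> (forall p, In p h -> In (snd p) S) ->
  ev h phi = sumL S (fun n => IZR (coef h n) * phi n).
Proof.
  intros ND HS.
  rewrite (sumL_ext S _ (fun n => ev h (fun k => dirac n k * phi n))).
  2:{ intros n _. rewrite coef_ev, Rmult_comm, <- ev_scal. apply ev_ext'. intros; ring. }
  rewrite <- ev_sumL. apply sumL_ext. intros p Hp. f_equal.
  rewrite (sumL_ext S _ (fun n => if pt_dec (snd p) n then phi n else 0)).
  - symmetry. apply sumL_single; auto.
  - intros n _. unfold dirac. destruct (pt_dec (snd p) n); ring.
Qed.

(** Coefficients are pairings with [dirac]. Conversely, over a finite set containing every exponent
    of both lists, [ev_coef] recovers the pairing from the coefficients, whatever repetitions the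
    lists contain. *)
Lemma LPeq_ev h1 h2 : LPeq h1 h2 <-> forall phi, ev h1 phi = ev h2 phi.
Proof.
  split.
  - intros H phi. set (S := nodup pt_dec (map snd (h1 ++ h2))).
    assert (HS : forall p, In p (h1 ++ h2) -> In (snd p) S).
    { intros p Hp. apply nodup_In, in_map, Hp. }
    rewrite (ev_coef h1 S), (ev_coef h2 S).
    + apply sumL_ext. intros n _. rewrite H. reflexivity.
    + apply NoDup_nodup.
    + intros p Hp. apply HS, in_or_app; auto.
    + apply NoDup_nodup.
    + intros p Hp. apply HS, in_or_app; auto.
  - intros H n. apply eq_IZR. rewrite !coef_ev. apply H.
Qed.

(** * Coordinates and translations of lattice points *)

Section Points.

Definition mk (d : nat) (f : nat -> Z) : pt := map f (seq 0 d).
Definition co (n : pt) (i : nat) : Z := nth i n 0%Z.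

Lemma mk_length d f : length (mk d f) = d.
Proof. unfold mk. rewrite length_map, length_seq. reflexivity. Qed.

Lemma co_mk d f i : (i < d)%nat -> co (mk d f) i = f i.
Proof.
  intros H. unfold co, mk. rewrite nth_indep with (d' := f 0%nat).
  - rewrite map_nth, seq_nth; auto.
  - rewrite length_map, length_seq. exact H.
Qed.

Lemma pt_ext d (n m : pt) : length n = d -> length m = d ->
  (forall i, (i < d)%nat -> co n i = co m i) -> n = m.
Proof.
  intros Hn Hm H. apply nth_ext with (d := 0%Z) (d' := 0%Z); [congruence|].
  intros i Hi. apply H. lia.
Qed.

Lemma zipmap_length (g : Z * Z -> Z) (n m : pt) d :
  length n = d -> length m = d -> length (map g (combine n m)) = d.
Proof. intros. rewrite length_map, length_combine. lia. Qed.

Lemma zipmap_co (g : Z * Z -> Z) (n m : pt) d i :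
  length n = d -> length m = d -> (i < d)%nat ->
  co (map g (combine n m)) i = g (co n i, co m i).
Proof.
  intros Hn Hm Hi. unfold co.
  rewrite nth_indep with (d' := g (0%Z, 0%Z)).
  - rewrite map_nth, combine_nth; congruence.
  - rewrite length_map, length_combine. lia.
Qed.

Lemma vadd_length d n m : length n = d -> length m = d -> length (vadd n m) = d.
Proof. apply zipmap_length. Qed.
Lemma vsub_length d n m : length n = d -> length m = d -> length (vsub n m) = d.
Proof. apply zipmap_length. Qed.
Lemma vadd_co d n m i : length n = d -> length m = d -> (i < d)%nat ->
  co (vadd n m) i = (co n i + co m i)%Z.
Proof. apply zipmap_co. Qed.
Lemma vsub_co d n m i : length n = d -> length m = d -> (i < d)%nat ->
  co (vsub n m) i = (co n i - co m i)%Z.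
Proof. apply zipmap_co. Qed.
Lemma zerovec_length d : length (zerovec d) = d.
Proof. apply repeat_length. Qed.
Lemma zerovec_co d i : co (zerovec d) i = 0%Z.
Proof. apply nth_repeat. Qed.

Lemma vadd_comm n m : vadd n m = vadd m n.
Proof.
  revert m. induction n as [|a n IH]; intros [|b m]; try reflexivity.
  unfold vadd in *. simpl. rewrite IH. f_equal. ring.
Qed.

Lemma vadd_assoc n m k : vadd n (vadd m k) = vadd (vadd n m) k.
Proof.
  revert m k. induction n as [|a n IH]; intros [|b m] [|c k]; try reflexivity.
  unfold vadd in *. simpl. rewrite IH. f_equal. ring.
Qed.

Lemma vsub_vadd n m k : vsub n (vadd m k) = vsub (vsub n m) k.
Proof.
  revert m k. induction n as [|a n IH]; intros [|b m] [|c k]; try reflexivity.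
  unfold vadd, vsub in *. simpl. rewrite IH. f_equal. ring.
Qed.

Lemma vadd_zero d n : length n = d -> vadd (zerovec d) n = n.
Proof.
  intros H. apply (pt_ext d); auto.
  - apply vadd_length; [apply zerovec_length|exact H].
  - intros i Hi. rewrite (vadd_co d); auto using zerovec_length.
    rewrite zerovec_co. reflexivity.
Qed.

Lemma vsub_eq_zero d n k : length n = d -> length k = d -> vsub n k = zerovec d <-> k = n.
Proof.
  intros Hn Hk. split.
  - intros H. apply (pt_ext d); auto. intros i Hi.
    pose proof (vsub_co d n k i Hn Hk Hi) as E. rewrite H, zerovec_co in E. lia.
  - intros ->. apply (pt_ext d); auto using vsub_length, zerovec_length.
    intros i Hi. rewrite (vsub_co d), zerovec_co; auto. ring.
Qed.

Lemma vsub_cancel d n k : length n = d -> length k = d -> vadd (vsub n k) k = n.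
Proof.
  intros Hn Hk. apply (pt_ext d); auto using vadd_length, vsub_length.
  intros i Hi. rewrite (vadd_co d), (vsub_co d); auto using vsub_length. ring.
Qed.

Lemma vadd_cancel d n k : length n = d -> length k = d -> vsub (vadd n k) k = n.
Proof.
  intros Hn Hk. apply (pt_ext d); auto using vadd_length, vsub_length.
  intros i Hi. rewrite (vsub_co d), (vadd_co d); auto using vadd_length. ring.
Qed.

End Points.

(** * The commutative ring of Laurent polynomials *)

Lemma wf_app d h1 h2 : wfLP d h1 -> wfLP d h2 -> wfLP d (h1 ++ h2).
Proof. intros. apply Forall_app; auto. Qed.

Lemma wf_mul d h1 h2 : wfLP d h1 -> wfLP d h2 -> wfLP d (LPmul h1 h2).
Proof.
  unfold wfLP, LPmul. rewrite !Forall_forall. intros H1 H2 p Hp.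
  apply in_flat_map in Hp. destruct Hp as [q [Hq Hp]].
  apply in_map_iff in Hp. destruct Hp as [r [<- Hr]]. simpl.
  apply vadd_length; auto.
Qed.

Definition LPscal (c : Z) (h : LP) : LP := map (fun p => ((c * fst p)%Z, snd p)) h.

Lemma wf_scal d c h : wfLP d h -> wfLP d (LPscal c h).
Proof. unfold wfLP, LPscal. intros H. apply Forall_map. exact H. Qed.

Lemma ev_LPscal c h phi : ev (LPscal c h) phi = IZR c * ev h phi.
Proof.
  unfold ev, LPscal. rewrite sumL_map, <- sumL_scal. apply sumL_ext.
  intros p _. simpl. rewrite mult_IZR. ring.
Qed.

(** The length condition is bundled because [vadd] truncates to the shorter argument: the constant 1
    is a unit only on exponents of length d. *)
Record W (d : nat) := mkW { wv : LP; wwf : wfLP d wv }.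
Arguments mkW {d} _ _.
Arguments wv {d} _.
Arguments wwf {d} _.

Section LaurentRing.
Context {d : nat}.
Notation W := (W d).

(* Formal sums represent the same Laurent polynomial when they pair equally with every
   test function; the ring laws then reduce to those of finite sums of reals. *)
Definition weq (x y : W) : Prop := forall phi, ev (wv x) phi = ev (wv y) phi.
Definition wadd (x y : W) : W := mkW (wv x ++ wv y) (wf_app d _ _ (wwf x) (wwf y)).
Definition wmul (x y : W) : W := mkW (LPmul (wv x) (wv y)) (wf_mul d _ _ (wwf x) (wwf y)).
Definition wopp (x : W) : W := mkW (LPscal (-1) (wv x)) (wf_scal d _ _ (wwf x)).
Definition wsub (x y : W) : W := wadd x (wopp y).
Definition w0 : W := mkW [] (Forall_nil _).

Lemma mono_wf (c : Z) (f : nat -> Z) : wfLP d [(c, mk d f)].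
Proof. constructor; [apply mk_length|constructor]. Qed.

Definition mono (f : nat -> Z) : W := mkW [(1%Z, mk d f)] (mono_wf _ f).
Definition wcst (c : Z) : W := mkW [(c, mk d (fun _ => 0%Z))] (mono_wf _ _).
Definition w1 : W := wcst 1.

Lemma ev_wadd x y phi : ev (wv (wadd x y)) phi = ev (wv x) phi + ev (wv y) phi.
Proof. apply ev_app. Qed.
Lemma ev_wmul x y phi :
  ev (wv (wmul x y)) phi = ev (wv x) (fun k => ev (wv y) (fun l => phi (vadd k l))).
Proof. apply ev_mul. Qed.
Lemma ev_wopp x phi : ev (wv (wopp x)) phi = - ev (wv x) phi.
Proof. simpl. rewrite ev_LPscal. ring. Qed.
Lemma ev_wsub x y phi : ev (wv (wsub x y)) phi = ev (wv x) phi - ev (wv y) phi.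
Proof. unfold wsub. rewrite ev_wadd, ev_wopp. ring. Qed.
Lemma ev_mono f phi : ev (wv (mono f)) phi = phi (mk d f).
Proof. unfold ev; simpl. ring. Qed.
Lemma mk_zero : mk d (fun _ => 0%Z) = zerovec d.
Proof.
  apply (pt_ext d); auto using mk_length, zerovec_length.
  intros i Hi. rewrite co_mk, zerovec_co; auto.
Qed.
Lemma ev_wcst c phi : ev (wv (wcst c)) phi = IZR c * phi (zerovec d).
Proof. unfold ev; simpl. rewrite mk_zero. ring. Qed.

Global Instance weq_equiv : Equivalence weq.
Proof.
  split; unfold weq; [intros x phi|intros x y H phi|intros x y z H1 H2 phi]; congruence.
Qed.
Global Instance wadd_proper : Proper (weq ==> weq ==> weq) wadd.
Proof. intros x x' Hx y y' Hy phi. rewrite !ev_wadd, Hx, Hy. reflexivity. Qed.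
Global Instance wmul_proper : Proper (weq ==> weq ==> weq) wmul.
Proof.
  intros x x' Hx y y' Hy phi. rewrite !ev_wmul, Hx. apply ev_ext'. intros k. apply Hy.
Qed.
Global Instance wopp_proper : Proper (weq ==> weq) wopp.
Proof. intros x x' Hx phi. rewrite !ev_wopp, Hx. reflexivity. Qed.
Global Instance wsub_proper : Proper (weq ==> weq ==> weq) wsub.
Proof. intros x x' Hx y y' Hy phi. rewrite !ev_wsub, Hx, Hy. reflexivity. Qed.

Lemma W_ring : ring_theory w0 w1 wadd wmul wsub wopp weq.
Proof.
  split; intros; intros phi.
  - rewrite ev_wadd. unfold ev at 1; simpl. ring.
  - rewrite !ev_wadd. ring.
  - rewrite !ev_wadd. ring.
  - rewrite ev_wmul. unfold w1. rewrite ev_wcst, Rmult_1_l.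
    apply (ev_ext d); [apply wwf|]. intros k Hk. rewrite vadd_zero; auto.
  - rewrite !ev_wmul, ev_swap. apply ev_ext'. intros k. apply ev_ext'. intros l.
    rewrite vadd_comm. reflexivity.
  - rewrite !ev_wmul. apply ev_ext'. intros k. rewrite ev_wmul.
    apply ev_ext'. intros l. apply ev_ext'. intros m. rewrite vadd_assoc. reflexivity.
  - rewrite ev_wadd, !ev_wmul, ev_wadd. reflexivity.
  - reflexivity.
  - rewrite ev_wadd, ev_wopp. unfold ev at 3; simpl. ring.
Qed.

Lemma W_ring_ext : ring_eq_ext wadd wmul wopp weq.
Proof. split; [apply wadd_proper|apply wmul_proper|apply wopp_proper]. Qed.

Add Ring Wring : W_ring (setoid weq_equiv W_ring_ext).

Fixpoint wpow (x : W) (n : nat) : W :=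
  match n with O => w1 | S n => wmul x (wpow x n) end.

Fixpoint wsum (S : nat) (F : nat -> W) : W :=
  match S with O => w0 | Datatypes.S r => wadd (wsum r F) (F r) end.

Lemma ev_wsum n F phi : ev (wv (wsum n F)) phi = sumL (seq 0 n) (fun i => ev (wv (F i)) phi).
Proof.
  induction n as [|n IH]; [reflexivity|].
  rewrite seq_S, sumL_app. simpl wsum. rewrite ev_wadd, IH. unfold sumL at 3; simpl. ring.
Qed.

Lemma mono_add f g : weq (wmul (mono f) (mono g)) (mono (fun i => (f i + g i)%Z)).
Proof.
  intros phi. rewrite ev_wmul, !ev_mono. f_equal.
  apply (pt_ext d); auto using vadd_length, mk_length.
  intros i Hi. rewrite (vadd_co d), !co_mk; auto using mk_length.
Qed.

Lemma mono_ext f g : (forall i, (i < d)%nat -> f i = g i) -> weq (mono f) (mono g).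
Proof.
  intros H phi. rewrite !ev_mono. f_equal.
  apply (pt_ext d); auto using mk_length. intros i Hi. rewrite !co_mk; auto.
Qed.

Lemma mono_0 f : (forall i, (i < d)%nat -> f i = 0%Z) -> weq (mono f) w1.
Proof.
  intros H phi. unfold w1. rewrite ev_mono, ev_wcst, Rmult_1_l, <- mk_zero. f_equal.
  apply (pt_ext d); auto using mk_length. intros i Hi. rewrite !co_mk; auto.
Qed.

Lemma wcst_add a b : weq (wcst (a + b)) (wadd (wcst a) (wcst b)).
Proof. intros phi. rewrite ev_wadd, !ev_wcst, plus_IZR. ring. Qed.

Lemma ev_wcst_mul a x phi : ev (wv (wmul (wcst a) x)) phi = IZR a * ev (wv x) phi.
Proof.
  rewrite ev_wmul, ev_wcst. f_equal. apply (ev_ext d); [apply wwf|].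
  intros k Hk. rewrite vadd_zero; auto.
Qed.

Lemma wcst_mul a b : weq (wcst (a * b)) (wmul (wcst a) (wcst b)).
Proof. intros phi. rewrite ev_wcst_mul, !ev_wcst, mult_IZR. ring. Qed.

End LaurentRing.

(** * Decay of differences of the lazy random walk *)

Section Decay.
Context {d : nat}.
Notation W := (W d).
Add Ring Wring : (@W_ring d) (setoid (@weq_equiv d) (@W_ring_ext d)).

Notation "x == y" := (weq x y) (at level 70).
Notation "x +: y" := (wadd x y) (at level 50, left associativity).
Notation "x -: y" := (wsub x y) (at level 50, left associativity).
Notation "x *: y" := (wmul x y) (at level 40, left associativity).
Notation one := (@w1 d).

(* The l^1 norm of the coefficients, through its dual characterisation. *)
Definition nb (x : W) (B : R) : Prop :=
  forall phi, (forall n, Rabs (phi n) <= 1) -> Rabs (ev (wv x) phi) <= B.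

Lemma nb_ge0 x B : nb x B -> 0 <= B.
Proof.
  intros H. eapply Rle_trans; [apply Rabs_pos|].
  apply (H (fun _ => 0)). intros _. rewrite Rabs_R0. lra.
Qed.

Lemma nb_bound x B phi c : nb x B -> (forall n, Rabs (phi n) <= c) ->
  Rabs (ev (wv x) phi) <= B * c.
Proof.
  intros H Hc. pose proof (nb_ge0 _ _ H) as HB.
  assert (Hc0 : 0 <= c) by (eapply Rle_trans; [apply Rabs_pos|apply (Hc [])]).
  destruct (Req_dec c 0) as [->|Hne].
  - rewrite (ev_ext' _ _ (fun _ => 0)), ev_0, Rabs_R0; [lra|].
    intros k. specialize (Hc k). unfold Rabs in Hc. destruct Rcase_abs in Hc; lra.
  - rewrite (ev_ext' _ _ (fun k => c * (phi k / c))) by (intros; field; exact Hne).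
    rewrite ev_scal, Rabs_mult, (Rabs_pos_eq c), Rmult_comm by exact Hc0.
    apply Rmult_le_compat_r; [exact Hc0|]. apply H. intros n.
    unfold Rdiv. rewrite Rabs_mult, Rabs_inv, (Rabs_pos_eq c) by exact Hc0.
    apply (Rmult_le_reg_r c); [lra|]. rewrite Rmult_assoc, Rinv_l; [|exact Hne].
    specialize (Hc n). lra.
Qed.

Lemma nb_le x B B' : nb x B -> B <= B' -> nb x B'.
Proof. intros H L phi Hp. eapply Rle_trans; [apply H, Hp|exact L]. Qed.

Global Instance nb_proper : Proper (weq ==> eq ==> iff) nb.
Proof.
  intros x y H B B' <-. split; intros N phi Hp; [rewrite <- H|rewrite H]; apply N, Hp.
Qed.

Lemma nb_add x y B C : nb x B -> nb y C -> nb (x +: y) (B + C).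
Proof.
  intros Hx Hy phi Hp. rewrite ev_wadd. eapply Rle_trans; [apply Rabs_triang|].
  apply Rplus_le_compat; auto.
Qed.

Lemma nb_opp x B : nb x B -> nb (wopp x) B.
Proof. intros H phi Hp. rewrite ev_wopp, Rabs_Ropp. auto. Qed.

Lemma nb_mul x y B C : nb x B -> nb y C -> nb (x *: y) (B * C).
Proof.
  intros Hx Hy phi Hp. rewrite ev_wmul. apply nb_bound; [exact Hx|].
  intros n. apply Hy. intros m. apply Hp.
Qed.

Lemma nb_mono f : nb (mono f) 1.
Proof. intros phi Hp. rewrite ev_mono. apply Hp. Qed.

Lemma nb_cst a : nb (wcst a) (Rabs (IZR a)).
Proof.
  intros phi Hp. rewrite ev_wcst, Rabs_mult.
  specialize (Hp (zerovec d)). pose proof (Rabs_pos (IZR a)). nra.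
Qed.

Lemma nb_one : nb one 1.
Proof. intros phi Hp. unfold w1. rewrite ev_wcst, Rmult_1_l. apply Hp. Qed.

Lemma nb_cst_div a x B : 0 < IZR a -> nb (wcst a *: x) B -> nb x (B / IZR a).
Proof.
  intros Ha H phi Hp. specialize (H phi Hp).
  rewrite ev_wcst_mul, Rabs_mult, (Rabs_pos_eq (IZR a)) in H by lra.
  apply (Rmult_le_reg_l (IZR a)); [exact Ha|]. unfold Rdiv.
  rewrite <- Rmult_assoc, (Rmult_comm (IZR a) B), Rmult_assoc, Rinv_r; lra.
Qed.

Lemma nb_wsum n F (b : nat -> R) : (forall i, (i < n)%nat -> nb (F i) (b i)) ->
  nb (wsum n F) (sumL (seq 0 n) b).
Proof.
  intros H phi Hp. rewrite ev_wsum. eapply Rle_trans; [apply sumL_abs|].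
  apply sumL_le. intros i Hi. apply in_seq in Hi. apply H; [lia|exact Hp].
Qed.

Lemma wcst_0 : @wcst d 0 == w0.
Proof. intros phi. rewrite ev_wcst. unfold ev; simpl. ring. Qed.

(* Expanding over random signs e_1, ..., e_N, the element below is the sum of
   (x + e_1 + ... + e_N) U^(number of negative signs), and
   |y| <= (s + y^2 / s) / 2 reduces its norm to the variance N of the sum. *)
Lemma nb_random_signs (U : W) (s : R) (N : nat) (x : Z) :
  nb U 1 -> 0 < s ->
  nb (wcst x *: wpow (one +: U) N +:
      wcst (Z.of_nat N) *: (one -: U) *: wpow (one +: U) (pred N))
     (2 ^ N * ((s + (IZR x * IZR x + INR N) / s) / 2)).
Proof.
  intros HU Hs. revert x. induction N as [|N IH]; intros x.
  - apply nb_le with (Rabs (IZR x)).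
    + assert (E : wcst x *: wpow (one +: U) 0 +:
        wcst (Z.of_nat 0) *: (one -: U) *: wpow (one +: U) (pred 0) == wcst x).
      { simpl Z.of_nat. simpl wpow. rewrite wcst_0. ring. }
      rewrite E. apply nb_cst.
    + simpl. assert (0 <= (Rabs (IZR x) - s) ^ 2 / s).
      { apply Rle_mult_inv_pos; [apply pow2_ge_0|exact Hs]. }
      assert (E : IZR x * IZR x = Rabs (IZR x) * Rabs (IZR x)).
      { rewrite <- Rabs_mult, Rabs_pos_eq; nra. }
      rewrite E. apply Rminus_le.
      replace (_ - _) with (- ((Rabs (IZR x) - s) ^ 2 / s) / 2) by (field; lra). lra.
  (* Splitting on the new sign, N + 1 signs started at x are N signs started at x + 1 plus U times N
     signs started at x - 1. The two bounds add up exactly, since (x + 1)^2 + (x - 1)^2 = 2 (x^2 +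
     1). *)
  - apply nb_le with (2 ^ N * ((s + (IZR (x + 1) * IZR (x + 1) + INR N) / s) / 2)
       + 1 * (2 ^ N * ((s + (IZR (x - 1) * IZR (x - 1) + INR N) / s) / 2))).
    + refine (proj2 (nb_proper _ _ _ _ _ eq_refl)
        (nb_add _ _ _ _ (IH (x + 1)%Z) (nb_mul _ _ _ _ HU (IH (x - 1)%Z)))).
      rewrite Nat2Z.inj_succ. unfold Z.succ, Z.sub.
      rewrite !wcst_add. change (@wcst d 1) with one.
      assert (E : @wcst d (-1) == wopp one).
      { intros phi. unfold w1. rewrite ev_wopp, !ev_wcst. ring. }
      rewrite E. destruct N as [|N]; simpl pred; simpl wpow.
      * simpl Z.of_nat. rewrite wcst_0. ring.
      * ring.
    + apply Req_le. rewrite plus_IZR, minus_IZR, S_INR. simpl pow. field. lra.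
Qed.

(** At x = 0 with N + 1 signs the element above is (N + 1)(1 - U)(1 + U)^N, and s = sqrt(N + 1)
    minimises its bound. The decay is thus obtained without estimating binomial coefficients. *)
Lemma nb_diff_binomial (U : W) (N : nat) : nb U 1 ->
  nb ((one -: U) *: wpow (one +: U) N) (2 ^ S N / sqrt (INR (S N))).
Proof.
  intros HU. pose proof (lt_0_INR (S N) (Nat.lt_0_succ N)) as HN.
  pose proof (sqrt_lt_R0 _ HN) as Hs.
  pose proof (nb_random_signs U (sqrt (INR (S N))) (S N) 0 HU Hs) as H.
  assert (H' : nb (wcst (Z.of_nat (S N)) *: ((one -: U) *: wpow (one +: U) N))
                  (2 ^ S N * sqrt (INR (S N)))).
  { assert (E : wcst 0 *: wpow (one +: U) (S N) +:
      wcst (Z.of_nat (S N)) *: (one -: U) *: wpow (one +: U) (pred (S N)) ==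
      wcst (Z.of_nat (S N)) *: ((one -: U) *: wpow (one +: U) N))
      by (rewrite wcst_0; simpl pred; ring).
    rewrite E in H. eapply nb_le; [exact H|]. apply Req_le. f_equal. rewrite <- (sqrt_sqrt (INR (S N))) at 2 by lra. field. lra. }
  apply nb_cst_div in H'; [|rewrite <- INR_IZR_INZ; exact HN].
  eapply nb_le; [exact H'|]. rewrite <- INR_IZR_INZ.
  rewrite <- (sqrt_sqrt (INR (S N))) at 2 by lra. apply Req_le. field. lra.
Qed.

(** * The lazy walk and its differences *)

Definition ui (z : Z) (i : nat) : W := mono (fun j => if Nat.eqb j i then z else 0%Z).

Lemma ui_mul a b i : ui a i *: ui b i == ui (a + b) i.
Proof.
  unfold ui. rewrite mono_add. apply mono_ext. intros j _. destruct (Nat.eqb j i); ring.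
Qed.

Lemma ui_0 i : ui 0 i == one.
Proof. apply mono_0. intros j _. destruct (Nat.eqb j i); reflexivity. Qed.

Lemma nb_ui z i : nb (ui z i) 1.
Proof. apply nb_mono. Qed.

Lemma fLap_wf : wfLP d (fLap d).
Proof.
  constructor; [apply zerovec_length|]. apply Forall_flat_map, Forall_forall. intros i _.
  repeat constructor; simpl; [|rewrite length_map]; apply mk_length.
Qed.

Definition lap : W := mkW (fLap d) fLap_wf.
(** 4d times the step distribution of the walk that stays put with probability 1/2. As 4d - f it
    equals the sum over j of u_j^(-1) (1 + u_j)^2, and its symbol 4d - F lies in [0, 4d]. *)
Definition walk : W := wcst (Z.of_nat (4 * d)) -: lap.

Lemma ev_lap phi : ev (wv lap) phi =
  sumL (seq 0 d) (fun i => ev (wv (wcst 2 -: ui 1 i -: ui (-1) i)) phi).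
Proof.
  simpl wv. unfold fLap. change (?p :: ?l) with ([p] ++ l). rewrite ev_app.
  unfold ev at 2. rewrite sumL_flat_map.
  rewrite (sumL_ext _ (fun i => ev (wv (wcst 2 -: ui 1 i -: ui (-1) i)) phi)
     (fun i => 2 * phi (zerovec d) + sumL
        [((-1)%Z, unitvec d i); ((-1)%Z, map Z.opp (unitvec d i))]
        (fun p => IZR (fst p) * phi (snd p)))).
  - rewrite sumL_plus, sumL_const, length_seq. f_equal. unfold ev; simpl.
    rewrite <- INR_IZR_INZ, Nat.add_0_r, plus_INR. ring.
  - intros i _. rewrite !ev_wsub, ev_wcst. unfold ui. rewrite !ev_mono.
    simpl. change (unitvec d i) with (mk d (fun j => if Nat.eqb j i then 1%Z else 0%Z)).
    replace (map Z.opp (mk d (fun j => if Nat.eqb j i then 1%Z else 0%Z)))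
      with (mk d (fun j => if Nat.eqb j i then (-1)%Z else 0%Z)); [ring|].
    unfold mk. rewrite map_map. apply map_ext. intros j. destruct (Nat.eqb j i); reflexivity.
Qed.

Lemma lap_wsum : lap == wsum d (fun i => wcst 2 -: ui 1 i -: ui (-1) i).
Proof. intros phi. rewrite ev_lap, ev_wsum. reflexivity. Qed.

Lemma two_ones : @wcst d 2 == one +: one.
Proof. intros phi. unfold w1. rewrite ev_wadd, !ev_wcst. ring. Qed.

Definition sq (j : nat) : W := ui (-1) j *: (one +: ui 1 j) *: (one +: ui 1 j).

Lemma ui_inv i : ui (-1) i *: ui 1 i == one.
Proof. rewrite ui_mul. apply ui_0. Qed.

Lemma sq_eq j : sq j == wcst 4 -: (wcst 2 -: ui 1 j -: ui (-1) j).
Proof.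
  transitivity (ui (-1) j +: ui 1 j *: (ui (-1) j *: ui 1 j) +: (ui (-1) j *: ui 1 j)
     +: (ui (-1) j *: ui 1 j)); [unfold sq; ring|].
  change 4%Z with (2 + 2)%Z. rewrite ui_inv, wcst_add, two_ones. ring.
Qed.

Lemma walk_split i : (i < d)%nat ->
  walk == sq i +: wsum d (fun j => if Nat.eqb j i then w0 else sq j).
Proof.
  intros Hi phi. rewrite ev_wadd, ev_wsum. unfold walk.
  rewrite ev_wsub, ev_lap, ev_wcst.
  rewrite <- (sumL_single Nat.eq_dec (seq 0 d) i (fun j => ev (wv (sq j)) phi)).
  2:{ apply seq_NoDup. }
  2:{ apply in_seq. lia. }
  rewrite <- sumL_plus. symmetry.
  rewrite (sumL_ext _ _ (fun j => 4 * phi (zerovec d) -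
      ev (wv (wcst 2 -: ui 1 j -: ui (-1) j)) phi)).
  - rewrite sumL_minus, sumL_const, length_seq, <- INR_IZR_INZ, mult_INR. simpl INR. ring.
  - intros j _. replace (if Nat.eq_dec i j then ev (wv (sq j)) phi else 0) with
      (if Nat.eqb j i then ev (wv (sq j)) phi else 0).
    + rewrite <- (ev_wcst 4 phi), <- ev_wsub, <- (sq_eq j phi).
      destruct (Nat.eqb j i).
      * change (ev (wv (@w0 d)) phi) with 0. ring.
      * ring.
    + destruct (Nat.eq_dec i j) as [->|Hne].
      * rewrite Nat.eqb_refl. reflexivity.
      * destruct (Nat.eqb_spec j i); congruence.
Qed.

Lemma nb_one_plus z i : nb (one +: ui z i) 2.
Proof. apply nb_le with (1 + 1); [apply nb_add; [apply nb_one|apply nb_ui]|lra]. Qed.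

Lemma nb_sq j : nb (sq j) 4.
Proof.
  apply nb_le with (1 * 2 * 2); [|lra].
  repeat apply nb_mul; first [apply nb_ui|apply nb_one_plus].
Qed.

Lemma nb_rest i : (i < d)%nat ->
  nb (wsum d (fun j => if Nat.eqb j i then w0 else sq j)) (4 * INR d - 4).
Proof.
  intros Hi.
  apply nb_le with (sumL (seq 0 d) (fun j => 4 - (if Nat.eq_dec i j then 4 else 0))).
  - apply nb_wsum. intros j _. destruct (Nat.eqb_spec j i) as [->|Hne].
    + intros phi _. unfold ev; simpl. rewrite Rabs_R0.
      destruct (Nat.eq_dec i i); lra.
    + destruct (Nat.eq_dec i j); [congruence|]. rewrite Rminus_0_r. apply nb_sq.
  - rewrite sumL_minus, sumL_const, length_seq.
    rewrite (sumL_single Nat.eq_dec (seq 0 d) i (fun _ => 4)).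
    + lra.
    + apply seq_NoDup.
    + apply in_seq. lia.
Qed.

Lemma nb_walk : (1 <= d)%nat -> nb walk (4 * INR d).
Proof.
  intros Hd. apply (proj2 (nb_proper _ _ (walk_split 0 Hd) _ _ eq_refl)).
  apply nb_le with (4 + (4 * INR d - 4)); [|lra].
  apply nb_add; [apply nb_sq|apply nb_rest, Hd].
Qed.

(** The mean of the argument on the left is x + p, but convexity of 1/sqrt bounds that side from
    below there, so half of the gain p is given up. With y = 1/x <= 1, both sides divided by
    1/sqrt(x) are separated by 1 - p y / 4. *)
Lemma convexity_step p x : 0 <= p <= 1 -> 1 <= x ->
  p / sqrt (x + 1) + (1 - p) / sqrt x <= 1 / sqrt (x + p / 2).
Proof.
  intros Hp Hx. set (y := 1 / x).
  assert (Hy : 0 < y <= 1).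
  { unfold y. split; [apply Rdiv_lt_0_compat; lra|].
    apply (Rmult_le_reg_r x); [lra|]. unfold Rdiv. rewrite Rmult_assoc, Rinv_l; lra. }
  assert (Hxp : 0 < x) by lra.
  pose proof (sqrt_lt_R0 x Hxp) as Hsx.
  assert (E : forall q, x + q = x * (1 + q * y)) by (intros; unfold y; field; lra).
  rewrite (E 1), (E (p / 2)), !sqrt_mult by nra.
  set (a := sqrt (1 + 1 * y)). set (b := sqrt (1 + p / 2 * y)).
  assert (Ha : a * a = 1 + y) by (unfold a; rewrite sqrt_sqrt; lra).
  assert (Hb : b * b = 1 + p / 2 * y) by (unfold b; rewrite sqrt_sqrt; nra).
  assert (Ha0 : 0 < a) by (apply sqrt_lt_R0; lra).
  assert (Hb0 : 0 < b) by (apply sqrt_lt_R0; nra).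
  assert (L1 : 1 / a <= 1 - y / 4).
  { apply (Rmult_le_reg_r a); [lra|]. unfold Rdiv at 1. rewrite Rmult_1_l, Rinv_l by lra.
    apply Rsqr_incr_0_var; [|nra]. unfold Rsqr.
    replace ((1 - y / 4) * a * ((1 - y / 4) * a)) with ((1 - y / 4) ^ 2 * (a * a)) by ring.
    rewrite Ha. assert (0 <= y * (1 - y)) by nra. nra. }
  assert (L2 : 1 - p * y / 4 <= 1 / b).
  { apply (Rmult_le_reg_r b); [lra|]. unfold Rdiv at 2. rewrite Rmult_1_l, Rinv_l by lra.
    assert (b <= 1 + p * y / 4); [|nra].
    apply Rsqr_incr_0_var; [|nra]. unfold Rsqr. rewrite Hb. nra. }
  replace (p / (sqrt x * a) + (1 - p) / sqrt x)
    with ((p * (1 / a) + (1 - p)) / sqrt x) by (field; lra).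
  replace (1 / (sqrt x * b)) with ((1 / b) / sqrt x) by (field; lra).
  apply Rmult_le_compat_r; [left; apply Rinv_0_lt_compat; lra|]. nra.
Qed.

(** A non-idle or idle step belongs to direction i with weight 1/d. Of the two factors 1 + u_i in
    [sq i], one raises the exponent j and the other is bounded by its norm 2; the other directions
    are bounded by 4d - 4. [convexity_step] with p = 1/d turns these two outcomes into a steady
    growth by 1/(2d) of the quantity under the root. The exponent j has to be general because the
    induction on m raises it. *)
Lemma nb_diff_walk i j m : (i < d)%nat ->
  nb ((one -: ui 1 i) *: wpow (one +: ui 1 i) j *: wpow walk m)
     (2 ^ S j * (4 * INR d) ^ m / sqrt (INR (S j) + INR m * (1 / INR d / 2))).
Proof.
  intros Hi. assert (Hd : 1 <= INR d) by (apply (le_INR 1); lia).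
  revert j. induction m as [|m IH]; intros j.
  - assert (E : (one -: ui 1 i) *: wpow (one +: ui 1 i) j *: wpow walk 0 ==
      (one -: ui 1 i) *: wpow (one +: ui 1 i) j) by (simpl wpow; ring).
    rewrite E.
    eapply nb_le; [apply nb_diff_binomial, nb_ui|].
    apply Req_le. simpl (INR 0). rewrite Rmult_0_l, Rplus_0_r. simpl. lra.
  - set (K := wsum d (fun j => if Nat.eqb j i then w0 else sq j)).
    assert (E : (one -: ui 1 i) *: wpow (one +: ui 1 i) j *: wpow walk (S m) ==
      ui (-1) i *: (one +: ui 1 i) *:
        ((one -: ui 1 i) *: wpow (one +: ui 1 i) (S j) *: wpow walk m) +:
      K *: ((one -: ui 1 i) *: wpow (one +: ui 1 i) j *: wpow walk m)).
    { simpl wpow. rewrite (walk_split i Hi) at 1. fold K. unfold sq. ring. }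
    rewrite E. eapply nb_le.
    { apply nb_add.
      - apply nb_mul; [apply nb_mul; [apply nb_ui|apply nb_one_plus]|apply IH].
      - apply nb_mul; [apply nb_rest, Hi|apply IH]. }
    set (x := INR (S j) + INR m * (1 / INR d / 2)).
    assert (Hp : 0 <= 1 / INR d <= 1).
    { split; [left; apply Rdiv_lt_0_compat; lra|].
      apply (Rmult_le_reg_r (INR d)); [lra|]. unfold Rdiv. rewrite Rmult_assoc, Rinv_l; lra. }
    assert (Hx : 1 <= x).
    { unfold x. rewrite S_INR. pose proof (pos_INR j). pose proof (pos_INR m). nra. }
    pose proof (convexity_step (1 / INR d) x Hp Hx) as C.
    replace (INR (S (S j)) + INR m * (1 / INR d / 2)) with (x + 1)
      by (unfold x; rewrite (S_INR (S j)); ring).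
    replace (INR (S j) + INR (S m) * (1 / INR d / 2)) with (x + 1 / INR d / 2)
      by (unfold x; rewrite (S_INR m); field; lra).
    set (P := 2 ^ S j * (4 * INR d) ^ S m).
    assert (HP : 0 <= P) by (apply Rmult_le_pos; apply pow_le; lra).
    apply Rle_trans with (P * (1 / INR d / sqrt (x + 1) + (1 - 1 / INR d) / sqrt x)).
    + apply Req_le. unfold P. simpl pow. field.
      repeat split; try lra; apply Rgt_not_eq, sqrt_lt_R0; lra.
    + replace (P / sqrt (x + 1 / INR d / 2)) with (P * (1 / sqrt (x + 1 / INR d / 2)))
        by (unfold Rdiv; ring).
      apply Rmult_le_compat_l; assumption.
Qed.

(* For [P := walk / (4 d)], a lazy random walk operator, this is the decay
   O(m^(-1/2)) of the norm of [x P^m]. *)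
Definition slow (x : W) : Prop := exists C, 0 <= C /\
  forall m, nb (x *: wpow walk m) (C * (4 * INR d) ^ m / sqrt (INR (S m))).

Global Instance slow_proper : Proper (weq ==> iff) slow.
Proof.
  intros x y H. split; intros [C [HC N]]; exists C; (split; [exact HC|]); intros m;
    [rewrite <- H|rewrite H]; apply N.
Qed.

Lemma slow_add x y : slow x -> slow y -> slow (x +: y).
Proof.
  intros [C [HC Nx]] [D [HD Ny]]. exists (C + D). split; [lra|]. intros m.
  assert (E : (x +: y) *: wpow walk m == x *: wpow walk m +: y *: wpow walk m) by ring.
  rewrite E. eapply nb_le; [apply nb_add; [apply Nx|apply Ny]|].
  apply Req_le. unfold Rdiv. ring.
Qed.

Lemma slow_mul x y B : nb x B -> slow y -> slow (x *: y).
Proof.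
  intros Nx [C [HC Ny]]. exists (B * C). split.
  - apply Rmult_le_pos; [eapply nb_ge0, Nx|exact HC].
  - intros m. assert (E : x *: y *: wpow walk m == x *: (y *: wpow walk m)) by ring.
    rewrite E. eapply nb_le; [apply nb_mul; [exact Nx|apply Ny]|].
    apply Req_le. unfold Rdiv. ring.
Qed.

Lemma slow_0 : slow w0.
Proof.
  exists 0. split; [lra|]. intros m phi _.
  rewrite ev_wmul. unfold ev at 1; simpl. rewrite Rabs_R0. unfold Rdiv. lra.
Qed.

Lemma slow_diff i : (i < d)%nat -> slow (ui 1 i -: one).
Proof.
  intros Hi. assert (Hd : 1 <= INR d) by (apply (le_INR 1); lia).
  (* The factor sqrt(2d) comes from m + 1 <= 2d (1 + m/(2d)). *)
  exists (2 * sqrt (2 * INR d)). split; [apply Rmult_le_pos; [lra|apply sqrt_pos]|].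
  intros m.
  assert (E : (ui 1 i -: one) *: wpow walk m ==
    wopp ((one -: ui 1 i) *: wpow (one +: ui 1 i) 0 *: wpow walk m)) by (simpl wpow; ring).
  rewrite E. apply nb_opp. eapply nb_le; [apply nb_diff_walk, Hi|].
  pose proof (pos_INR m) as Hm. simpl (2 ^ 1). simpl (INR 1).
  set (y := 1 + INR m * (1 / INR d / 2)).
  assert (Hy : INR (S m) <= (2 * INR d) * y).
  { unfold y. rewrite S_INR. replace ((2 * INR d) * (1 + INR m * (1 / INR d / 2)))
      with (2 * INR d + INR m) by (field; lra). lra. }
  assert (Hs : 0 < INR (S m)) by (rewrite S_INR; lra).
  assert (Hy0 : 0 < y) by nra.
  pose proof (sqrt_le_1_alt _ _ Hy) as Hq.
  rewrite sqrt_mult in Hq by lra.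
  pose proof (sqrt_lt_R0 _ Hs). pose proof (sqrt_lt_R0 _ Hy0).
  pose proof (pow_lt (4 * INR d) m ltac:(lra)) as HP.
  apply (Rmult_le_reg_r (sqrt y * sqrt (INR (S m)))); [nra|].
  replace (2 * 1 * (4 * INR d) ^ m / sqrt y * (sqrt y * sqrt (INR (S m))))
    with (2 * (4 * INR d) ^ m * sqrt (INR (S m))) by (field; lra).
  replace (2 * sqrt (2 * INR d) * (4 * INR d) ^ m / sqrt (INR (S m)) *
    (sqrt y * sqrt (INR (S m)))) with (2 * (4 * INR d) ^ m * (sqrt (2 * INR d) * sqrt y))
    by (field; lra).
  apply Rmult_le_compat_l; lra.
Qed.

Lemma slow_ui z i : (i < d)%nat -> slow (ui z i -: one).
Proof.
  intros Hi.
  assert (P : forall n, slow (ui (Z.of_nat n) i -: one)).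
  { induction n as [|n IH].
    - simpl Z.of_nat. rewrite ui_0.
      assert (E : one -: one == w0) by ring. rewrite E. apply slow_0.
    - rewrite Nat2Z.inj_succ. unfold Z.succ. rewrite <- ui_mul.
      assert (E : ui (Z.of_nat n) i *: ui 1 i -: one ==
        ui (Z.of_nat n) i *: (ui 1 i -: one) +: (ui (Z.of_nat n) i -: one)) by ring.
      rewrite E. apply slow_add; [|exact IH].
      apply slow_mul with 1; [apply nb_ui|apply slow_diff, Hi]. }
  destruct (Z_le_gt_dec 0 z) as [Hz|Hz].
  - rewrite <- (Z2Nat.id z Hz). apply P.
  - assert (E : ui z i -: one == wopp (ui z i) *: (ui (Z.of_nat (Z.to_nat (- z))) i -: one)).
    { rewrite Z2Nat.id by lia. transitivity (ui z i -: ui z i *: ui (- z) i); [|ring].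
      rewrite ui_mul. replace (z + - z)%Z with 0%Z by ring. rewrite ui_0. reflexivity. }
    rewrite E. apply slow_mul with 1; [apply nb_opp, nb_ui|apply P].
Qed.

(** Keeps the first r exponents, so that monomials can be handled one coordinate at a time. *)
Definition trunc (r : nat) (f : nat -> Z) (j : nat) : Z := if Nat.ltb j r then f j else 0%Z.

Lemma mono_trunc_S r f : @mono d (trunc (S r) f) == mono (trunc r f) *: ui (f r) r.
Proof.
  unfold ui. rewrite mono_add. apply mono_ext. intros j _. unfold trunc.
  destruct (Nat.ltb_spec j (S r)), (Nat.ltb_spec j r), (Nat.eqb_spec j r); subst; lia.
Qed.

Lemma mono_trunc_0 f : mono (trunc 0 f) == one.
Proof. apply mono_0. reflexivity. Qed.

Lemma mono_trunc_d f : @mono d (trunc d f) == mono f.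
Proof.
  apply mono_ext. intros i Hi. unfold trunc. destruct (Nat.ltb_spec i d); [reflexivity|lia].
Qed.

Lemma slow_mono f : slow (@mono d f -: one).
Proof.
  rewrite <- (mono_trunc_d f).
  assert (H : forall r, (r <= d)%nat -> slow (mono (trunc r f) -: one)).
  { induction r as [|r IH]; intros Hr.
    - rewrite (mono_trunc_0 f). assert (E : one -: one == w0) by ring. rewrite E. apply slow_0.
    - rewrite mono_trunc_S.
      assert (E : mono (trunc r f) *: ui (f r) r -: one ==
        mono (trunc r f) *: (ui (f r) r -: one) +: (mono (trunc r f) -: one)) by ring.
      rewrite E. apply slow_add; [|apply IH; lia].
      apply slow_mul with 1; [apply nb_mono|apply slow_ui; lia]. }
  apply H. lia.
Qed.

Lemma mk_co n : length n = d -> mk d (co n) = n.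
Proof.
  intros H. apply (pt_ext d); auto using mk_length. intros i Hi. apply co_mk, Hi.
Qed.

Lemma slow_aug x : augI d (wv x) -> slow x.
Proof.
  destruct x as [h wf]. simpl. intros [_ H1].
  (* The tail of a list of augmentation 0 need not have augmentation 0, so the induction subtracts
     the augmentation: what remains is the sum of the a (u^k - 1). *)
  assert (G : forall h wf, slow (mkW h wf -: wcst (eval1 h))).
  { clear. induction h as [|[a k] h IH]; intros wf.
    - assert (E : mkW [] wf -: wcst (eval1 []) == w0).
      { intros phi. rewrite ev_wsub, ev_wcst. unfold ev; simpl. ring. }
      rewrite E. apply slow_0.
    - inversion wf as [|? ? Hk wf']; subst.
      assert (E : mkW ((a, k) :: h) wf -: wcst (eval1 ((a, k) :: h)) ==
        wcst a *: (mono (co k) -: one) +: (mkW h wf' -: wcst (eval1 h))).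
      { intros phi. rewrite ev_wadd, ev_wcst_mul, !ev_wsub. unfold w1.
        rewrite !ev_wcst, ev_mono. simpl in Hk. rewrite mk_co by exact Hk.
        unfold ev; simpl. rewrite plus_IZR. ring. }
      rewrite E. apply slow_add; [|apply IH].
      eapply slow_mul; [apply nb_cst|apply slow_mono]. }
  specialize (G h wf). rewrite H1 in G.
  assert (E : mkW h wf -: wcst 0 == mkW h wf).
  { intros phi. rewrite ev_wsub, ev_wcst. ring. }
  rewrite E in G. exact G.
Qed.

Lemma wpow_add (x : W) n m : wpow x (n + m) == wpow x n *: wpow x m.
Proof. induction n as [|n IH]; simpl; [|rewrite IH]; ring. Qed.

Lemma nb_pow x B n : nb x B -> nb (wpow x n) (B ^ n).
Proof.
  intros H. induction n as [|n IH]; [apply nb_one|]. apply nb_mul; assumption.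
Qed.

(** With m = 3q + r, each of the three factors receives a power q of the walk and decays like
    q^(-1/2); the remaining r <= 2 powers cost only their norm. *)
Lemma nb_triple x y z : (1 <= d)%nat -> slow x -> slow y -> slow z ->
  exists C, 0 <= C /\ forall m,
    nb (x *: y *: z *: wpow walk m)
       (C * (4 * INR d) ^ m / (INR (S m) * sqrt (INR (S m)))).
Proof.
  intros Hd [Cx [Hx Nx]] [Cy [Hy Ny]] [Cz [Hz Nz]].
  assert (Hd' : 1 <= INR d) by (apply (le_INR 1); lia).
  assert (HC : 0 <= Cx * Cy * Cz) by (repeat apply Rmult_le_pos; assumption).
  pose proof (sqrt_pos 3) as H3.
  exists (Cx * Cy * Cz * (3 * sqrt 3)). split; [apply Rmult_le_pos; lra|]. intros m.
  pose proof (Nat.div_mod m 3 ltac:(lia)) as Em.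
  pose proof (Nat.mod_upper_bound m 3 ltac:(lia)) as Hr.
  set (q := (m / 3)%nat) in *. set (r := (m mod 3)%nat) in *.
  assert (Em' : m = (q + (q + (q + r)))%nat) by lia. clear Em.
  assert (E : x *: y *: z *: wpow walk m ==
    (x *: wpow walk q) *: (y *: wpow walk q) *: (z *: wpow walk q) *: wpow walk r).
  { rewrite Em', !wpow_add. ring. }
  rewrite E. eapply nb_le.
  { apply nb_mul; [apply nb_mul; [apply nb_mul; [apply Nx|apply Ny]|apply Nz]|].
    apply nb_pow, nb_walk, Hd. }
  assert (Hq : 0 < INR (S q)) by (apply lt_0_INR; lia).
  assert (Hm : 0 < INR (S m)) by (apply lt_0_INR; lia).
  (* m + 1 <= 3(q + 1) because r <= 2; its power 3/2 produces the constant 3 sqrt 3. *)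
  assert (Hqm : INR (S m) <= 3 * INR (S q)).
  { replace 3 with (INR 3) by (simpl; ring). rewrite <- mult_INR. apply le_INR. lia. }
  pose proof (sqrt_le_1_alt _ _ Hqm) as Hs.
  rewrite sqrt_mult in Hs by lra.
  pose proof (sqrt_lt_R0 _ Hq) as Sq. pose proof (sqrt_lt_R0 _ Hm) as Sm.
  pose proof (sqrt_sqrt (INR (S q)) ltac:(lra)) as Eq.
  set (b := sqrt (INR (S q))) in *. set (c := sqrt (INR (S m))) in *.
  rewrite Em' at 1. rewrite !pow_add. set (P := (4 * INR d) ^ q).
  set (Pr := (4 * INR d) ^ r).
  assert (HP : 0 <= P * P * P * Pr) by
    (unfold P, Pr; repeat apply Rmult_le_pos; apply pow_le; lra).
  apply (Rmult_le_reg_r (b * b * b * (INR (S m) * c)));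
    [repeat apply Rmult_lt_0_compat; assumption|].
  replace (Cx * P / b * (Cy * P / b) * (Cz * P / b) * Pr * (b * b * b * (INR (S m) * c)))
    with (Cx * Cy * Cz * (P * P * P * Pr) * (INR (S m) * c)) by (field; lra).
  replace (Cx * Cy * Cz * (3 * sqrt 3) * (P * (P * (P * Pr))) / (INR (S m) * c) *
    (b * b * b * (INR (S m) * c)))
    with (Cx * Cy * Cz * (P * P * P * Pr) * ((3 * (b * b)) * (sqrt 3 * b))) by (field; lra).
  apply Rmult_le_compat_l; [apply Rmult_le_pos; assumption|].
  rewrite Eq. apply Rmult_le_compat; lra.
Qed.

(* Test [(1 - u_0) x] against the indicator of the half-line {t e_0 : t <= 0}. *)
Lemma coef_zero_bound x B : (1 <= d)%nat ->
  nb ((ui 1 0 -: one) *: x) B -> Rabs (IZR (coef (wv x) (zerovec d))) <= B.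
Proof.
  intros Hd H.
  set (line := fun t : Z => mk d (fun j => if Nat.eqb j 0 then t else 0%Z)).
  set (phi := fun n => if pt_dec n (line (co n 0))
                       then if Z_le_dec (co n 0) 0 then 1 else 0 else 0).
  specialize (H phi). rewrite ev_wmul, ev_wsub in H. unfold w1 in H.
  rewrite ev_wcst in H. unfold ui in H. rewrite ev_mono in H.
  rewrite Rmult_1_l, <- ev_minus in H.
  (* phi(e_0 + k) - phi(k) is -1 at k = 0 and 0 elsewhere: a unit step leaves the half-line only
     from its end point, and off the line both values vanish. *)
  replace (IZR (coef (wv x) (zerovec d))) with (- ev (wv x) (fun k =>
     phi (vadd (mk d (fun j => if Nat.eqb j 0 then 1%Z else 0%Z)) k) -
     phi (vadd (zerovec d) k))).
  - rewrite Rabs_Ropp. apply H. intros n. unfold phi.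
    destruct pt_dec; [destruct Z_le_dec|]; rewrite ?Rabs_R0, ?Rabs_R1; lra.
  - rewrite coef_ev.
    replace (- ev _ _) with (-1 * ev (wv x) (fun k =>
     phi (vadd (mk d (fun j => if Nat.eqb j 0 then 1%Z else 0%Z)) k) -
     phi (vadd (zerovec d) k))) by ring. rewrite <- ev_scal.
    apply (ev_ext d); [apply wwf|]. intros k Hk. rewrite vadd_zero by exact Hk.
    change (mk d (fun j => if Nat.eqb j 0 then 1%Z else 0%Z)) with (line 1%Z).
    assert (Hl : forall t, length (line t) = d) by (intros; apply mk_length).
    assert (L0 : forall t, co (line t) 0 = t) by (intros; unfold line; rewrite co_mk; [reflexivity|lia]).
    assert (L1 : forall t j, (j < d)%nat -> j <> 0%nat -> co (line t) j = 0%Z).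
    { intros t j Hj Hne. unfold line. rewrite co_mk by exact Hj.
      destruct (Nat.eqb_spec j 0); [contradiction|reflexivity]. }
    assert (C0 : co (vadd (line 1%Z) k) 0 = (1 + co k 0)%Z)
      by (rewrite (vadd_co d), L0; auto; lia).
    unfold phi. rewrite C0.
    destruct (pt_dec k (line (co k 0))) as [Ek|Nk].
    + destruct (pt_dec (vadd (line 1%Z) k) (line (1 + co k 0)%Z)) as [_|N].
      2:{ exfalso. apply N. apply (pt_ext d); auto using vadd_length.
          intros j Hj. rewrite (vadd_co d) by auto.
          destruct (Nat.eq_dec j 0) as [->|Hne]; [rewrite !L0; reflexivity|].
          rewrite Ek, !L1 by auto. reflexivity. }
      unfold dirac. destruct (pt_dec k (zerovec d)) as [->|Nz].
      * rewrite zerovec_co. destruct Z_le_dec; [lia|]. destruct Z_le_dec; [ring|lia].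
      * destruct (Z_le_dec (1 + co k 0) 0), (Z_le_dec (co k 0) 0); try lia; try ring.
        exfalso. apply Nz. rewrite Ek. replace (co k 0) with 0%Z by lia.
        apply (pt_ext d); auto using zerovec_length. intros j Hj. rewrite zerovec_co.
        destruct (Nat.eq_dec j 0) as [->|Hne]; auto.
    + destruct (pt_dec (vadd (line 1%Z) k) (line (1 + co k 0)%Z)) as [Ev|_].
      1:{ exfalso. apply Nk. apply (pt_ext d); auto. intros j Hj.
          destruct (Nat.eq_dec j 0) as [->|Hne]; [rewrite L0; reflexivity|].
          rewrite L1 by auto. apply (f_equal (fun v => co v j)) in Ev.
          rewrite (vadd_co d), !L1 in Ev; auto. }
      unfold dirac. destruct (pt_dec k (zerovec d)) as [->|_]; [|ring].
      exfalso. apply Nk. rewrite zerovec_co. apply (pt_ext d); auto using zerovec_length.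
      intros j Hj. rewrite zerovec_co. destruct (Nat.eq_dec j 0) as [->|Hne]; auto.
      symmetry; auto.
Qed.

End Decay.

Lemma sum_pow_three_halves M :
  sumL (seq 0 M) (fun m => 1 / (INR (S m) * sqrt (INR (S m)))) <= 3.
Proof.
  (* The correction 2/sqrt(M + 1) makes the induction close, since (n + 1)^(-3/2) <= 2/sqrt(n) -
     2/sqrt(n + 1). The first term gives equality, which fixes the 3. *)
  assert (H : sumL (seq 0 (S M)) (fun m => 1 / (INR (S m) * sqrt (INR (S m))))
              <= 3 - 2 / sqrt (INR (S M))).
  { induction M as [|M IH].
    - unfold sumL. simpl. rewrite sqrt_1. lra.
    - rewrite seq_S, sumL_app.
      change (sumL [(0 + S M)%nat] _) with
        (1 / (INR (S (S M)) * sqrt (INR (S (S M)))) + 0).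
      set (T := sumL _ _) in IH |- *.
      assert (Ha : 0 < INR (S M)) by (apply lt_0_INR; lia).
      assert (Hb : 0 < INR (S (S M))) by (apply lt_0_INR; lia).
      assert (Hab : INR (S (S M)) = INR (S M) + 1) by apply S_INR.
      pose proof (sqrt_lt_R0 _ Ha) as Sa. pose proof (sqrt_lt_R0 _ Hb) as Sb.
      pose proof (sqrt_sqrt _ (Rlt_le _ _ Ha)) as Ea.
      pose proof (sqrt_sqrt _ (Rlt_le _ _ Hb)) as Eb.
      pose proof (sqrt_le_1_alt (INR (S M)) (INR (S (S M))) ltac:(lra)) as L.
      set (a := sqrt (INR (S M))) in *. set (b := sqrt (INR (S (S M)))) in *.
      rewrite <- Eb.
      assert (K : 1 / (b * b * b) <= 2 / a - 2 / b); [|lra].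
      apply (Rmult_le_reg_r (a * b * b * b)); [repeat apply Rmult_lt_0_compat; assumption|].
      replace (1 / (b * b * b) * (a * b * b * b)) with a by (field; lra).
      replace ((2 / a - 2 / b) * (a * b * b * b)) with (2 * b * b * (b - a)) by (field; lra).
      assert (D : (b - a) * (b + a) = 1) by nra.
      assert (b - a >= 0) by lra.
      assert (2 * b * (b - a) >= 1) by nra. nra. }
  destruct M as [|M]; [unfold sumL; simpl; lra|].
  rewrite seq_S, sumL_app in H.
  set (T := sumL (seq 0 (S M)) _) in *.
  assert (0 <= sumL [(0 + S M)%nat] (fun m => 1 / (INR (S m) * sqrt (INR (S m))))).
  { apply sumL_ge0. intros m _. left. assert (0 < INR (S m)) by (apply lt_0_INR; lia).
    apply Rdiv_lt_0_compat; [lra|].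
    apply Rmult_lt_0_compat; [lra|]. apply sqrt_lt_R0; lra. }
  assert (0 < 2 / sqrt (INR (S (S M)))).
  { apply Rdiv_lt_0_compat; [lra|]. apply sqrt_lt_R0, lt_0_INR. lia. }
  lra.
Qed.

(** * Iterated improper integrals *)

Lemma RInt_is_RInt g a b v : Defs.RInt g a b v <-> is_RInt g a b v.
Proof.
  split.
  - intros [pr <-]. rewrite <- RInt_Reals. apply (RInt_correct g a b).
    apply ex_RInt_Reals_1, pr.
  - intros H. assert (E : ex_RInt g a b) by (exists v; exact H).
    exists (ex_RInt_Reals_0 _ _ _ E). rewrite <- RInt_Reals. apply is_RInt_unique, H.
Qed.

Lemma imp_pick g v : ImpInt01 g v -> forall e, 0 < e ->
  exists delta, 0 < delta /\ forall eps, 0 < eps < delta -> eps < / 2 ->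
    exists x, is_RInt g eps (1 - eps) x /\ Rabs (x - v) < e.
Proof.
  intros [Hex Hlim] e He. destruct (Hlim e He) as [delta [Hd H]].
  exists delta. split; [exact Hd|]. intros eps H1 H2.
  destruct (Hex eps ltac:(lra)) as [x Hx]. exists x. split; [apply RInt_is_RInt, Hx|].
  apply (H eps); assumption.
Qed.

Lemma imp_le g g' v v' : ImpInt01 g v -> ImpInt01 g' v' ->
  (forall s, 0 < s < 1 -> g s <= g' s) -> v <= v'.
Proof.
  intros H H' L. apply le_epsilon. intros e He.
  destruct (imp_pick _ _ H (e / 2) ltac:(lra)) as [a [Ha Pa]].
  destruct (imp_pick _ _ H' (e / 2) ltac:(lra)) as [b [Hb Pb]].
  set (eps := Rmin (/ 2) (Rmin a b) / 2).
  assert (He' : 0 < eps /\ eps < a /\ eps < b /\ eps < / 2).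
  { unfold eps, Rmin. repeat destruct Rle_dec; lra. }
  destruct (Pa eps ltac:(lra) ltac:(lra)) as [x [Hx Lx]].
  destruct (Pb eps ltac:(lra) ltac:(lra)) as [y [Hy Ly]].
  assert (x <= y).
  { apply (is_RInt_le g g' eps (1 - eps)); auto; [lra|]. intros s Hs. apply L. lra. }
  apply Rabs_def2 in Lx. apply Rabs_def2 in Ly. lra.
Qed.

Lemma imp_lin g g' v v' a b : ImpInt01 g v -> ImpInt01 g' v' ->
  ImpInt01 (fun s => a * g s + b * g' s) (a * v + b * v').
Proof.
  intros H H'.
  assert (Hlin : forall eps x y, is_RInt g eps (1 - eps) x -> is_RInt g' eps (1 - eps) y ->
    is_RInt (fun s => a * g s + b * g' s) eps (1 - eps) (a * x + b * y)).
  { intros eps x y Hx Hy.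
    apply (is_RInt_plus (fun s => a * g s) (fun s => b * g' s));
      apply (is_RInt_scal (V := R_NormedModule)); assumption. }
  split.
  - intros eps He. destruct (proj1 H eps He) as [x Hx]. destruct (proj1 H' eps He) as [y Hy].
    exists (a * x + b * y). apply RInt_is_RInt, Hlin; apply RInt_is_RInt; assumption.
  - intros e He. pose proof (Rabs_pos a) as Pa. pose proof (Rabs_pos b) as Pb.
    set (K := Rabs a + Rabs b + 1).
    assert (HeK : 0 < e / K) by (apply Rdiv_lt_0_compat; unfold K; lra).
    destruct (imp_pick _ _ H _ HeK) as [d1 [Hd1 P1]].
    destruct (imp_pick _ _ H' _ HeK) as [d2 [Hd2 P2]].
    exists (Rmin d1 d2). split; [apply Rmin_glb_lt; assumption|].
    intros eps z [He1 He2] He3 Hz.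
    pose proof (Rmin_l d1 d2). pose proof (Rmin_r d1 d2).
    destruct (P1 eps ltac:(lra) He3) as [x [Hx Lx]].
    destruct (P2 eps ltac:(lra) He3) as [y [Hy Ly]].
    apply RInt_is_RInt in Hz.
    rewrite <- (is_RInt_unique _ _ _ _ Hz), (is_RInt_unique _ _ _ _ (Hlin _ _ _ Hx Hy)).
    replace (a * x + b * y - (a * v + b * v')) with (a * (x - v) + b * (y - v')) by ring.
    eapply Rle_lt_trans; [apply Rabs_triang|]. rewrite !Rabs_mult.
    apply Rle_lt_trans with ((Rabs a + Rabs b) * (e / K)); [nra|].
    apply Rlt_le_trans with (K * (e / K)).
    + apply Rmult_lt_compat_r; [exact HeK|unfold K; lra].
    + apply Req_le. field. unfold K. lra.
Qed.

Lemma imp_ext g g' v : (forall s, 0 < s < 1 -> g s = g' s) -> ImpInt01 g v -> ImpInt01 g' v.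
Proof.
  intros E H.
  assert (T : forall eps x, 0 < eps < / 2 ->
    is_RInt g eps (1 - eps) x -> is_RInt g' eps (1 - eps) x).
  { intros eps x He. apply is_RInt_ext. intros s Hs. apply E.
    rewrite Rmin_left, Rmax_right in Hs; lra. }
  split.
  - intros eps He. destruct (proj1 H eps He) as [x Hx]. exists x.
    apply RInt_is_RInt, T; [exact He|]. apply RInt_is_RInt, Hx.
  - intros e He. destruct (imp_pick _ _ H e He) as [d1 [Hd P]]. exists d1. split; [exact Hd|].
    intros eps x H1 H2 Hx. destruct (P eps H1 H2) as [y [Hy Ly]].
    apply RInt_is_RInt in Hx. apply T in Hy; [|lra].
    rewrite <- (is_RInt_unique _ _ _ _ Hx), (is_RInt_unique _ _ _ _ Hy). exact Ly.
Qed.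

Lemma imp_bound g v B : ImpInt01 g v ->
  (forall eps x, 0 < eps < / 2 -> is_RInt g eps (1 - eps) x -> x <= B) -> v <= B.
Proof.
  intros H HB. apply le_epsilon. intros e He.
  destruct (imp_pick _ _ H e He) as [a [Ha P]].
  assert (He' : 0 < Rmin (/ 2) a / 2 /\ Rmin (/ 2) a / 2 < a /\ Rmin (/ 2) a / 2 < / 2).
  { unfold Rmin. destruct Rle_dec; lra. }
  destruct (P _ ltac:(split; apply He') ltac:(apply He')) as [x [Hx Lx]].
  specialize (HB _ _ ltac:(split; apply He') Hx). apply Rabs_def2 in Lx. lra.
Qed.

Lemma imp_continuous g v M : (forall s, continuous g s) ->
  (forall s, 0 <= s <= 1 -> Rabs (g s) <= M) -> is_RInt g 0 1 v -> ImpInt01 g v.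
Proof.
  intros Hc HM Hv.
  assert (Hex : forall a b, ex_RInt g a b)
    by (intros; apply (ex_RInt_continuous (V := R_CompleteNormedModule)); auto).
  assert (HM0 : 0 <= M) by (eapply Rle_trans; [apply Rabs_pos|apply (HM 0); lra]).
  split.
  - intros eps _. destruct (Hex eps (1 - eps)) as [x Hx]. exists x. apply RInt_is_RInt, Hx.
  - intros e He. exists (e / (2 * M + 1)). split; [apply Rdiv_lt_0_compat; lra|].
    intros eps x [H1 H2] H3 Hx. apply RInt_is_RInt in Hx.
    destruct (Hex 0 eps) as [y Hy]. destruct (Hex (1 - eps) 1) as [z Hz].
    assert (Ev : v = y + x + z).
    { rewrite <- (is_RInt_unique _ _ _ _ Hv). apply is_RInt_unique.
      apply (is_RInt_Chasles g 0 (1 - eps) 1); [|exact Hz].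
      apply (is_RInt_Chasles g 0 eps (1 - eps)); assumption. }
    assert (Ly : Rabs y <= eps * M).
    { replace (eps * M) with ((eps - 0) * M) by ring.
      apply (norm_RInt_le_const g 0 eps y M); [lra| |exact Hy].
      intros s Hs. apply HM. lra. }
    assert (Lz : Rabs z <= eps * M).
    { replace (eps * M) with ((1 - (1 - eps)) * M) by ring.
      apply (norm_RInt_le_const g (1 - eps) 1 z M); [lra| |exact Hz].
      intros s Hs. apply HM. lra. }
    rewrite Ev. replace (x - (y + x + z)) with (- (y + z)) by ring. rewrite Rabs_Ropp.
    eapply Rle_lt_trans; [apply Rabs_triang|].
    apply Rle_lt_trans with (eps * (2 * M + 1)); [nra|].
    apply Rlt_le_trans with (e / (2 * M + 1) * (2 * M + 1)).
    + apply Rmult_lt_compat_r; lra.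
    + apply Req_le. field. lra.
Qed.

Lemma imp_const c : ImpInt01 (fun _ => c) c.
Proof.
  apply imp_continuous with (Rabs c).
  - intros s. apply continuous_const.
  - intros; lra.
  - evar_last; [apply (is_RInt_const 0 1 c)|].
    unfold scal; simpl; unfold mult; simpl; ring.
Qed.

(** For a nonnegative integrand the truncated integrals grow as eps decreases, so their supremum is
    the improper integral. *)
Lemma imp_exist_nonneg h B : (forall s, 0 < s < 1 -> continuous h s) ->
  (forall s, 0 < s < 1 -> 0 <= h s) ->
  (forall eps x, 0 < eps < / 2 -> is_RInt h eps (1 - eps) x -> x <= B) ->
  exists v, ImpInt01 h v.
Proof.
  intros Hc Hpos HB.
  assert (Hex : forall a b, 0 < a <= b -> b < 1 -> ex_RInt h a b).
  { intros a b Ha Hb. apply (ex_RInt_continuous (V := R_CompleteNormedModule)).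
    intros z Hz. rewrite Rmin_left, Rmax_right in Hz by lra. apply Hc. lra. }
  set (E := fun x => exists eps, 0 < eps < / 2 /\ is_RInt h eps (1 - eps) x).
  destruct (completeness E) as [v [Hub Hlub]].
  { exists B. intros x [eps [He Hx]]. apply (HB eps); assumption. }
  { destruct (Hex (/ 4) (1 - / 4)) as [x Hx]; try lra. exists x, (/ 4). split; [lra|exact Hx]. }
  exists v. split.
  - intros eps He. destruct (Hex eps (1 - eps)) as [x Hx]; try lra.
    exists x. apply RInt_is_RInt, Hx.
  - intros e He.
    destruct (classic (exists x, E x /\ v - e < x)) as [[x0 [[eps0 [He0 Hx0]] Lx0]]|N].
    + exists eps0. split; [lra|]. intros eps x [H1 H2] H3 Hx. apply RInt_is_RInt in Hx.
      assert (x <= v) by (apply Hub; exists eps; split; [lra|exact Hx]).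
      destruct (Hex eps eps0) as [y Hy]; try lra.
      destruct (Hex (1 - eps0) (1 - eps)) as [z Hz]; try lra.
      assert (Ev : x = y + x0 + z).
      { rewrite <- (is_RInt_unique _ _ _ _ Hx). apply is_RInt_unique.
        apply (is_RInt_Chasles h eps (1 - eps0) (1 - eps)); [|exact Hz].
        apply (is_RInt_Chasles h eps eps0 (1 - eps0)); assumption. }
      assert (0 <= y).
      { apply (is_RInt_ge_0 h eps eps0); [lra|exact Hy|]. intros s Hs. apply Hpos. lra. }
      assert (0 <= z).
      { apply (is_RInt_ge_0 h (1 - eps0) (1 - eps)); [lra|exact Hz|].
        intros s Hs. apply Hpos. lra. }
      apply Rabs_def1; lra.
    + exfalso. assert (v <= v - e); [|lra]. apply Hlub. intros x Hx.
      destruct (Rle_dec x (v - e)) as [L|L]; [exact L|].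
      exfalso. apply N. exists x. split; [exact Hx|lra].
Qed.

(* An integrable majorant of the singularities at both ends of (0,1), the sum of the
   powers s^(-3/4) and (1-s)^(-3/4). *)
Definition qrt (s : R) : R := sqrt (sqrt s).
Definition end_majorant (s : R) : R := / (qrt s ^ 3) + / (qrt (1 - s) ^ 3).

Lemma qrt_pos s : 0 < s -> 0 < qrt s.
Proof. intros H. apply sqrt_lt_R0, sqrt_lt_R0, H. Qed.

Lemma qrt_pow4 s : 0 <= s -> qrt s ^ 4 = s.
Proof.
  intros H. unfold qrt. replace (sqrt (sqrt s) ^ 4)
    with ((sqrt (sqrt s) * sqrt (sqrt s)) * (sqrt (sqrt s) * sqrt (sqrt s))) by ring.
  rewrite (sqrt_sqrt (sqrt s)) by apply sqrt_pos. apply sqrt_sqrt, H.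
Qed.

Lemma qrt_le1 s : s <= 1 -> qrt s <= 1.
Proof.
  intros H. rewrite <- sqrt_1. apply sqrt_le_1_alt. rewrite <- sqrt_1.
  apply sqrt_le_1_alt, H.
Qed.

Lemma qrt_derive s : 0 < s -> is_derive (fun x => 4 * qrt x) s (/ (qrt s ^ 3)).
Proof.
  intros H. unfold qrt. pose proof (sqrt_lt_R0 s H) as H1.
  pose proof (sqrt_lt_R0 _ H1) as H2. auto_derive; [tauto|].
  rewrite <- (sqrt_sqrt (sqrt s)) at 1 by lra. field. lra.
Qed.

Lemma qrt_derive' s : s < 1 ->
  is_derive (fun x => - (4 * qrt (1 - x))) s (/ (qrt (1 - s) ^ 3)).
Proof.
  intros H. assert (H0 : 0 < 1 - s) by lra.
  evar_last.
  - apply (is_derive_opp (fun x => 4 * qrt (1 - x))).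
    apply (is_derive_comp (fun x => 4 * qrt x) (fun x => 1 - x)).
    + apply qrt_derive, H0.
    + auto_derive; [exact I|reflexivity].
  - unfold scal, opp; simpl. unfold mult; simpl. ring.
Qed.

Lemma qrt_continuous s : 0 < s -> continuous (fun x => / (qrt x ^ 3)) s.
Proof.
  intros H. apply (ex_derive_continuous (V := R_NormedModule)). unfold qrt.
  pose proof (sqrt_lt_R0 s H) as H1. pose proof (sqrt_lt_R0 _ H1) as H2.
  auto_derive. repeat split; auto. apply Rgt_not_eq, (pow_lt _ 3), H2.
Qed.

Lemma qrt_continuous' s : s < 1 -> continuous (fun x => / (qrt (1 - x) ^ 3)) s.
Proof.
  intros H. apply (continuous_comp (fun x => 1 - x) (fun x => / (qrt x ^ 3))).
  - apply (ex_derive_continuous (V := R_NormedModule)). auto_derive. exact I.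
  - apply qrt_continuous. lra.
Qed.

Lemma end_majorant_continuous s : 0 < s < 1 -> continuous end_majorant s.
Proof.
  intros H. apply (continuous_plus (fun x => / (qrt x ^ 3)) (fun x => / (qrt (1 - x) ^ 3))).
  - apply qrt_continuous. lra.
  - apply qrt_continuous'. lra.
Qed.

Lemma end_majorant_ge s m : 0 < s < 1 -> m = Rmin s (1 - s) -> / (qrt m ^ 3) <= end_majorant s.
Proof.
  intros H ->. unfold end_majorant.
  assert (0 < / (qrt s ^ 3)) by (apply Rinv_0_lt_compat, pow_lt, qrt_pos; lra).
  assert (0 < / (qrt (1 - s) ^ 3)) by (apply Rinv_0_lt_compat, pow_lt, qrt_pos; lra).
  unfold Rmin. destruct Rle_dec; lra.
Qed.

Lemma end_majorant_ge1 s : 0 < s < 1 -> 1 <= end_majorant s.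
Proof.
  intros H. eapply Rle_trans; [|apply (end_majorant_ge s _ H eq_refl)].
  assert (Hm : 0 < Rmin s (1 - s) <= 1) by (unfold Rmin; destruct Rle_dec; lra).
  pose proof (qrt_pos _ (proj1 Hm)) as H1. pose proof (qrt_le1 _ (proj2 Hm)) as H2.
  rewrite <- Rinv_1 at 1. apply Rinv_le_contravar; [apply pow_lt, H1|].
  eapply Rle_trans; [apply (pow_incr _ 1 3); lra|]. rewrite pow1. lra.
Qed.

(** s^(-3/4) has the primitive 4 s^(1/4), so each of the two ends contributes at most 4. *)
Lemma end_majorant_int eps x : 0 < eps < / 2 -> is_RInt end_majorant eps (1 - eps) x -> x <= 8.
Proof.
  intros He Hx.
  assert (I1 : is_RInt (fun s => / (qrt s ^ 3)) eps (1 - eps)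
                 (4 * qrt (1 - eps) - 4 * qrt eps)).
  { apply (is_RInt_derive (V := R_CompleteNormedModule) (fun x => 4 * qrt x));
      intros z Hz; rewrite Rmin_left, Rmax_right in Hz by lra.
    - apply qrt_derive. lra.
    - apply qrt_continuous. lra. }
  assert (I2 : is_RInt (fun s => / (qrt (1 - s) ^ 3)) eps (1 - eps)
                 (- (4 * qrt (1 - (1 - eps))) - - (4 * qrt (1 - eps)))).
  { apply (is_RInt_derive (V := R_CompleteNormedModule) (fun x => - (4 * qrt (1 - x))));
      intros z Hz; rewrite Rmin_left, Rmax_right in Hz by lra.
    - apply qrt_derive'. lra.
    - apply qrt_continuous'. lra. }
  pose proof (is_RInt_plus _ _ _ _ _ _ I1 I2) as I3.
  change (is_RInt end_majorant eps (1 - eps)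
    (4 * qrt (1 - eps) - 4 * qrt eps + (- (4 * qrt (1 - (1 - eps))) - - (4 * qrt (1 - eps)))))
    in I3.
  rewrite <- (is_RInt_unique _ _ _ _ Hx), (is_RInt_unique _ _ _ _ I3).
  pose proof (qrt_le1 (1 - eps) ltac:(lra)). pose proof (qrt_pos eps ltac:(lra)).
  replace (1 - (1 - eps)) with eps by ring.
  lra.
Qed.

(** Adding C times the majorant makes g nonnegative with bounded truncated integrals; the integral
    of the majorant is subtracted afterwards. *)
Lemma imp_exist_majorant g C : (forall s, 0 < s < 1 -> continuous g s) ->
  (forall s, 0 < s < 1 -> Rabs (g s) <= C * end_majorant s) -> exists v, ImpInt01 g v.
Proof.
  intros Hc HC.
  assert (HC0 : 0 <= C).
  { pose proof (HC (/ 2) ltac:(lra)). pose proof (Rabs_pos (g (/ 2))).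
    pose proof (end_majorant_ge1 (/ 2) ltac:(lra)). nra. }
  destruct (imp_exist_nonneg end_majorant 8) as [v1 H1].
  - apply end_majorant_continuous.
  - intros s Hs. pose proof (end_majorant_ge1 s Hs). lra.
  - apply end_majorant_int.
  - destruct (imp_exist_nonneg (fun s => g s + C * end_majorant s) (2 * C * 8)) as [v2 H2].
    + intros s Hs. apply (continuous_plus g (fun s => C * end_majorant s)); [apply Hc, Hs|].
      apply (continuous_scal_r (V := R_NormedModule) C end_majorant s), end_majorant_continuous, Hs.
    + intros s Hs. specialize (HC s Hs). pose proof (Rle_abs (- g s)) as L.
      rewrite Rabs_Ropp in L. lra.
    + intros eps x He Hx.
      assert (Hex : ex_RInt end_majorant eps (1 - eps)).
      { apply (ex_RInt_continuous (V := R_CompleteNormedModule)).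
        intros z Hz. rewrite Rmin_left, Rmax_right in Hz by lra.
        apply end_majorant_continuous. lra. }
      destruct Hex as [y Hy]. pose proof (end_majorant_int eps y He Hy).
      apply Rle_trans with (2 * C * y); [|nra].
      apply (is_RInt_le (fun s => g s + C * end_majorant s) (fun s => 2 * C * end_majorant s)
               eps (1 - eps)); [lra|exact Hx| |].
      * apply (is_RInt_scal (V := R_NormedModule) end_majorant eps (1 - eps) (2 * C)), Hy.
      * intros s Hs. specialize (HC s ltac:(lra)). pose proof (Rle_abs (g s)). lra.
    + exists (1 * v2 + (- C) * v1).
      eapply imp_ext; [|apply (imp_lin _ _ _ _ 1 (- C) H2 H1)]. intros s _. simpl. ring.
Qed.

(** * Integration over the cube: comparison, linearity and existence *)

Definition in_cube (k : nat) (t : nat -> R) : Prop := forall j, (j < k)%nat -> 0 < t j < 1.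

Lemma in_cube_upd k t s : in_cube k t -> 0 < s < 1 -> in_cube (S k) (upd t k s).
Proof.
  intros H Hs j Hj. unfold upd. destruct (Nat.eqb_spec j k); [exact Hs|apply H; lia].
Qed.

Lemma cube_le k f f' v v' : CubeInt k f v -> CubeInt k f' v' ->
  (forall t, in_cube k t -> f t <= f' t) -> v <= v'.
Proof.
  revert f f' v v'. induction k as [|k IH]; simpl; intros f f' v v' H H' L.
  - subst. apply L. intros j Hj. lia.
  - destruct H as [g [Hg Ig]]. destruct H' as [g' [Hg' Ig']].
    apply (imp_le _ _ _ _ Ig Ig'). intros s Hs.
    apply (IH _ _ _ _ (Hg s Hs) (Hg' s Hs)). intros t Ht. apply L, in_cube_upd; assumption.
Qed.

(** [CubeInt] is a relation, so every identity between integrals is drawn from this lemma or from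
    the comparison behind it, by computing on the open cube only. *)
Lemma cube_unique k f f' v v' : CubeInt k f v -> CubeInt k f' v' ->
  (forall t, in_cube k t -> f t = f' t) -> v = v'.
Proof.
  intros H H' E. apply Rle_antisym.
  - apply (cube_le _ _ _ _ _ H H'). intros t Ht. rewrite E by exact Ht. lra.
  - apply (cube_le _ _ _ _ _ H' H). intros t Ht. rewrite E by exact Ht. lra.
Qed.

Lemma cube_ext k f f' v : (forall t, in_cube k t -> f t = f' t) ->
  CubeInt k f v -> CubeInt k f' v.
Proof.
  revert f f' v. induction k as [|k IH]; simpl; intros f f' v E H.
  - subst. apply E. intros j Hj. lia.
  - destruct H as [g [Hg Ig]]. exists g. split; [|exact Ig]. intros s Hs.
    apply IH with (2 := Hg s Hs). intros t Ht. apply E, in_cube_upd; assumption.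
Qed.

Lemma cube_lin k f f' v v' a b : CubeInt k f v -> CubeInt k f' v' ->
  CubeInt k (fun t => a * f t + b * f' t) (a * v + b * v').
Proof.
  revert f f' v v'. induction k as [|k IH]; simpl; intros f f' v v' H H'.
  - subst. reflexivity.
  - destruct H as [g [Hg Ig]]. destruct H' as [g' [Hg' Ig']].
    exists (fun s => a * g s + b * g' s). split.
    + intros s Hs. apply (IH (fun t => f (upd t k s)) (fun t => f' (upd t k s))); auto.
    + apply imp_lin; assumption.
Qed.

Lemma cube_const k c : CubeInt k (fun _ => c) c.
Proof.
  induction k as [|k IH]; [reflexivity|]. exists (fun _ => c).
  split; [intros; exact IH|apply imp_const].
Qed.

Lemma cube_sumL {A} k (S : list A) (f : A -> (nat -> R) -> R) v :
  (forall x, In x S -> CubeInt k (f x) (v x)) ->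
  CubeInt k (fun t => sumL S (fun x => f x t)) (sumL S v).
Proof.
  induction S as [|x S IH]; intros H.
  - exact (cube_const k 0).
  - replace (sumL (x :: S) v) with (1 * v x + 1 * sumL S v) by (unfold sumL; simpl; ring).
    eapply cube_ext; [|apply cube_lin; [apply H; left; reflexivity|
      apply IH; intros y Hy; apply H; right; exact Hy]].
    intros t _. unfold sumL; simpl. ring.
Qed.

Lemma cube_scal k f v a : CubeInt k f v -> CubeInt k (fun t => a * f t) (a * v).
Proof.
  intros H. replace (a * v) with (a * v + 0 * v) by ring.
  eapply cube_ext; [|apply cube_lin; exact H]. intros t _. simpl. ring.
Qed.

Lemma cube_ev k h (f : pt -> (nat -> R) -> R) v :
  (forall p, In p h -> CubeInt k (f (snd p)) (v (snd p))) ->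
  CubeInt k (fun t => ev h (fun n => f n t)) (ev h v).
Proof. intros H. apply cube_sumL. intros p Hp. apply cube_scal, H, Hp. Qed.

Fixpoint prodk (k : nat) (t : nat -> R) : R :=
  match k with O => 1 | S k => end_majorant (t k) * prodk k t end.

Lemma prodk_upd k i t s : (k <= i)%nat -> prodk k (upd t i s) = prodk k t.
Proof.
  induction k as [|k IH]; intros H; simpl; [reflexivity|].
  rewrite IH by lia. unfold upd at 1. destruct (Nat.eqb_spec k i); [lia|reflexivity].
Qed.

Lemma prodk_ge1 k t : in_cube k t -> 1 <= prodk k t.
Proof.
  induction k as [|k IH]; intros H; simpl; [lra|].
  pose proof (end_majorant_ge1 (t k) (H k ltac:(lia))).
  assert (1 <= prodk k t) by (apply IH; intros j Hj; apply H; lia). nra.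
Qed.

Lemma prodk_mono k i t : (k <= i)%nat -> in_cube i t -> prodk k t <= prodk i t.
Proof.
  intros Hk. induction Hk as [|i Hk IH]; intros H; [lra|]. simpl.
  assert (Hi : in_cube i t) by (intros j Hj; apply H; lia).
  pose proof (end_majorant_ge1 (t i) (H i ltac:(lia))).
  pose proof (prodk_ge1 i t Hi). specialize (IH Hi). nra.
Qed.

(** Each variable contributes the factor 8 of [end_majorant_int]. The constant C is general because
    the outer variables are absorbed into it one after the other. *)
Lemma cube_bound k f v C : 0 <= C -> CubeInt k f v ->
  (forall t, in_cube k t -> f t <= C * prodk k t) -> v <= C * 8 ^ k.
Proof.
  revert f v C. induction k as [|k IH]; simpl; intros f v C HC H L.
  - subst. specialize (L (fun _ => 0) ltac:(intros j Hj; lia)). lra.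
  - destruct H as [g [Hg Ig]]. apply (imp_bound _ _ _ Ig). intros eps x He Hx.
    assert (Hex : ex_RInt end_majorant eps (1 - eps)).
    { apply (ex_RInt_continuous (V := R_CompleteNormedModule)).
      intros z Hz. rewrite Rmin_left, Rmax_right in Hz by lra.
      apply end_majorant_continuous. lra. }
    destruct Hex as [y Hy]. pose proof (end_majorant_int eps y He Hy) as Ly.
    pose proof (pow_lt 8 k ltac:(lra)) as P8.
    apply Rle_trans with (C * 8 ^ k * y).
    + apply (is_RInt_le g (fun s => C * 8 ^ k * end_majorant s) eps (1 - eps));
        [lra|exact Hx| |].
      * apply (is_RInt_scal (V := R_NormedModule) end_majorant eps (1 - eps) (C * 8 ^ k)), Hy.
      * intros s Hs.
        assert (Hm : 1 <= end_majorant s) by (apply end_majorant_ge1; lra).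
        replace (C * 8 ^ k * end_majorant s) with (C * end_majorant s * 8 ^ k) by ring.
        apply (IH _ _ (C * end_majorant s) ltac:(nra) (Hg s ltac:(lra))).
        intros t Ht. eapply Rle_trans; [apply L, in_cube_upd; [exact Ht|lra]|].
        rewrite prodk_upd by lia. unfold upd. rewrite Nat.eqb_refl. lra.
    + replace (C * (8 * 8 ^ k)) with (C * 8 ^ k * 8) by ring.
      apply Rmult_le_compat_l; [nra|exact Ly].
Qed.

Definition l1dist (k : nat) (t t' : nat -> R) : R := sumL (seq 0 k) (fun j => Rabs (t j - t' j)).

Lemma l1dist_upd k t t' s s' :
  l1dist (S k) (upd t k s) (upd t' k s') = l1dist k t t' + Rabs (s - s').
Proof.
  unfold l1dist. rewrite seq_S, sumL_app. f_equal.
  - apply sumL_ext. intros j Hj. apply in_seq in Hj. unfold upd.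
    destruct (Nat.eqb_spec j k); [lia|reflexivity].
  - unfold sumL; simpl. unfold upd. rewrite Nat.eqb_refl. ring.
Qed.

Lemma l1dist_refl k t : l1dist k t t = 0.
Proof.
  apply sumL_zero. intros j _. replace (t j - t j) with 0 by ring. apply Rabs_R0.
Qed.

Lemma cube_diff k f f' v v' K : CubeInt k f v -> CubeInt k f' v' ->
  (forall t, in_cube k t -> Rabs (f t - f' t) <= K) -> Rabs (v - v') <= K.
Proof.
  intros H H' L.
  assert (Hlin : CubeInt k (fun t => 1 * f t + -1 * f' t) (1 * v + -1 * v'))
    by (apply cube_lin; assumption).
  apply Rabs_le. split.
  - apply Rle_trans with (1 * v + -1 * v'); [|lra].
    apply (cube_le _ _ _ _ _ (cube_const k (- K)) Hlin). intros t Ht.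
    specialize (L t Ht). apply Rabs_le_between in L. lra.
  - apply Rle_trans with (1 * v + -1 * v'); [lra|].
    apply (cube_le _ _ _ _ _ Hlin (cube_const k K)). intros t Ht.
    specialize (L t Ht). apply Rabs_le_between in L. lra.
Qed.

Lemma lipschitz_continuous g s a b K : a < s < b ->
  (forall x y, a < x < b -> a < y < b -> Rabs (g x - g y) <= K * Rabs (x - y)) ->
  continuous g s.
Proof.
  intros Hs HK. apply continuity_pt_filterlim. intros e He.
  set (K' := Rabs K + 1). assert (HK' : 0 < K') by (unfold K'; pose proof (Rabs_pos K); lra).
  exists (Rmin (e / K') (Rmin (s - a) (b - s))). split.
  - repeat apply Rmin_glb_lt; try lra. apply Rdiv_lt_0_compat; lra.
  - intros x [_ Hx]. simpl in *. unfold Rdist in *.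
    pose proof (Rmin_l (e / K') (Rmin (s - a) (b - s))) as M1.
    pose proof (Rmin_r (e / K') (Rmin (s - a) (b - s))) as M2.
    pose proof (Rmin_l (s - a) (b - s)). pose proof (Rmin_r (s - a) (b - s)).
    assert (Hxab : a < x < b) by (assert (T := Rabs_def2 _ _ Hx); lra).
    eapply Rle_lt_trans; [apply HK; assumption|].
    pose proof (Rabs_pos (x - s)). pose proof (Rle_abs K).
    apply Rle_lt_trans with (K' * Rabs (x - s)); [unfold K'; nra|].
    apply Rlt_le_trans with (K' * (e / K')).
    + apply Rmult_lt_compat_l; lra.
    + apply Req_le. field. lra.
Qed.

(** A Lipschitz bound passes to partial integrals with the same constant K, since the cube has
    volume 1. Plain continuity would not carry the induction this directly. *)
Lemma cube_exist_lipschitz k f K :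
  (forall t t', Rabs (f t - f t') <= K * l1dist k t t') -> exists v, CubeInt k f v.
Proof.
  revert f. induction k as [|k IH]; intros f L.
  - exists (f (fun _ => 0)). reflexivity.
  - assert (Hg : forall s, exists v, CubeInt k (fun t => f (upd t k s)) v).
    { intros s. apply IH. intros t t'. eapply Rle_trans; [apply L|].
      rewrite l1dist_upd. apply Req_le. replace (s - s) with 0 by ring. rewrite Rabs_R0. ring. }
    set (g := fun s => epsilon (inhabits 0) (fun v => CubeInt k (fun t => f (upd t k s)) v)).
    assert (Gs : forall s, CubeInt k (fun t => f (upd t k s)) (g s))
      by (intros s; apply epsilon_spec, Hg).
    assert (GL : forall s s', Rabs (g s - g s') <= K * Rabs (s - s')).
    { intros s s'. apply (cube_diff _ _ _ _ _ _ (Gs s) (Gs s')). intros t _.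
      eapply Rle_trans; [apply L|]. rewrite l1dist_upd, l1dist_refl. apply Req_le. ring. }
    assert (Gc : forall s, continuous g s).
    { intros s. apply (lipschitz_continuous g s (s - 1) (s + 1) K); [lra|].
      intros; apply GL. }
    destruct (ex_RInt_continuous (V := R_CompleteNormedModule) g 0 1 (fun z _ => Gc z))
      as [v Hv].
    exists v, g. split; [intros; apply Gs|].
    apply imp_continuous with (Rabs (g 0) + Rabs K); auto.
    intros s Hs. replace (g s) with (g 0 + (g s - g 0)) by ring.
    eapply Rle_trans; [apply Rabs_triang|]. apply Rplus_le_compat_l.
    eapply Rle_trans; [apply GL|]. rewrite (Rabs_pos_eq (s - 0)) by lra.
    pose proof (Rle_abs K). pose proof (Rabs_pos K). nra.
Qed.

(** With the outermost variable kept in a compact part of (0,1) the integrand is Lipschitz in all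
    the others, so the inner integrals exist and depend continuously on that variable. The majorant
    is then needed only for the outermost integral, after the inner factors have been integrated to
    8^k. *)
Lemma cube_exist_majorant k f C : 0 <= C ->
  (forall a b, 0 < a -> b < 1 -> exists K, forall t t', a < t k < b -> a < t' k < b ->
     Rabs (f t - f t') <= K * l1dist (S k) t t') ->
  (forall t, in_cube (S k) t -> Rabs (f t) <= C * prodk (S k) t) ->
  exists v, CubeInt (S k) f v.
Proof.
  intros HC L HB.
  assert (Hg : forall s, 0 < s < 1 -> exists v, CubeInt k (fun t => f (upd t k s)) v).
  { intros s Hs. destruct (L (s / 2) ((1 + s) / 2)) as [K HK]; try lra.
    apply cube_exist_lipschitz with K. intros t t'.
    eapply Rle_trans; [apply HK; unfold upd; rewrite Nat.eqb_refl; lra|].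
    rewrite l1dist_upd. apply Req_le. replace (s - s) with 0 by ring. rewrite Rabs_R0. ring. }
  set (g := fun s => epsilon (inhabits 0) (fun v => CubeInt k (fun t => f (upd t k s)) v)).
  assert (Gs : forall s, 0 < s < 1 -> CubeInt k (fun t => f (upd t k s)) (g s))
    by (intros s Hs; apply epsilon_spec, Hg, Hs).
  destruct (imp_exist_majorant g (C * 8 ^ k)) as [v Hv].
  - intros s Hs. destruct (L (s / 2) ((1 + s) / 2)) as [K HK]; try lra.
    apply (lipschitz_continuous g s (s / 2) ((1 + s) / 2) K); [lra|].
    intros x y Hx Hy.
    apply (cube_diff _ _ _ _ _ _ (Gs x ltac:(lra)) (Gs y ltac:(lra))). intros t _.
    eapply Rle_trans; [apply HK; unfold upd; rewrite Nat.eqb_refl; lra|].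
    rewrite l1dist_upd, l1dist_refl. apply Req_le. ring.
  - intros s Hs. pose proof (end_majorant_ge1 s Hs) as Hm.
    assert (HB' : forall t, in_cube k t -> Rabs (f (upd t k s)) <= C * end_majorant s * prodk k t).
    { intros t Ht. eapply Rle_trans; [apply HB, in_cube_upd; assumption|]. simpl.
      rewrite prodk_upd by lia. unfold upd. rewrite Nat.eqb_refl. lra. }
    replace (C * 8 ^ k * end_majorant s) with (C * end_majorant s * 8 ^ k) by ring.
    apply Rabs_le. split.
    + assert (-1 * g s <= C * end_majorant s * 8 ^ k); [|lra].
      apply (cube_bound k _ _ (C * end_majorant s) ltac:(nra) (cube_scal _ _ _ (-1) (Gs s Hs))).
      intros t Ht. specialize (HB' t Ht). apply Rabs_le_between in HB'. lra.
    + apply (cube_bound k _ _ (C * end_majorant s) ltac:(nra) (Gs s Hs)).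
      intros t Ht. specialize (HB' t Ht). apply Rabs_le_between in HB'. lra.
  - exists v, g. split; assumption.
Qed.

Lemma imp_cos c (n : Z) :
  ImpInt01 (fun s => cos (c + 2 * PI * (IZR n * s))) (if Z.eq_dec n 0 then cos c else 0).
Proof.
  apply imp_continuous with 1.
  - intros s. apply (ex_derive_continuous (V := R_NormedModule)). auto_derive. exact I.
  - intros s _. apply Rabs_le, COS_bound.
  - destruct (Z.eq_dec n 0) as [->|Hn].
    + apply (is_RInt_ext (fun _ => cos c)).
      * intros s _. simpl. f_equal. ring.
      * evar_last; [apply (is_RInt_const 0 1 (cos c))|].
        unfold scal; simpl; unfold mult; simpl; ring.
    + assert (Hn' : IZR n <> 0) by (apply not_0_IZR, Hn). pose proof PI_RGT_0 as HPI.
      set (G := fun s => sin (c + 2 * PI * (IZR n * s)) / (2 * PI * IZR n)).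
      replace 0 with (G 1 - G 0) at 2.
      * apply (is_RInt_derive (V := R_CompleteNormedModule) G); intros s _.
        -- unfold G. auto_derive; [exact I|]. field. split; lra.
        -- apply (ex_derive_continuous (V := R_NormedModule)). auto_derive. exact I.
      * unfold G. replace (sin (c + 2 * PI * (IZR n * 1))) with (sin (c + 2 * PI * (IZR n * 0))).
        -- lra.
        -- rewrite Rmult_0_r, Rmult_0_r, Rplus_0_r, Rmult_1_r.
           destruct (Z_le_gt_dec 0 n) as [Hz|Hz].
           ++ rewrite <- (sin_period c (Z.to_nat n)). f_equal.
              rewrite INR_IZR_INZ, Z2Nat.id by exact Hz. ring.
           ++ rewrite <- (sin_period (c + 2 * PI * IZR n) (Z.to_nat (- n))). f_equal.
              rewrite INR_IZR_INZ, Z2Nat.id, opp_IZR by lia. ring.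
Qed.

(** Orthogonality of characters. The phase c is arbitrary so that it can absorb the variable fixed
    by the outermost integral. *)
Lemma cube_cos k c (n : nat -> Z) :
  CubeInt k (fun t => cos (c + 2 * PI * sumL (seq 0 k) (fun j => IZR (n j) * t j)))
    (if forallb (fun j => Z.eqb (n j) 0) (seq 0 k) then cos c else 0).
Proof.
  revert c. induction k as [|k IH]; intros c.
  - simpl. f_equal. unfold sumL; simpl. ring.
  - exists (fun s => if forallb (fun j => Z.eqb (n j) 0) (seq 0 k)
                     then cos (c + 2 * PI * (IZR (n k) * s)) else 0). split.
    + intros s Hs. eapply cube_ext; [|apply IH]. intros t _. cbv beta.
      f_equal. rewrite seq_S, sumL_app.
      assert (E : sumL [(0 + k)%nat] (fun j => IZR (n j) * upd t k s j) = IZR (n k) * s).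
      { unfold sumL; simpl. unfold upd. rewrite Nat.eqb_refl. ring. }
      rewrite E.
      rewrite (sumL_ext (seq 0 k) (fun j => IZR (n j) * upd t k s j) (fun j => IZR (n j) * t j)).
      * ring.
      * intros j Hj. apply in_seq in Hj. unfold upd.
        destruct (Nat.eqb_spec j k); [lia|reflexivity].
    + rewrite seq_S, forallb_app. simpl forallb.
      destruct (forallb _ (seq 0 k)); simpl.
      * rewrite Bool.andb_true_r. pose proof (imp_cos c (n k)) as H.
        destruct (Z.eq_dec (n k) 0), (Z.eqb_spec (n k) 0); congruence || exact H.
      * apply imp_const.
Qed.

(** * The symbol of the Laplacian and the Green function *)

Lemma cos_lipschitz a b : Rabs (cos a - cos b) <= Rabs (a - b).
Proof.
  rewrite <- (Rmult_1_l (Rabs (a - b))).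
  apply (bounded_variation cos (fun x => - sin x)). intros t _. split.
  - apply is_derive_Reals, derivable_pt_lim_cos.
  - rewrite Rabs_Ropp. apply Rabs_le, SIN_bound.
Qed.

Lemma sin_lipschitz a b : Rabs (sin a - sin b) <= Rabs (a - b).
Proof.
  rewrite <- (Rmult_1_l (Rabs (a - b))).
  apply (bounded_variation sin cos). intros t _. split.
  - apply is_derive_Reals, derivable_pt_lim_sin.
  - apply Rabs_le, COS_bound.
Qed.

Lemma sin_le_abs a : Rabs (sin a) <= Rabs a.
Proof.
  pose proof (sin_lipschitz a 0) as H. rewrite sin_0, !Rminus_0_r in H. exact H.
Qed.

Lemma two_minus_two_cos x : 2 - 2 * cos (2 * x) = (2 * sin x) ^ 2.
Proof. rewrite cos_2a_sin. ring. Qed.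

(** Up to PI s = PI/3 the mean value theorem applies with cosine at least 1/2; beyond that the sine
    is at least 1/2 and s is at most 1/2. *)
Lemma sin_PI_lower s : 0 < s <= / 2 -> s <= 2 * sin (PI * s).
Proof.
  intros Hs. pose proof PI2_3_2 as P1. pose proof PI_4 as P4.
  assert (Hx : 0 < PI * s) by nra.
  destruct (Rle_dec (PI * s) (PI / 3)) as [L|L].
  - destruct (MVT_cor2 sin cos 0 (PI * s) Hx) as [c [E Hc]].
    { intros; apply derivable_pt_lim_sin. }
    rewrite sin_0, !Rminus_0_r in E.
    assert (cos (PI / 3) < cos c) by (apply cos_decreasing_1; lra).
    rewrite cos_PI3 in H. rewrite E. nra.
  - assert (sin (PI / 6) <= sin (PI * s)) by (apply sin_incr_1; nra).
    rewrite sin_PI6 in H. lra.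
Qed.

Lemma symbol_term_lower s : 0 < s < 1 -> Rmin s (1 - s) ^ 2 <= 2 - 2 * cos (2 * PI * s).
Proof.
  intros Hs. rewrite Rmult_assoc, two_minus_two_cos. apply pow_incr.
  unfold Rmin. destruct Rle_dec as [L|L].
  - split; [lra|apply sin_PI_lower; lra].
  - split; [lra|]. rewrite <- (sin_PI_x (PI * s)).
    replace (PI - PI * s) with (PI * (1 - s)) by ring. apply sin_PI_lower; lra.
Qed.

Lemma Rabs_cos_le1 a : Rabs (cos a) <= 1.
Proof. apply Rabs_le, COS_bound. Qed.

Lemma Rabs_sin_le1 a : Rabs (sin a) <= 1.
Proof. apply Rabs_le, SIN_bound. Qed.

Lemma sin_add_le a b : Rabs (sin (a + b)) <= Rabs (sin a) + Rabs (sin b).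
Proof.
  rewrite sin_plus. eapply Rle_trans; [apply Rabs_triang|]. rewrite !Rabs_mult.
  pose proof (Rabs_cos_le1 a). pose proof (Rabs_cos_le1 b).
  pose proof (Rabs_pos (sin a)). pose proof (Rabs_pos (sin b)). nra.
Qed.

Lemma sin_mult_le (n : Z) x : Rabs (sin (IZR n * x)) <= Rabs (IZR n) * Rabs (sin x).
Proof.
  assert (P : forall m : nat, Rabs (sin (INR m * x)) <= INR m * Rabs (sin x)).
  { induction m as [|m IH].
    - simpl. rewrite !Rmult_0_l, sin_0, Rabs_R0. lra.
    - rewrite S_INR, Rmult_plus_distr_r, Rmult_1_l.
      eapply Rle_trans; [apply sin_add_le|]. lra. }
  destruct (Z_le_gt_dec 0 n) as [H|H].
  - specialize (P (Z.to_nat n)). rewrite INR_IZR_INZ, Z2Nat.id in P by exact H.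
    rewrite (Rabs_pos_eq (IZR n)) by (apply IZR_le, H). exact P.
  - specialize (P (Z.to_nat (- n))). rewrite INR_IZR_INZ, Z2Nat.id, opp_IZR in P by lia.
    rewrite (Rabs_left1 (IZR n)) by (apply IZR_le; lia).
    rewrite Ropp_mult_distr_l_reverse, sin_neg, Rabs_Ropp in P. exact P.
Qed.

Section Symbol.
Context {d : nat}.
Notation W := (W d).
Add Ring Wring2 : (@W_ring d) (setoid (@weq_equiv d) (@W_ring_ext d)).
Notation F := (Fsym d).
Notation td := (tdot d).

Lemma td_sum n t : td n t = sumL (seq 0 d) (fun j => IZR (co n j) * t j).
Proof. reflexivity. Qed.

Lemma td_vadd n k t : length n = d -> length k = d -> td (vadd n k) t = td n t + td k t.
Proof.
  intros Hn Hk. rewrite !td_sum, <- sumL_plus. apply sumL_ext. intros j Hj.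
  apply in_seq in Hj. rewrite (vadd_co d), plus_IZR by (auto; lia). ring.
Qed.

Lemma td_vsub n k t : length n = d -> length k = d -> td (vsub n k) t = td n t - td k t.
Proof.
  intros Hn Hk. rewrite !td_sum, <- sumL_minus. apply sumL_ext. intros j Hj.
  apply in_seq in Hj. rewrite (vsub_co d), minus_IZR by (auto; lia). ring.
Qed.

Lemma td_zero t : td (zerovec d) t = 0.
Proof. rewrite td_sum. apply sumL_zero. intros j _. rewrite zerovec_co. ring. Qed.

Lemma td_unit z i t : (i < d)%nat ->
  td (mk d (fun j => if Nat.eqb j i then z else 0%Z)) t = IZR z * t i.
Proof.
  intros Hi. rewrite td_sum.
  rewrite <- (sumL_single Nat.eq_dec (seq 0 d) i (fun j => IZR z * t j)).
  - apply sumL_ext. intros j Hj. apply in_seq in Hj. rewrite co_mk by lia.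
    destruct (Nat.eqb_spec j i), (Nat.eq_dec i j); try congruence; ring.
  - apply seq_NoDup.
  - apply in_seq. lia.
Qed.

Lemma F_terms t : F t = sumL (seq 0 d) (fun j => 2 - 2 * cos (2 * PI * t j)).
Proof.
  rewrite sumL_minus, sumL_const, sumL_scal, length_seq. unfold Fsym, sumL. ring.
Qed.

Lemma F_term_le t j : (j < d)%nat -> 2 - 2 * cos (2 * PI * t j) <= F t.
Proof.
  intros Hj. rewrite F_terms.
  rewrite <- (sumL_single Nat.eq_dec (seq 0 d) j (fun j => 2 - 2 * cos (2 * PI * t j))).
  - apply sumL_le. intros i _. pose proof (COS_bound (2 * PI * t i)).
    destruct Nat.eq_dec; lra.
  - apply seq_NoDup.
  - apply in_seq. lia.
Qed.

Lemma F_range t : 0 <= F t <= 4 * INR d.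
Proof.
  rewrite F_terms. split.
  - apply sumL_ge0. intros j _. pose proof (COS_bound (2 * PI * t j)). lra.
  - apply Rle_trans with (sumL (seq 0 d) (fun _ => 4)).
    + apply sumL_le. intros j _. pose proof (COS_bound (2 * PI * t j)). lra.
    + rewrite sumL_const, length_seq. lra.
Qed.

Lemma F_lower t j : (j < d)%nat -> 0 < t j < 1 -> Rmin (t j) (1 - t j) ^ 2 <= F t.
Proof.
  intros Hj Ht. eapply Rle_trans; [apply symbol_term_lower, Ht|apply F_term_le, Hj].
Qed.

Lemma F_pos t : (1 <= d)%nat -> in_cube d t -> 0 < F t.
Proof.
  intros Hd Ht. eapply Rlt_le_trans; [|apply (F_lower t 0); [lia|apply Ht; lia]].
  apply pow_lt. specialize (Ht 0%nat Hd). unfold Rmin. destruct Rle_dec; lra.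
Qed.

(** The real part of e^(ic) times the symbol of x at t. The phase replaces complex exponentials:
    letting c vary recovers the whole symbol, and multiplication by a monomial only shifts c. *)
Definition hat (x : W) (c : R) (t : nat -> R) : R :=
  ev (wv x) (fun k => cos (c - 2 * PI * td k t)).

Lemma hat_weq x y c t : weq x y -> hat x c t = hat y c t.
Proof. intros H. apply H. Qed.

Lemma hat_mul x y c t : hat (wmul x y) c t =
  ev (wv x) (fun k => hat y (c - 2 * PI * td k t) t).
Proof.
  unfold hat. rewrite ev_wmul. apply (ev_ext d); [apply wwf|]. intros k Hk.
  apply (ev_ext d); [apply wwf|]. intros l Hl. rewrite td_vadd by assumption.
  f_equal. ring.
Qed.

Lemma hat_lap c t : hat lap c t = F t * cos c.
Proof.
  unfold hat. rewrite ev_lap, F_terms, (Rmult_comm _ (cos c)), <- sumL_scal.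
  apply sumL_ext. intros j Hj. apply in_seq in Hj.
  rewrite !ev_wsub, ev_wcst. unfold ui. rewrite !ev_mono, !td_unit, td_zero by lia.
  replace (c - 2 * PI * (1 * t j)) with (c - 2 * PI * t j) by ring.
  replace (c - 2 * PI * (-1 * t j)) with (c + 2 * PI * t j) by ring.
  replace (c - 2 * PI * 0) with c by ring.
  rewrite cos_plus, cos_minus. ring.
Qed.

Lemma hat_mul_lap x c t : hat (wmul x lap) c t = F t * hat x c t.
Proof.
  rewrite hat_mul. unfold hat at 2. rewrite <- ev_scal. apply ev_ext'. intros k. apply hat_lap.
Qed.

Lemma hat_mul_walk x c t : hat (wmul x walk) c t = (4 * INR d - F t) * hat x c t.
Proof.
  rewrite (hat_weq _ (wsub (wmul (wcst (Z.of_nat (4 * d))) x) (wmul x lap)))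
    by (unfold walk; ring).
  unfold hat. rewrite ev_wsub, ev_wcst_mul. fold (hat x c t). fold (hat (wmul x lap) c t).
  rewrite hat_mul_lap, <- INR_IZR_INZ, mult_INR. simpl INR. ring.
Qed.

Lemma hat_walk_pow x c t m :
  hat (wmul x (wpow walk m)) c t = (4 * INR d - F t) ^ m * hat x c t.
Proof.
  induction m as [|m IH].
  - rewrite (hat_weq _ x); simpl; ring.
  - rewrite (hat_weq _ (wmul (wmul x (wpow walk m)) walk)) by (simpl wpow; ring).
    rewrite hat_mul_walk, IH. simpl. ring.
Qed.

(* Orders of vanishing at the origin, measured by the square root of the symbol. *)
Definition re (x : W) t := ev (wv x) (fun k => cos (2 * PI * td k t)).
Definition im (x : W) t := ev (wv x) (fun k => sin (2 * PI * td k t)).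
Definition order (x : W) (p : nat) : Prop := exists C, 0 <= C /\ forall t,
  Rabs (re x t) <= C * sqrt (F t) ^ p /\ Rabs (im x t) <= C * sqrt (F t) ^ p.

Lemma hat_re_im x c t : hat x c t = cos c * re x t + sin c * im x t.
Proof.
  unfold hat, re, im. rewrite <- !ev_scal, <- ev_plus. apply ev_ext'.
  intros k. apply cos_minus.
Qed.

Lemma re_mul x y t : re (wmul x y) t = re x t * re y t - im x t * im y t.
Proof.
  unfold re, im. rewrite ev_wmul.
  rewrite (ev_ext d _ _ (fun k =>
    re y t * cos (2 * PI * td k t) - im y t * sin (2 * PI * td k t)) (wwf x)).
  - rewrite ev_minus, !ev_scal. unfold re, im. ring.
  - intros k Hk. unfold re, im.
    rewrite (Rmult_comm (ev (wv y) _)), (Rmult_comm (ev (wv y) _) (sin _)).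
    rewrite <- !ev_scal, <- ev_minus.
    apply (ev_ext d); [apply wwf|]. intros l Hl.
    rewrite td_vadd, Rmult_plus_distr_l, cos_plus by assumption. reflexivity.
Qed.

Lemma im_mul x y t : im (wmul x y) t = re x t * im y t + im x t * re y t.
Proof.
  unfold re, im. rewrite ev_wmul.
  rewrite (ev_ext d _ _ (fun k =>
    re y t * sin (2 * PI * td k t) + im y t * cos (2 * PI * td k t)) (wwf x)).
  - rewrite ev_plus, !ev_scal. unfold re, im. ring.
  - intros k Hk. unfold re, im.
    rewrite (Rmult_comm (ev (wv y) _)), (Rmult_comm (ev (wv y) _) (cos _)).
    rewrite <- !ev_scal, <- ev_plus.
    apply (ev_ext d); [apply wwf|]. intros l Hl.
    rewrite td_vadd, Rmult_plus_distr_l, sin_plus by assumption. ring.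
Qed.

Lemma order_mul x y p q : order x p -> order y q -> order (wmul x y) (p + q).
Proof.
  intros [A [HA Hx]] [B [HB Hy]]. exists (2 * (A * B)). split; [nra|]. intros t.
  destruct (Hx t) as [X1 X2]. destruct (Hy t) as [Y1 Y2].
  rewrite re_mul, im_mul, pow_add.
  set (P := sqrt (F t) ^ p) in *. set (Q := sqrt (F t) ^ q) in *.
  assert (G : forall a b, Rabs a <= A * P -> Rabs b <= B * Q -> Rabs (a * b) <= A * B * (P * Q)).
  { intros a b Ha Hb. rewrite Rabs_mult.
    replace (A * B * (P * Q)) with (A * P * (B * Q)) by ring.
    apply Rmult_le_compat; auto using Rabs_pos. }
  split.
  - eapply Rle_trans; [apply Rabs_triang|]. rewrite Rabs_Ropp.
    pose proof (G _ _ X1 Y1). pose proof (G _ _ X2 Y2). lra.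
  - eapply Rle_trans; [apply Rabs_triang|].
    pose proof (G _ _ X1 Y2). pose proof (G _ _ X2 Y1). lra.
Qed.

Definition l1len (k : pt) : R := sumL (seq 0 d) (fun j => Rabs (IZR (co k j))).

Lemma l1len_ge0 k : 0 <= l1len k.
Proof. apply sumL_ge0. intros; apply Rabs_pos. Qed.

(** 4 sin^2(PI t_j) is one of the terms of F, which settles a single coordinate. Then |sin(a + b)|
    <= |sin a| + |sin b| and |sin(n x)| <= |n| |sin x| carry this to the inner product for all t,
    without reduction modulo 1. *)
Lemma sin_half_bound k t : 2 * Rabs (sin (PI * td k t)) <= l1len k * sqrt (F t).
Proof.
  assert (Hs : forall j, (j < d)%nat -> 2 * Rabs (sin (PI * t j)) <= sqrt (F t)).
  { intros j Hj. rewrite <- (Rabs_pos_eq 2), <- Rabs_mult by lra.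
    rewrite <- sqrt_Rsqr_abs. apply sqrt_le_1_alt. unfold Rsqr.
    pose proof (F_term_le t j Hj) as H. rewrite Rmult_assoc, two_minus_two_cos in H. lra. }
  assert (G : forall S, (forall j, In j S -> (j < d)%nat) ->
    2 * Rabs (sin (PI * sumL S (fun j => IZR (co k j) * t j))) <=
    sumL S (fun j => Rabs (IZR (co k j))) * sqrt (F t)).
  { induction S as [|j S IH]; intros HS.
    - unfold sumL; simpl. rewrite Rmult_0_r, sin_0, Rabs_R0. lra.
    - change (sumL (j :: S) ?f) with (f j + sumL S f). cbv beta.
      rewrite !(Rmult_plus_distr_l PI), Rmult_plus_distr_r.
      pose proof (sin_add_le (PI * (IZR (co k j) * t j))
        (PI * sumL S (fun j => IZR (co k j) * t j))) as H1.
      replace (PI * (IZR (co k j) * t j)) with (IZR (co k j) * (PI * t j)) in * by ring.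
      pose proof (sin_mult_le (co k j) (PI * t j)) as H2.
      assert (HSj : forall i, In i S -> (i < d)%nat) by (intros; apply HS; right; assumption).
      specialize (IH HSj). specialize (Hs j (HS j (or_introl eq_refl))).
      pose proof (Rabs_pos (IZR (co k j))). nra. }
  apply G. intros j Hj. apply in_seq in Hj. lia.
Qed.

Lemma cos_sub_one_bound k t :
  Rabs (cos (2 * PI * td k t) - 1) <= l1len k * sqrt (F t) /\
  Rabs (cos (2 * PI * td k t) - 1) <= l1len k ^ 2 * F t /\
  Rabs (sin (2 * PI * td k t)) <= l1len k * sqrt (F t).
Proof.
  pose proof (sin_half_bound k t) as H. rewrite Rmult_assoc.
  set (a := PI * td k t) in *. rewrite cos_2a_sin, sin_2a.
  replace (1 - 2 * sin a * sin a - 1) with (- (2 * (sin a * sin a))) by ring.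
  rewrite Rabs_Ropp. rewrite !Rabs_mult, (Rabs_pos_eq 2) by lra.
  pose proof (Rabs_sin_le1 a). pose proof (Rabs_cos_le1 a).
  pose proof (Rabs_pos (sin a)). pose proof (Rabs_pos (cos a)).
  pose proof (sqrt_sqrt (F t) (proj1 (F_range t))) as E.
  pose proof (sqrt_pos (F t)). pose proof (l1len_ge0 k).
  repeat split; nra.
Qed.

Lemma order_aug x : eval1 (wv x) = 0%Z -> order x 1.
Proof.
  intros H1. exists (sumL (wv x) (fun p => Rabs (IZR (fst p)) * l1len (snd p))).
  assert (G : forall t (phi : pt -> R), (forall k, Rabs (phi k) <= l1len k * sqrt (F t)) ->
    Rabs (ev (wv x) phi) <=
    sumL (wv x) (fun p => Rabs (IZR (fst p)) * l1len (snd p)) * sqrt (F t) ^ 1).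
  { intros t phi Hp. eapply Rle_trans; [apply sumL_abs|].
    rewrite pow_1, Rmult_comm, <- sumL_scal. apply sumL_le. intros p _.
    rewrite Rabs_mult. specialize (Hp (snd p)). pose proof (Rabs_pos (IZR (fst p))). nra. }
  split.
  - apply sumL_ge0. intros p _. apply Rmult_le_pos; [apply Rabs_pos|apply l1len_ge0].
  - intros t. split.
    + replace (re x t) with (ev (wv x) (fun k => cos (2 * PI * td k t) - 1)).
      * apply G. intros k. apply cos_sub_one_bound.
      * rewrite ev_minus, <- eval1_ev, H1. unfold re. ring.
    + apply G. intros k. apply cos_sub_one_bound.
Qed.

Lemma order_0 x : order x 0.
Proof.
  exists (sumL (wv x) (fun p => Rabs (IZR (fst p)))).
  assert (G : forall (phi : pt -> R), (forall k, Rabs (phi k) <= 1) ->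
    Rabs (ev (wv x) phi) <= sumL (wv x) (fun p => Rabs (IZR (fst p))) * 1).
  { intros phi Hp. eapply Rle_trans; [apply sumL_abs|].
    rewrite Rmult_1_r. apply sumL_le. intros p _.
    rewrite Rabs_mult. specialize (Hp (snd p)). pose proof (Rabs_pos (IZR (fst p))). nra. }
  split; [apply sumL_ge0; intros; apply Rabs_pos|]. intros t. split; apply G; intros k.
  - apply Rabs_le, COS_bound.
  - apply Rabs_le, SIN_bound.
Qed.

(** The two factors of order 1 give sqrt(F)^2 = F; z is taken merely as bounded. *)
Lemma hat_triple_bound x y z : eval1 (wv x) = 0%Z -> eval1 (wv y) = 0%Z ->
  exists C, 0 <= C /\ forall c t, Rabs (hat (wmul (wmul x y) z) c t) <= C * F t.
Proof.
  intros Hx Hy.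
  destruct (order_mul _ _ _ _ (order_mul _ _ _ _ (order_aug x Hx) (order_aug y Hy)) (order_0 z))
    as [C [HC H]].
  exists (2 * C). split; [lra|]. intros c t. destruct (H t) as [H1 H2].
  assert (E : sqrt (F t) ^ (1 + 1 + 0) = F t).
  { simpl. rewrite Rmult_1_r. apply sqrt_sqrt, F_range. }
  rewrite E in H1, H2. rewrite hat_re_im.
  eapply Rle_trans; [apply Rabs_triang|]. rewrite !Rabs_mult.
  pose proof (Rabs_sin_le1 c). pose proof (Rabs_cos_le1 c).
  pose proof (Rabs_pos (re (wmul (wmul x y) z) t)).
  pose proof (Rabs_pos (im (wmul (wmul x y) z) t)). nra.
Qed.

(** * Existence of the integrals that define the Green function *)

Definition num (n : pt) (t : nat -> R) : R :=
  if Nat.eqb d 2 then cos (2 * PI * td n t) - 1 else cos (2 * PI * td n t).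

Lemma integrand_num n t : integrand d n t = num n t / F t.
Proof. unfold integrand, num. destruct (Nat.eqb d 2); reflexivity. Qed.

Lemma num_bound n t : Rabs (num n t) <= 2.
Proof.
  unfold num. pose proof (COS_bound (2 * PI * td n t)).
  destruct (Nat.eqb d 2); apply Rabs_le; lra.
Qed.

Lemma num_lipschitz n t t' :
  Rabs (num n t - num n t') <= 2 * PI * l1len n * l1dist d t t'.
Proof.
  assert (E : num n t - num n t' = cos (2 * PI * td n t) - cos (2 * PI * td n t')).
  { unfold num. destruct (Nat.eqb d 2); ring. }
  rewrite E. eapply Rle_trans; [apply cos_lipschitz|]. pose proof PI_RGT_0.
  rewrite <- Rmult_minus_distr_l, Rabs_mult, (Rabs_pos_eq (2 * PI)), (Rmult_assoc (2 * PI))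
    by lra.
  apply Rmult_le_compat_l; [lra|].
  rewrite !td_sum, <- sumL_minus. eapply Rle_trans; [apply sumL_abs|].
  unfold l1dist. rewrite <- sumL_scal. apply sumL_le. intros j Hj.
  rewrite <- Rmult_minus_distr_l, Rabs_mult. apply Rmult_le_compat_r; [apply Rabs_pos|].
  unfold l1len.
  rewrite <- (sumL_single Nat.eq_dec (seq 0 d) j (fun j => Rabs (IZR (co n j))));
    [|apply seq_NoDup|exact Hj].
  apply sumL_le. intros i _. pose proof (Rabs_pos (IZR (co n i))).
  destruct Nat.eq_dec; lra.
Qed.

Lemma F_lipschitz t t' : Rabs (F t - F t') <= 4 * PI * l1dist d t t'.
Proof.
  rewrite !F_terms, <- sumL_minus. eapply Rle_trans; [apply sumL_abs|].
  unfold l1dist. rewrite <- sumL_scal. apply sumL_le. intros j _. pose proof PI_RGT_0.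
  replace (2 - 2 * cos (2 * PI * t j) - (2 - 2 * cos (2 * PI * t' j)))
    with (2 * (cos (2 * PI * t' j) - cos (2 * PI * t j))) by ring.
  rewrite Rabs_mult, (Rabs_pos_eq 2) by lra.
  pose proof (cos_lipschitz (2 * PI * t' j) (2 * PI * t j)) as H0.
  rewrite <- Rmult_minus_distr_l, Rabs_mult, (Rabs_pos_eq (2 * PI)), Rabs_minus_sym in H0
    by lra. rewrite (Rabs_minus_sym (t' j)) in H0. rewrite (Rabs_minus_sym (cos _)) in *. lra.
Qed.

Lemma l1dist_ge0 k t t' : 0 <= l1dist k t t'.
Proof. apply sumL_ge0. intros; apply Rabs_pos. Qed.

Lemma triple_product_le a b c a' b' c' : 0 <= a -> 0 <= b -> 0 <= c ->
  a <= a' -> b <= b' -> c <= c' -> a * (b * (c * 1)) <= a' * (b' * (c' * 1)).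
Proof.
  intros. rewrite !Rmult_1_r. assert (0 <= b * c) by (apply Rmult_le_pos; assumption).
  repeat apply Rmult_le_compat; assumption.
Qed.

(* With r_j = min(t_j, 1 - t_j)^(1/4) and rho the largest of r_0, r_1, r_2 one has
   (r_0 r_1 r_2)^3 <= rho^9 <= rho^8 <= F t. *)
Lemma inv_F_majorant t : (3 <= d)%nat -> in_cube d t -> / F t <= prodk d t.
Proof.
  (* Three coordinates are enough for the bound; the factors of the others are at least 1. *)
  intros Hd Ht. eapply Rle_trans; [|apply (prodk_mono 3 d t Hd Ht)].
  set (r := fun j => qrt (Rmin (t j) (1 - t j))).
  assert (Hm : forall j, (j < 3)%nat -> 0 < Rmin (t j) (1 - t j) <= 1).
  { intros j Hj. specialize (Ht j ltac:(lia)). unfold Rmin. destruct Rle_dec; lra. }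
  assert (Hr : forall j, (j < 3)%nat -> 0 < r j <= 1).
  { intros j Hj. destruct (Hm j Hj). split; [apply qrt_pos|apply qrt_le1]; assumption. }
  assert (HF : forall j, (j < 3)%nat -> r j ^ 9 <= F t).
  { intros j Hj. eapply Rle_trans; [|apply (F_lower t j); [lia|apply Ht; lia]].
    destruct (Hr j Hj). destruct (Hm j Hj).
    rewrite <- (qrt_pow4 (Rmin (t j) (1 - t j))) by lra. fold (r j).
    assert (0 <= (r j ^ 4) ^ 2) by apply pow2_ge_0.
    replace (r j ^ 9) with ((r j ^ 4) ^ 2 * r j) by ring. nra. }
  assert (HM : forall j, (j < 3)%nat -> / (r j ^ 3) <= end_majorant (t j)).
  { intros j Hj. apply end_majorant_ge; [apply Ht; lia|reflexivity]. }
  pose proof (Hr 0%nat ltac:(lia)) as Q0. pose proof (Hr 1%nat ltac:(lia)) as Q1.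
  pose proof (Hr 2%nat ltac:(lia)) as Q2.
  assert (K : (r 2%nat ^ 3) * ((r 1%nat ^ 3) * (r 0%nat ^ 3 * 1)) <= F t).
  { assert (G : forall rho, 0 <= rho -> r 0%nat <= rho -> r 1%nat <= rho -> r 2%nat <= rho ->
      rho ^ 9 <= F t -> (r 2%nat ^ 3) * ((r 1%nat ^ 3) * (r 0%nat ^ 3 * 1)) <= F t).
    { intros rho H0 L0 L1 L2 L. eapply Rle_trans; [|exact L].
      replace (rho ^ 9) with (rho ^ 3 * (rho ^ 3 * (rho ^ 3 * 1))) by ring.
      assert (P : forall j, (j < 3)%nat -> 0 <= r j ^ 3)
        by (intros j Hj; apply pow_le; destruct (Hr j Hj); lra).
      assert (Q : forall j, (j < 3)%nat -> r j <= rho -> r j ^ 3 <= rho ^ 3)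
        by (intros j Hj Lj; apply pow_incr; destruct (Hr j Hj); lra).
      pose proof (P 0%nat ltac:(lia)) as P0. pose proof (P 1%nat ltac:(lia)) as P1.
      pose proof (P 2%nat ltac:(lia)) as P2. pose proof (Q 0%nat ltac:(lia) L0) as U0.
      pose proof (Q 1%nat ltac:(lia) L1) as U1. pose proof (Q 2%nat ltac:(lia) L2) as U2.
      apply triple_product_le; assumption. }
    destruct (Rle_dec (r 0%nat) (r 1%nat)), (Rle_dec (r 1%nat) (r 2%nat)),
      (Rle_dec (r 0%nat) (r 2%nat));
      first [ apply (G (r 2%nat)); try apply HF; lia || lra
            | apply (G (r 1%nat)); try apply HF; lia || lra
            | apply (G (r 0%nat)); try apply HF; lia || lra ]. }
  assert (P3 : forall j, (j < 3)%nat -> 0 < r j ^ 3)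
    by (intros j Hj; apply pow_lt; destruct (Hr j Hj); lra).
  pose proof (P3 0%nat ltac:(lia)). pose proof (P3 1%nat ltac:(lia)).
  pose proof (P3 2%nat ltac:(lia)).
  eapply Rle_trans; [apply Rinv_le_contravar; [|exact K]|].
  { repeat apply Rmult_lt_0_compat; lra. }
  rewrite !Rinv_mult, Rinv_1. simpl prodk.
  assert (I : forall j, (j < 3)%nat -> 0 <= / (r j ^ 3))
    by (intros j Hj; left; apply Rinv_0_lt_compat, P3, Hj).
  apply triple_product_le; auto.
Qed.

(** For d = 2 the subtracted 1 makes the numerator O(F), so the quotient itself is bounded. For d >=
    3 the numerator is bounded and 1/F lies below the majorant. *)
Lemma integrand_bound n : (2 <= d)%nat -> exists C, 0 <= C /\
  forall t, in_cube d t -> Rabs (integrand d n t) <= C * prodk d t.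
Proof.
  intros Hd. destruct (Nat.eq_dec d 2) as [E2|N2].
  - exists (l1len n ^ 2). split; [apply pow2_ge_0|]. intros t Ht.
    pose proof (F_pos t ltac:(lia) Ht) as HF.
    rewrite integrand_num. unfold num. rewrite (proj2 (Nat.eqb_eq d 2) E2).
    unfold Rdiv. rewrite Rabs_mult, Rabs_inv, (Rabs_pos_eq (F t)) by lra.
    apply Rle_trans with (l1len n ^ 2).
    + apply (Rmult_le_reg_r (F t)); [exact HF|]. rewrite Rmult_assoc, Rinv_l, Rmult_1_r by lra.
      apply cos_sub_one_bound.
    + pose proof (prodk_ge1 d t Ht). pose proof (pow2_ge_0 (l1len n)). nra.
  - exists 2. split; [lra|]. intros t Ht.
    pose proof (F_pos t ltac:(lia) Ht) as HF.
    pose proof (inv_F_majorant t ltac:(lia) Ht).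
    pose proof (Rinv_0_lt_compat _ HF).
    rewrite integrand_num. unfold Rdiv.
    rewrite Rabs_mult, Rabs_inv, (Rabs_pos_eq (F t)) by lra.
    apply Rmult_le_compat; try lra; [apply Rabs_pos|apply num_bound].
Qed.

Lemma integrand_lipschitz n k : S k = d -> forall a b, 0 < a -> b < 1 ->
  exists K, forall t t', a < t k < b -> a < t' k < b ->
    Rabs (integrand d n t - integrand d n t') <= K * l1dist (S k) t t'.
Proof.
  intros Hk a b Ha Hb.
  destruct (Rlt_dec a b) as [Hab|Hab]; [|exists 0; intros; lra].
  (* m is a lower bound for the distance of t_k to the ends of (0,1), so F >= m^2 whatever the other
     coordinates are. *)
  set (m := Rmin a (1 - b)). set (c := m ^ 2).
  assert (Hm : 0 < m) by (unfold m, Rmin; destruct Rle_dec; lra).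
  assert (Hc : 0 < c) by (apply pow_lt, Hm).
  assert (HF : forall t, a < t k < b -> c <= F t).
  { intros t Ht. eapply Rle_trans; [|apply (F_lower t k); [lia|lra]].
    apply pow_incr. split; [lra|]. unfold m, Rmin. repeat destruct Rle_dec; lra. }
  exists (2 * PI * l1len n / c + 2 * (4 * PI) / (c * c)). intros t t' Ht Ht'.
  rewrite Hk. pose proof (HF t Ht) as F1. pose proof (HF t' Ht') as F2.
  pose proof (num_lipschitz n t t') as L1. pose proof (F_lipschitz t t') as L2.
  pose proof (num_bound n t') as B'.
  rewrite !integrand_num.
  replace (num n t / F t - num n t' / F t') with
    ((num n t - num n t') / F t + num n t' * (F t' - F t) / (F t * F t')) by (field; lra).
  pose proof (l1dist_ge0 d t t') as D0. set (D := l1dist d t t') in *.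
  assert (Rabs ((num n t - num n t') / F t) <= 2 * PI * l1len n / c * D).
  { unfold Rdiv. rewrite Rabs_mult, Rabs_inv, (Rabs_pos_eq (F t)) by lra.
    replace (2 * PI * l1len n * / c * D) with (2 * PI * l1len n * D * / c) by ring.
    apply Rmult_le_compat; [apply Rabs_pos| |exact L1|].
    - left. apply Rinv_0_lt_compat. lra.
    - apply Rinv_le_contravar; lra. }
  assert (Rabs (num n t' * (F t' - F t) / (F t * F t')) <= 2 * (4 * PI) / (c * c) * D).
  { assert (c * c <= F t * F t') by (apply Rmult_le_compat; lra).
    assert (0 < c * c) by nra.
    unfold Rdiv. rewrite !Rabs_mult, Rabs_inv, (Rabs_pos_eq (F t * F t')) by lra.
    replace (2 * (4 * PI) * / (c * c) * D) with (2 * (4 * PI * D) * / (c * c)) by ring.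
    rewrite (Rabs_minus_sym (F t')).
    apply Rmult_le_compat.
    - apply Rmult_le_pos; apply Rabs_pos.
    - left. apply Rinv_0_lt_compat. lra.
    - apply Rmult_le_compat; auto using Rabs_pos.
    - apply Rinv_le_contravar; lra. }
  eapply Rle_trans; [apply Rabs_triang|]. lra.
Qed.

(** [wgreen] is an [epsilon] choice, so everything known about it comes from the existence of the
    integral. *)
Lemma wgreen_spec n : (2 <= d)%nat -> CubeInt d (integrand d n) (wgreen d n).
Proof.
  intros Hd. unfold wgreen. apply epsilon_spec.
  destruct (integrand_bound n Hd) as [C [HC HB]].
  assert (Ek : exists k, S k = d) by (exists (pred d); lia). destruct Ek as [k Hk].
  pose proof (integrand_lipschitz n k Hk) as L.
  assert (HB' : forall t, in_cube (S k) t -> Rabs (integrand d n t) <= C * prodk (S k) t)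
    by (rewrite Hk; exact HB).
  destruct (cube_exist_majorant k (integrand d n) C HC L HB') as [v Hv].
  exists v. rewrite Hk in Hv. exact Hv.
Qed.

(** Augmentation 0 cancels the constant -1 in the numerator for d = 2, so the two definitions of w
    lead to one formula. *)
Lemma act_wgreen_cube (x : W) n : (2 <= d)%nat -> length n = d -> eval1 (wv x) = 0%Z ->
  CubeInt d (fun t => hat x (2 * PI * td n t) t / F t) (act (wv x) (wgreen d) n).
Proof.
  intros Hd Hn H1. rewrite act_ev.
  eapply cube_ext; [|apply (cube_ev d (wv x) (fun k => integrand d (vsub n k)));
    intros p _; apply wgreen_spec, Hd].
  intros t _. cbv beta. unfold hat, Rdiv. rewrite Rmult_comm, <- ev_scal.
  assert (E : ev (wv x) (fun k => / F t * cos (2 * PI * td n t - 2 * PI * td k t)) =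
    ev (wv x) (fun k => / F t * cos (2 * PI * td n t - 2 * PI * td k t)) -
    / F t * (if Nat.eqb d 2 then 1 else 0) * ev (wv x) (fun _ => 1)).
  { rewrite <- eval1_ev, H1. ring. }
  rewrite E, <- ev_scal, <- ev_minus. apply (ev_ext d); [apply wwf|]. intros k Hk.
  rewrite integrand_num. unfold num.
  rewrite td_vsub by assumption. rewrite Rmult_minus_distr_l.
  destruct (Nat.eqb d 2); unfold Rdiv; ring.
Qed.

(** Fourier inversion for a finite sum, by orthogonality of the characters. *)
Lemma coef_cube (x : W) n : length n = d ->
  CubeInt d (fun t => hat x (2 * PI * td n t) t) (IZR (coef (wv x) n)).
Proof.
  intros Hn. rewrite coef_ev.
  apply (cube_ev d (wv x) (fun k t => cos (2 * PI * td n t - 2 * PI * td k t)) (dirac n)).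
  intros p Hp. pose proof (wwf x) as Hw. unfold wfLP in Hw. rewrite Forall_forall in Hw.
  specialize (Hw p Hp). set (k := snd p) in *.
  eapply cube_ext.
  2:{ replace (dirac n k) with (if forallb (fun j => Z.eqb (co (vsub n k) j) 0) (seq 0 d)
        then cos 0 else 0); [apply (cube_cos d 0 (co (vsub n k)))|].
      unfold dirac. destruct (pt_dec k n) as [E|N].
      - apply (vsub_eq_zero d n k Hn Hw) in E. rewrite E.
        destruct forallb eqn:Ef; [apply cos_0|]. exfalso.
        assert (T : forallb (fun j => Z.eqb (co (zerovec d) j) 0) (seq 0 d) = true).
        { apply forallb_forall. intros j _. rewrite zerovec_co. reflexivity. }
        congruence.
      - destruct forallb eqn:Ef; [|reflexivity]. exfalso. apply N.
        rewrite <- (vsub_eq_zero d n k Hn Hw).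
        apply (pt_ext d); auto using vsub_length, zerovec_length.
        intros j Hj. rewrite zerovec_co. apply Z.eqb_eq.
        apply (proj1 (forallb_forall _ _) Ef j). apply in_seq. lia. }
  intros t _. cbv beta. rewrite <- td_sum, td_vsub by assumption. f_equal. ring.
Qed.

(** F is positive on the open cube and cancels there, which leaves the Fourier integral of the
    constant 1. *)
Lemma lap_wgreen n : (2 <= d)%nat -> length n = d ->
  act (fLap d) (wgreen d) n = dirac (zerovec d) n.
Proof.
  intros Hd Hn. set (one := @w1 d).
  assert (H1 : eval1 (wv (@lap d)) = 0%Z).
  { apply eq_IZR. rewrite eval1_ev, ev_lap. apply sumL_zero. intros i _.
    rewrite !ev_wsub, ev_wcst. unfold ui. rewrite !ev_mono. ring. }
  change (fLap d) with (wv (@lap d)).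
  replace (dirac (zerovec d) n) with (IZR (coef (wv one) n)).
  - apply (cube_unique _ _ _ _ _ (act_wgreen_cube lap n Hd Hn H1) (coef_cube one n Hn)).
    intros t Ht. rewrite hat_lap. unfold one, hat, w1. rewrite ev_wcst, td_zero.
    pose proof (F_pos t ltac:(lia) Ht). rewrite Rmult_0_r, Rminus_0_r. field. lra.
  - rewrite coef_ev. unfold one, w1. rewrite ev_wcst, Rmult_1_l.
    unfold dirac. destruct (pt_dec (zerovec d) n), (pt_dec n (zerovec d)); congruence.
Qed.

End Symbol.

(** * Summability of third differences *)

Section Summability.
Context {d : nat}.
Notation W := (W d).
Add Ring Wring3 : (@W_ring d) (setoid (@weq_equiv d) (@W_ring_ext d)).
Notation F := (Fsym d).

(** The test function is the sign of the coefficient on S and 0 elsewhere. *)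
Lemma sum_coef_le_nb (x : W) B S : nb x B -> NoDup S ->
  sumL S (fun n => Rabs (IZR (coef (wv x) n))) <= B.
Proof.
  intros H ND. set (sg := fun n => if Rle_dec 0 (IZR (coef (wv x) n)) then 1 else -1).
  replace (sumL S (fun n => Rabs (IZR (coef (wv x) n))))
    with (ev (wv x) (fun k => sumL S (fun n => sg n * dirac n k))).
  - eapply Rle_trans; [apply Rle_abs|]. apply H. intros k.
    eapply Rle_trans; [apply sumL_abs|].
    apply Rle_trans with (sumL S (fun n => if pt_dec k n then 1 else 0)).
    + apply sumL_le. intros n _. unfold sg, dirac.
      destruct Rle_dec, pt_dec; rewrite Rabs_mult, ?Rabs_R0, ?Rabs_R1, ?Rabs_m1; lra.
    + destruct (in_dec pt_dec k S) as [Hi|Hi].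
      * rewrite (sumL_single pt_dec S k (fun _ => 1)) by assumption. lra.
      * rewrite (sumL_single_out pt_dec S k (fun _ => 1)) by assumption. lra.
  - rewrite ev_sumL. apply sumL_ext. intros n _. rewrite ev_scal, <- coef_ev.
    unfold sg. destruct Rle_dec; [rewrite Rabs_pos_eq by lra|rewrite Rabs_left by lra]; ring.
Qed.

Lemma nb_list (x : W) : nb x (sumL (wv x) (fun p => Rabs (IZR (fst p)))).
Proof.
  intros phi Hp. eapply Rle_trans; [apply sumL_abs|]. apply sumL_le. intros p _.
  rewrite Rabs_mult. specialize (Hp (snd p)). pose proof (Rabs_pos (IZR (fst p))). nra.
Qed.

Lemma geometric_remainder q f M : q <> 0 -> f <> 0 ->
  / f - sumL (seq 0 M) (fun m => (q - f) ^ m / q ^ S m) = (q - f) ^ M / q ^ M / f.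
Proof.
  intros Hq Hf. induction M as [|M IH].
  - unfold sumL; simpl. field. exact Hf.
  - rewrite seq_S, sumL_app. unfold Rminus in *. rewrite Ropp_plus_distr, <- Rplus_assoc, IH.
    change (sumL [(0 + M)%nat] ?g) with (g M + 0). cbv beta. simpl pow.
    pose proof (pow_nonzero q M Hq). field. auto.
Qed.

(** With q = 4d, the part of the geometric series of 1/F beyond M terms is (1 - F/q)^M / F. The
    factor F in the bound for the symbol of x cancels the denominator, and what remains, C (1 -
    F/q)^M, is nonnegative and integrates to C times the return probability after M steps. *)
Lemma green_remainder (x : W) C n M : (2 <= d)%nat -> length n = d ->
  eval1 (wv x) = 0%Z -> 0 <= C -> (forall c t, Rabs (hat x c t) <= C * F t) ->
  Rabs (act (wv x) (wgreen d) n -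
        sumL (seq 0 M) (fun m => / (4 * INR d) ^ S m *
           IZR (coef (wv (wmul x (wpow walk m))) n))) <=
  C / (4 * INR d) ^ M * IZR (coef (wv (@wpow d walk M)) (zerovec d)).
Proof.
  intros Hd Hn H1 HC HB. assert (Hd' : 1 <= INR d) by (apply (le_INR 1); lia).
  set (q := 4 * INR d). assert (Hq : 0 < q) by (unfold q; lra).
  pose proof (pow_lt q M Hq) as HqM.
  pose proof (act_wgreen_cube x n Hd Hn H1) as I1.
  assert (I2 : CubeInt d (fun t => sumL (seq 0 M) (fun m =>
      / q ^ S m * hat (wmul x (wpow walk m)) (2 * PI * tdot d n t) t))
    (sumL (seq 0 M) (fun m => / q ^ S m * IZR (coef (wv (wmul x (wpow walk m))) n)))).
  { apply (cube_sumL d (seq 0 M) (fun m t =>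
      / q ^ S m * hat (wmul x (wpow walk m)) (2 * PI * tdot d n t) t)).
    intros m _. apply cube_scal, coef_cube, Hn. }
  pose proof (cube_scal _ _ _ (C / q ^ M)
    (coef_cube (@wpow d walk M) (zerovec d) (zerovec_length d))) as I3.
  pose proof (cube_lin _ _ _ _ _ 1 (-1) I1 I2) as I4.
  assert (P : forall t, in_cube d t ->
    Rabs (1 * (hat x (2 * PI * tdot d n t) t / F t) + -1 * sumL (seq 0 M) (fun m =>
      / q ^ S m * hat (wmul x (wpow walk m)) (2 * PI * tdot d n t) t)) <=
    C / q ^ M * hat (@wpow d walk M) (2 * PI * tdot d (zerovec d) t) t).
  { intros t Ht. pose proof (F_pos (d := d) t ltac:(lia) Ht) as HF. pose proof (F_range (d := d) t) as HR.
    assert (E : hat (@wpow d walk M) (2 * PI * tdot d (zerovec d) t) t = (q - F t) ^ M).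
    { rewrite (hat_weq _ (wmul (@w1 d) (wpow walk M))) by ring.
      rewrite hat_walk_pow. unfold hat, w1. rewrite ev_wcst, td_zero.
      rewrite !Rmult_0_r, Rminus_0_r, cos_0. unfold q. ring. }
    rewrite E. set (c := 2 * PI * tdot d n t). set (h := hat x c t).
    replace (1 * (h / F t) + -1 * sumL (seq 0 M) (fun m =>
      / q ^ S m * hat (wmul x (wpow walk m)) c t)) with ((q - F t) ^ M / q ^ M / F t * h).
    - assert (G0 : 0 <= (q - F t) ^ M) by (apply pow_le; unfold q; lra).
      assert (G : 0 <= (q - F t) ^ M / q ^ M / F t).
      { unfold Rdiv. repeat apply Rmult_le_pos; try assumption;
          left; apply Rinv_0_lt_compat; assumption. }
      rewrite Rabs_mult, (Rabs_pos_eq _ G).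
      apply Rle_trans with ((q - F t) ^ M / q ^ M / F t * (C * F t)).
      + apply Rmult_le_compat_l; [exact G|apply HB].
      + apply Req_le. field. lra.
    - rewrite <- geometric_remainder by lra.
      rewrite Rmult_minus_distr_r, (Rmult_comm _ h), (Rmult_comm (sumL _ _) h), <- sumL_scal.
      unfold Rdiv. rewrite (sumL_ext _ (fun m => / q ^ S m * hat (wmul x (wpow walk m)) c t)
        (fun m => h * ((q - F t) ^ m * / q ^ S m))); [ring|].
      intros m _. rewrite hat_walk_pow. fold q h. ring. }
  apply Rabs_le. split.
  - pose proof (cube_le _ _ _ _ _ (cube_scal _ _ _ (-1) I4) I3) as L.
    assert (K : forall t, in_cube d t -> -1 * (1 * (hat x (2 * PI * tdot d n t) t / F t) +
      -1 * sumL (seq 0 M) (fun m =>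
      / q ^ S m * hat (wmul x (wpow walk m)) (2 * PI * tdot d n t) t)) <=
      C / q ^ M * hat (@wpow d walk M) (2 * PI * tdot d (zerovec d) t) t).
    { intros t Ht. specialize (P t Ht). apply Rabs_le_between in P. lra. }
    specialize (L K). lra.
  - pose proof (cube_le _ _ _ _ _ I4 I3) as L.
    assert (K : forall t, in_cube d t -> 1 * (hat x (2 * PI * tdot d n t) t / F t) +
      -1 * sumL (seq 0 M) (fun m =>
      / q ^ S m * hat (wmul x (wpow walk m)) (2 * PI * tdot d n t) t) <=
      C / q ^ M * hat (@wpow d walk M) (2 * PI * tdot d (zerovec d) t) t).
    { intros t Ht. specialize (P t Ht). apply Rabs_le_between in P. lra. }
    specialize (L K). lra.
Qed.

(** The remainder is bounded uniformly in n, hence not summably over the whole lattice. So S is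
    fixed first and costs a factor [length S]; as M grows this term vanishes, and the bound A 3/q
    left over is independent of S. *)
Lemma triple_ell1 (x y z : W) : (2 <= d)%nat ->
  augI d (wv x) -> augI d (wv y) -> augI d (wv z) ->
  ell1 d (act (wv (wmul (wmul x y) z)) (wgreen d)).
Proof.
  intros Hd Hx Hy Hz. assert (Hd' : 1 <= INR d) by (apply (le_INR 1); lia).
  set (q := 4 * INR d). assert (Hq : 0 < q) by (unfold q; lra).
  assert (Hd1 : (1 <= d)%nat) by lia.
  destruct (nb_triple x y z Hd1 (slow_aug x Hx) (slow_aug y Hy) (slow_aug z Hz))
    as [A [HA NA]].
  destruct (hat_triple_bound x y z (proj2 Hx) (proj2 Hy)) as [B [HB HH]].
  destruct (slow_diff (d := d) 0 ltac:(lia)) as [D [HD ND]].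
  set (h := wmul (wmul x y) z) in *.
  assert (H1 : eval1 (wv h) = 0%Z).
  { apply eq_IZR. rewrite eval1_ev. unfold h. rewrite ev_wmul.
    rewrite (ev_ext' _ _ (fun _ => IZR (eval1 (wv z)))).
    - rewrite (proj2 Hz). apply ev_0.
    - intros k. rewrite eval1_ev. reflexivity. }
  exists (A * 3 / q). intros S NDS HS. rewrite Forall_forall in HS.
  change (sumL S (fun n => Rabs (act (wv h) (wgreen d) n)) <= A * 3 / q).
  set (c := fun m n => / q ^ Datatypes.S m * IZR (coef (wv (wmul h (wpow walk m))) n)).
  assert (Main : forall M, sumL S (fun n => Rabs (act (wv h) (wgreen d) n)) <=
    A * 3 / q + INR (length S) * (B * D) / sqrt (INR (Datatypes.S M))).
  { intros M.
    assert (HsM : 0 < sqrt (INR (Datatypes.S M))) by (apply sqrt_lt_R0, lt_0_INR; lia).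
    pose proof (pow_lt q M Hq) as HqM.
    apply Rle_trans with (sumL S (fun n => sumL (seq 0 M) (fun m => Rabs (c m n)) +
       B * D / sqrt (INR (Datatypes.S M)))).
    - apply sumL_le. intros n Hn.
      pose proof (green_remainder h B n M Hd (HS n Hn) H1 HB HH) as R.
      fold q in R. change (sumL (seq 0 M) _) with (sumL (seq 0 M) (fun m => c m n)) in R.
      (* The decay of a single difference of walk^M already controls its coefficient at 0, so the
         remainder is O(M^(-1/2)). *)
      pose proof (coef_zero_bound _ _ Hd1 (ND M)) as Z. fold q in Z.
      pose proof (sumL_abs (seq 0 M) (fun m => c m n)) as T.
      assert (R' : B / q ^ M * IZR (coef (wv (@wpow d walk M)) (zerovec d)) <=
        B * D / sqrt (INR (Datatypes.S M))).
      { apply Rle_trans with (B / q ^ M * (D * q ^ M / sqrt (INR (Datatypes.S M)))).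
        - apply Rmult_le_compat_l; [apply Rle_mult_inv_pos; assumption|].
          eapply Rle_trans; [apply Rle_abs|exact Z].
        - apply Req_le. field. lra. }
      set (a := act (wv h) (wgreen d) n) in *.
      set (b := sumL (seq 0 M) (fun m => c m n)) in *.
      replace a with ((a - b) + b) by ring.
      eapply Rle_trans; [apply Rabs_triang|]. lra.
    - rewrite sumL_plus, sumL_const, sumL_swap.
      apply Rplus_le_compat; [|apply Req_le; unfold Rdiv; ring].
      apply Rle_trans with (sumL (seq 0 M) (fun m => A / q *
        (1 / (INR (Datatypes.S m) * sqrt (INR (Datatypes.S m)))))).
      + apply sumL_le. intros m _. pose proof (pow_lt q m Hq) as Hqm.
        assert (Hm : 0 < INR (Datatypes.S m)) by (apply lt_0_INR; lia).
        pose proof (sqrt_lt_R0 _ Hm).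
        rewrite (sumL_ext _ _ (fun n => / q ^ Datatypes.S m *
          Rabs (IZR (coef (wv (wmul h (wpow walk m))) n)))).
        2:{ intros n _. unfold c. rewrite Rabs_mult, Rabs_pos_eq; [reflexivity|].
            left. apply Rinv_0_lt_compat, pow_lt, Hq. }
        rewrite sumL_scal.
        apply Rle_trans with (/ q ^ Datatypes.S m *
          (A * q ^ m / (INR (Datatypes.S m) * sqrt (INR (Datatypes.S m))))).
        * apply Rmult_le_compat_l; [left; apply Rinv_0_lt_compat, pow_lt, Hq|].
          apply sum_coef_le_nb; [apply NA|exact NDS].
        * apply Req_le. simpl pow. field. lra.
      + rewrite sumL_scal. replace (A * 3 / q) with (A / q * 3) by (unfold Rdiv; ring).
        apply Rmult_le_compat_l; [apply Rle_mult_inv_pos; lra|apply sum_pow_three_halves]. }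
  apply le_epsilon. intros e He.
  set (K := INR (length S) * (B * D)) in *.
  assert (HK : 0 <= K) by (unfold K; repeat apply Rmult_le_pos; auto using pos_INR).
  destruct (archimed ((K / e) ^ 2)) as [Hup _].
  set (M := Z.to_nat (up ((K / e) ^ 2))). specialize (Main M).
  assert (HM : (K / e) ^ 2 <= INR (Datatypes.S M)).
  { rewrite S_INR. unfold M. rewrite INR_IZR_INZ, Z2Nat.id; [lra|].
    apply le_IZR. pose proof (pow2_ge_0 (K / e)). lra. }
  assert (Hs : K / e <= sqrt (INR (Datatypes.S M))).
  { assert (HKe : 0 <= K / e) by (apply Rle_mult_inv_pos; assumption).
    rewrite <- (sqrt_pow2 (K / e)) by exact HKe. apply sqrt_le_1_alt, HM. }
  assert (HsM : 0 < sqrt (INR (Datatypes.S M))) by (apply sqrt_lt_R0, lt_0_INR; lia).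
  assert (K / sqrt (INR (Datatypes.S M)) <= e); [|lra].
  apply Rle_div_l; [exact HsM|]. apply Rle_div_l in Hs; [lra|exact He].
Qed.

Lemma act_LPmul h1 h2 w n : act (LPmul h1 h2) w n = act h1 (act h2 w) n.
Proof.
  rewrite act_ev, ev_mul, act_ev. apply ev_ext'. intros k. rewrite act_ev.
  apply ev_ext'. intros l. rewrite vsub_vadd. reflexivity.
Qed.

Lemma act_comm h1 h2 w n : act h1 (act h2 w) n = act h2 (act h1 w) n.
Proof.
  rewrite <- !act_LPmul, !act_ev, !ev_mul, ev_swap. apply ev_ext'. intros k.
  apply ev_ext'. intros l. rewrite vadd_comm. reflexivity.
Qed.

Lemma act_ext h w w' n : wfLP d h -> length n = d ->
  (forall m, length m = d -> w m = w' m) -> act h w n = act h w' n.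
Proof.
  intros Hh Hn E. rewrite !act_ev. apply (ev_ext d); [exact Hh|].
  intros k Hk. apply E, vsub_length; assumption.
Qed.

Lemma act_dirac h n : wfLP d h -> length n = d ->
  act h (dirac (zerovec d)) n = IZR (coef h n).
Proof.
  intros Hh Hn. rewrite act_ev, coef_ev. apply (ev_ext d); [exact Hh|].
  intros k Hk. unfold dirac. pose proof (vsub_eq_zero d n k Hn Hk) as E.
  destruct (pt_dec (vsub n k) (zerovec d)), (pt_dec k n); tauto.
Qed.

Lemma ell1_ext g g' : (forall n, length n = d -> g n = g' n) -> ell1 d g -> ell1 d g'.
Proof.
  intros E [B HB]. exists B. intros S ND HS. specialize (HB S ND HS).
  rewrite Forall_forall in HS. eapply Rle_trans; [|exact HB]. apply Req_le.
  apply (sumL_ext S (fun n => Rabs (g' n)) (fun n => Rabs (g n))).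
  intros n Hn. rewrite E; auto.
Qed.

Lemma ell1_add g g' : ell1 d g -> ell1 d g' -> ell1 d (fun n => g n + g' n).
Proof.
  intros [B HB] [B' HB']. exists (B + B'). intros S ND HS.
  specialize (HB S ND HS). specialize (HB' S ND HS).
  apply Rle_trans with (sumL S (fun n => Rabs (g n) + Rabs (g' n))).
  - apply (sumL_le S (fun n => Rabs (g n + g' n))). intros n _. apply Rabs_triang.
  - rewrite sumL_plus. apply Rplus_le_compat; assumption.
Qed.

(** (f a) w = a (f w) = a, which has finite support. *)
Lemma ell1_lap_multiple a : (2 <= d)%nat -> wfLP d a ->
  ell1 d (act (LPmul (fLap d) a) (wgreen d)).
Proof.
  intros Hd Ha. apply ell1_ext with (fun n => IZR (coef a n)).
  - intros n Hn. rewrite act_LPmul, act_comm, <- act_dirac by assumption.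
    apply act_ext; [exact Ha|exact Hn|]. intros m Hm. symmetry. apply lap_wgreen; assumption.
  - exists (sumL a (fun p => Rabs (IZR (fst p)))). intros S ND _.
    apply (sum_coef_le_nb (mkW a Ha) _ S (nb_list (mkW a Ha)) ND).
Qed.

Lemma ell1_aug_cube b : (2 <= d)%nat -> augI3 d b -> ell1 d (act b (wgreen d)).
Proof.
  intros Hd [T [HT Hb]]. rewrite LPeq_ev in Hb.
  apply ell1_ext with (act (fold_right (fun '(x, y, z) acc =>
    LPmul (LPmul x y) z ++ acc) [] T) (wgreen d)).
  { intros n _. rewrite !act_ev. symmetry. apply Hb. }
  clear Hb b. induction T as [|[[x y] z] T IH].
  - exists 0. intros S _ _. apply Req_le.
    apply (sumL_zero S (fun n => Rabs 0)). intros. apply Rabs_R0.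
  - inversion HT as [|? ? Hxyz HT']; subst. destruct Hxyz as [Hx [Hy Hz]]. specialize (IH HT').
    set (r := fold_right _ _ T) in *. simpl fold_right. fold r.
    apply ell1_ext with (fun n => act (LPmul (LPmul x y) z) (wgreen d) n + act r (wgreen d) n).
    { intros n _. symmetry. rewrite !act_ev. apply ev_app. }
    apply ell1_add; [|exact IH].
    exact (triple_ell1 (mkW x (proj1 Hx)) (mkW y (proj1 Hy)) (mkW z (proj1 Hz)) Hd Hx Hy Hz).
Qed.

End Summability.

(** * Vanishing moments *)

Lemma sumL_filter {A} (p : A -> bool) (T : list A) G :
  sumL (filter p T) G = sumL T (fun m => if p m then G m else 0).
Proof.
  induction T as [|x T IH]; [reflexivity|]. unfold sumL in *. simpl.
  destruct (p x); simpl; rewrite IH; ring.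
Qed.

Lemma sumL_subset (S T : list pt) G : NoDup S -> NoDup T -> incl S T ->
  sumL T G = sumL S G + sumL (filter (fun m => if in_dec pt_dec m S then false else true) T) G.
Proof.
  intros HS HT HI. rewrite sumL_filter.
  replace (sumL S G) with (sumL T (fun m => if in_dec pt_dec m S then G m else 0)).
  - rewrite <- sumL_plus. apply sumL_ext. intros m _. destruct in_dec; ring.
  - rewrite (sumL_ext T _ (fun m => sumL S (fun s => if pt_dec s m then G m else 0))).
    + rewrite sumL_swap. apply sumL_ext. intros s Hs. apply (sumL_single pt_dec); auto.
    + intros m _.
      rewrite (sumL_ext S _ (fun s => if pt_dec m s then G m else 0)).
      * destruct in_dec as [Hi|Hi]; symmetry.
        -- apply (sumL_single pt_dec S m (fun _ => G m)); assumption.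
        -- apply (sumL_single_out pt_dec S m (fun _ => G m)); assumption.
      * intros s _. destruct (pt_dec s m), (pt_dec m s); congruence.
Qed.

Lemma NoDup_map_inj {A B} (g : A -> B) (S : list A) :
  (forall x y, In x S -> In y S -> g x = g y -> x = y) -> NoDup S -> NoDup (map g S).
Proof.
  intros Hi ND. induction ND as [|x S Hx ND IH]; [constructor|]. simpl. constructor.
  - intros Hin. apply in_map_iff in Hin. destruct Hin as [y [E Hy]].
    apply Hx. rewrite (Hi x y); [exact Hy|left; reflexivity|right; exact Hy|congruence].
  - apply IH. intros a b Ha Hb. apply Hi; right; assumption.
Qed.

Definition tail_le (d : nat) (v : pt -> R) (S : list pt) (delta : R) : Prop :=
  forall T, NoDup T -> (forall n, In n T -> length n = d) ->
    (forall n, In n T -> ~ In n S) -> sumL T (fun n => Rabs (v n)) <= delta.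

(** S is a finite set whose sum is within delta of the supremum; a disjoint set of larger mass would
    push the union above it. *)
Lemma ell1_tail d v delta : ell1 d v -> 0 < delta -> exists S : list pt,
  NoDup S /\ (forall n, In n S -> length n = d) /\ tail_le d v S delta.
Proof.
  intros [B HB] Hd.
  set (E := fun x => exists S, NoDup S /\ (forall n, In n S -> length n = d) /\
                     x = sumL S (fun n => Rabs (v n))).
  destruct (completeness E) as [s [Hub Hlub]].
  { exists B. intros x [S [ND [HS ->]]]. apply HB; [exact ND|]. apply Forall_forall, HS. }
  { exists 0, []. split; [constructor|]. split; [intros n []|reflexivity]. }
  destruct (classic (exists x, E x /\ s - delta < x)) as [[x [[S [ND [HS Ex]]] Hx]]|N].
  - exists S. split; [exact ND|]. split; [exact HS|]. intros T NT HT HD.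
    assert (L : sumL (S ++ T) (fun n => Rabs (v n)) <= s).
    { apply Hub. exists (S ++ T). split; [|split; [|reflexivity]].
      - apply NoDup_app; auto. intros a Ha Hb. exact (HD a Hb Ha).
      - intros n Hn. apply in_app_or in Hn. destruct Hn; auto. }
    rewrite sumL_app in L. lra.
  - exfalso. assert (s <= s - delta); [|lra]. apply Hlub. intros x Hx.
    destruct (Rle_dec x (s - delta)) as [L|L]; [exact L|].
    exfalso. apply N. exists x. split; [exact Hx|lra].
Qed.

Section Moments.
Context {d : nat}.
Notation W := (W d).
Notation td := (tdot d).

(** The shift is m + k, against n - k in [act], because f acts on psi through the adjoint of
    convolution when it is moved off v. *)
Definition eigen (psi : pt -> R) (lam : R) : Prop := forall m, length m = d ->
  ev (fLap d) (fun k => psi (vadd m k)) = lam * psi m.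

Lemma eigen_wave c t : eigen (fun n => cos (c - 2 * PI * td n t)) (Fsym d t).
Proof.
  intros m Hm. rewrite <- hat_lap. unfold hat. simpl wv.
  apply (ev_ext d); [apply fLap_wf|]. intros k Hk. rewrite td_vadd by assumption.
  f_equal. ring.
Qed.

Lemma eigen_lin psi psi' lam a b : eigen psi lam -> eigen psi' lam ->
  eigen (fun n => a * psi n + b * psi' n) lam.
Proof. intros H H' m Hm. rewrite ev_plus, !ev_scal, H, H' by exact Hm. ring. Qed.

Lemma eigen_ext psi psi' lam : (forall n, psi n = psi' n) -> eigen psi lam -> eigen psi' lam.
Proof.
  intros E H m Hm. rewrite <- E, <- H by exact Hm. apply ev_ext'. intros. symmetry. apply E.
Qed.

Lemma tail_diff (v : pt -> R) (S T : list pt) (psi : pt -> R) delta C : NoDup S -> NoDup T -> incl S T ->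
  (forall n, In n T -> length n = d) -> tail_le d v S delta -> 0 <= C ->
  (forall n, Rabs (psi n) <= C) ->
  Rabs (sumL T (fun m => v m * psi m) - sumL S (fun m => v m * psi m)) <= C * delta.
Proof.
  intros NS NT HI HT Ht HC Hp. rewrite (sumL_subset S T) by assumption.
  match goal with |- Rabs (?a + ?b - ?a') <= _ => replace (a + b - a') with b by ring end.
  eapply Rle_trans; [apply sumL_abs|].
  eapply Rle_trans; [apply (sumL_le _ _ (fun m => C * Rabs (v m)))|].
  - intros m _. rewrite Rabs_mult. specialize (Hp m). pose proof (Rabs_pos (v m)). nra.
  - rewrite sumL_scal. apply Rmult_le_compat_l; [exact HC|]. apply Ht.
    + apply NoDup_filter, NT.
    + intros n Hn. apply filter_In in Hn. apply HT, Hn.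
    + intros n Hn. apply filter_In in Hn. destruct Hn as [_ Hn].
      destruct in_dec; [discriminate|assumption].
Qed.

(** Formally the pairing of g = f v with psi is that of v with f psi = lam psi. As v has infinite
    support, the summation by parts is done on finite sets. Its error does not carry the factor lam,
    so it gets a tolerance of its own, eta, which is sent to 0; the tail delta is multiplied by lam
    and may stay. *)
Lemma eigen_pairing (g : W) v psi lam (S : list pt) delta :
  ell1 d v -> (forall n, length n = d -> act (fLap d) v n = IZR (coef (wv g) n)) ->
  eigen psi lam -> (forall n, Rabs (psi n) <= 2) ->
  NoDup S -> (forall n, In n S -> length n = d) -> tail_le d v S delta ->
  Rabs (ev (wv g) psi) <= Rabs lam * (sumL S (fun m => Rabs (v m) * Rabs (psi m)) + 2 * delta).
Proof.
  intros Hv Hg He Hp NS HS Ht.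
  set (L := sumL (fLap d) (fun p => Rabs (IZR (fst p)))).
  assert (HL : 0 <= L) by (apply sumL_ge0; intros; apply Rabs_pos).
  apply le_epsilon. intros e He0. set (eta := e / (2 * L + 1)).
  assert (Heta : 0 < eta) by (apply Rdiv_lt_0_compat; lra).
  destruct (ell1_tail d v eta Hv Heta) as [S2 [NS2 [HS2 Ht2]]].
  set (S3 := nodup pt_dec (S ++ S2)).
  assert (N3 : NoDup S3) by apply NoDup_nodup.
  assert (I3 : incl S S3) by (intros n Hn; apply nodup_In, in_or_app; auto).
  assert (H3 : forall n, In n S3 -> length n = d).
  { intros n Hn. apply nodup_In, in_app_or in Hn. destruct Hn; auto. }
  assert (Ht3 : tail_le d v S3 eta).
  { intros T NT HT HD. apply Ht2; auto. intros n Hn Hn2. apply (HD n Hn).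
    apply nodup_In, in_or_app; auto. }
  pose proof (fLap_wf (d := d)) as Wf. unfold wfLP in Wf. rewrite Forall_forall in Wf.
  pose proof (wwf g) as Wg. unfold wfLP in Wg. rewrite Forall_forall in Wg.
  (* B contains the support of g and all translates of S3 by exponents of f, so each set B - k still
     contains S3 and differs from it only in the tail of v. *)
  set (B := nodup pt_dec (map snd (wv g) ++
              flat_map (fun p => map (fun m => vadd m (snd p)) S3) (fLap d))).
  assert (NB : NoDup B) by apply NoDup_nodup.
  assert (HB : forall n, In n B -> length n = d).
  { intros n Hn. apply nodup_In, in_app_or in Hn. destruct Hn as [Hn|Hn].
    - apply in_map_iff in Hn. destruct Hn as [p [<- Hn]]. auto.
    - apply in_flat_map in Hn. destruct Hn as [p [Hpf Hn]]. apply in_map_iff in Hn.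
      destruct Hn as [m [<- Hm]]. apply vadd_length; auto. }
  assert (E1 : ev (wv g) psi = ev (fLap d) (fun k => sumL B (fun n => v (vsub n k) * psi n))).
  { rewrite (ev_coef (wv g) B psi NB).
    - rewrite ev_sumL. apply sumL_ext. intros n Hn. rewrite <- Hg by auto.
      rewrite act_ev, Rmult_comm, <- ev_scal. apply ev_ext'. intros; ring.
    - intros p Hpg. apply nodup_In, in_or_app. left. apply in_map, Hpg. }
  assert (E2 : ev (fLap d) (fun k => sumL S3 (fun m => v m * psi (vadd m k))) =
               lam * sumL S3 (fun m => v m * psi m)).
  { rewrite ev_sumL, <- sumL_scal. apply sumL_ext. intros m Hm.
    rewrite ev_scal, He by auto. ring. }
  assert (D1 : Rabs (ev (wv g) psi - lam * sumL S3 (fun m => v m * psi m)) <= 2 * eta * L).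
  { rewrite E1, <- E2, <- ev_minus. eapply Rle_trans; [apply sumL_abs|].
    unfold L. rewrite <- sumL_scal. apply sumL_le. intros p Hpf.
    rewrite Rabs_mult, Rmult_comm. apply Rmult_le_compat_r; [apply Rabs_pos|].
    set (k := snd p).
    assert (Hk : length k = d) by (apply Wf, Hpf).
    replace (sumL B (fun n => v (vsub n k) * psi n)) with
      (sumL (map (fun n => vsub n k) B) (fun m => v m * psi (vadd m k))).
    - apply (tail_diff v S3 (map (fun n => vsub n k) B) (fun m => psi (vadd m k))); auto; try lra.
      + apply NoDup_map_inj; [|exact NB]. intros x y Hx Hy E.
        rewrite <- (vsub_cancel d x k), E by auto. apply (vsub_cancel d); auto.
      + intros m Hm. apply in_map_iff. exists (vadd m k). split.
        * apply (vadd_cancel d); auto.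
        * apply nodup_In, in_or_app. right. apply in_flat_map. exists p.
          split; [exact Hpf|]. apply in_map_iff. exists m. auto.
      + intros n Hn. apply in_map_iff in Hn. destruct Hn as [x [<- Hx]].
        apply vsub_length; auto.
    - rewrite sumL_map. apply sumL_ext. intros n Hn. rewrite (vsub_cancel d) by auto.
      reflexivity. }
  pose proof (tail_diff v S S3 psi delta 2 NS N3 I3 H3 Ht ltac:(lra) Hp) as D2.
  assert (D3 : Rabs (sumL S (fun m => v m * psi m)) <=
               sumL S (fun m => Rabs (v m) * Rabs (psi m))).
  { eapply Rle_trans; [apply sumL_abs|]. apply sumL_le. intros m _. rewrite Rabs_mult. lra. }
  set (a := ev (wv g) psi) in *. set (b := sumL S3 (fun m => v m * psi m)) in *.
  set (s := sumL S (fun m => v m * psi m)) in *.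
  assert (D4 : Rabs b <= sumL S (fun m => Rabs (v m) * Rabs (psi m)) + 2 * delta).
  { replace b with (s + (b - s)) by ring. eapply Rle_trans; [apply Rabs_triang|]. lra. }
  replace a with (lam * b + (a - lam * b)) by ring.
  eapply Rle_trans; [apply Rabs_triang|]. rewrite Rabs_mult. apply Rplus_le_compat.
  - apply Rmult_le_compat_l; [apply Rabs_pos|exact D4].
  - eapply Rle_trans; [exact D1|]. unfold eta.
    apply Rle_trans with (e / (2 * L + 1) * (2 * L + 1)).
    + fold eta. nra.
    + apply Req_le. field. lra.
Qed.

(** The pairing of g with psi is th^2 times the wanted moment, up to O(th^3). By [eigen_pairing] it
    is also at most lam = O(th^2) times a quantity that can be made small: psi is O(th) on S, and v
    has small mass outside. Division by th^2 gives the claim. The constants c n grow with n, which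
    is why the tail of v is cut off rather than estimated through c. *)
Lemma moment_vanishes (g : W) v (psi : R -> pt -> R) (lam : R -> R) (p c : pt -> R) C :
  ell1 d v -> (forall n, length n = d -> act (fLap d) v n = IZR (coef (wv g) n)) ->
  0 <= C ->
  (forall th, 0 < th <= 1 -> eigen (psi th) (lam th) /\ Rabs (lam th) <= C * th ^ 2 /\
     forall n, Rabs (psi th n) <= 2 /\ Rabs (psi th n) <= th * c n /\
       Rabs (psi th n - th ^ 2 * p n) <= th ^ 3 * c n) ->
  ev (wv g) p = 0.
Proof.
  intros Hv Hg HC H.
  assert (Hc : forall n, 0 <= c n).
  { intros n. destruct (H 1 ltac:(lra)) as [_ [_ H1]]. destruct (H1 n) as [_ [H2 _]].
    pose proof (Rabs_pos (psi 1 n)). lra. }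
  set (G := sumL (wv g) (fun q => Rabs (IZR (fst q)) * c (snd q))).
  assert (HG : 0 <= G).
  { apply sumL_ge0. intros q _. apply Rmult_le_pos; [apply Rabs_pos|apply Hc]. }
  assert (Z : Rabs (ev (wv g) p) <= 0); [|pose proof (Rabs_pos (ev (wv g) p));
    destruct (Req_dec (ev (wv g) p) 0) as [E|E]; [exact E|];
    pose proof (Rabs_pos_lt _ E); lra].
  apply le_epsilon. intros e He.
  (* delta is chosen first because it determines S; V and then th depend on S. The denominators make
     2 C delta and th K at most e/2 each. *)
  set (delta := e / (4 * C + 1)).
  assert (Hdelta : 0 < delta) by (apply Rdiv_lt_0_compat; lra).
  destruct (ell1_tail d v delta Hv Hdelta) as [S [NS [HS Ht]]].
  set (V := sumL S (fun m => Rabs (v m) * c m)).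
  assert (HV : 0 <= V).
  { apply sumL_ge0. intros q _. apply Rmult_le_pos; [apply Rabs_pos|apply Hc]. }
  set (K := C * V + G). assert (HK : 0 <= K) by (unfold K; nra).
  set (th := Rmin 1 (e / (2 * K + 1))).
  assert (Hth : 0 < th <= 1).
  { unfold th. split; [apply Rmin_glb_lt; [lra|apply Rdiv_lt_0_compat; lra]|apply Rmin_l]. }
  assert (HthK : th * K <= e / 2).
  { apply Rle_trans with (e / (2 * K + 1) * K).
    - apply Rmult_le_compat_r; [exact HK|apply Rmin_r].
    - apply (Rmult_le_reg_r (2 * K + 1)); [lra|].
      replace (e / (2 * K + 1) * K * (2 * K + 1)) with (e * K) by (field; lra). nra. }
  destruct (H th Hth) as [Heig [Hlam Hb]].
  pose proof (eigen_pairing g v (psi th) (lam th) S delta Hv Hg Heig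
    (fun n => proj1 (Hb n)) NS HS Ht) as P.
  assert (P1 : sumL S (fun m => Rabs (v m) * Rabs (psi th m)) <= th * V).
  { unfold V. rewrite <- sumL_scal. apply sumL_le. intros m _.
    destruct (Hb m) as [_ [Hm _]].
    replace (th * (Rabs (v m) * c m)) with (Rabs (v m) * (th * c m)) by ring.
    apply Rmult_le_compat_l; [apply Rabs_pos|exact Hm]. }
  assert (P2 : Rabs (ev (wv g) (psi th) - th ^ 2 * ev (wv g) p) <= th ^ 3 * G).
  { rewrite <- ev_scal, <- ev_minus. eapply Rle_trans; [apply sumL_abs|].
    unfold G. rewrite <- sumL_scal. apply sumL_le. intros q _. rewrite Rabs_mult.
    destruct (Hb (snd q)) as [_ [_ Hm]].
    replace (th ^ 3 * (Rabs (IZR (fst q)) * c (snd q)))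
      with (Rabs (IZR (fst q)) * (th ^ 3 * c (snd q))) by ring.
    apply Rmult_le_compat_l; [apply Rabs_pos|exact Hm]. }
  assert (P3 : Rabs (ev (wv g) (psi th)) <= C * th ^ 2 * (th * V + 2 * delta)).
  { assert (P0 : 0 <= sumL S (fun m => Rabs (v m) * Rabs (psi th m)))
      by (apply sumL_ge0; intros m _; apply Rmult_le_pos; apply Rabs_pos).
    eapply Rle_trans; [exact P|].
    apply Rmult_le_compat; [apply Rabs_pos|lra|exact Hlam|lra]. }
  assert (Hth2 : 0 < th ^ 2) by (apply pow_lt; lra).
  assert (P4 : th ^ 2 * Rabs (ev (wv g) p) <= th ^ 2 * (th * K + 2 * C * delta)).
  { rewrite <- (Rabs_pos_eq (th ^ 2)) at 1 by lra. rewrite <- Rabs_mult.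
    replace (th ^ 2 * ev (wv g) p) with
      (ev (wv g) (psi th) - (ev (wv g) (psi th) - th ^ 2 * ev (wv g) p)) by ring.
    eapply Rle_trans; [apply Rabs_triang|]. rewrite Rabs_Ropp.
    eapply Rle_trans; [apply Rplus_le_compat; [exact P3|exact P2]|].
    apply Req_le. unfold K. ring. }
  apply Rmult_le_reg_l in P4; [|exact Hth2].
  assert (2 * C * delta <= e / 2); [|lra].
  unfold delta. apply (Rmult_le_reg_r (4 * C + 1)); [lra|].
  replace (2 * C * (e / (4 * C + 1)) * (4 * C + 1)) with (2 * C * e) by (field; lra). nra.
Qed.

Lemma sin_sub_id x : Rabs (sin x - x) <= x ^ 2.
Proof.
  replace (sin x - x) with ((sin x - x) - (sin 0 - 0)) by (rewrite sin_0; ring).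
  replace (x ^ 2) with (Rabs x * Rabs (x - 0)).
  2:{ rewrite Rminus_0_r, <- Rabs_mult, Rabs_pos_eq; [ring|nra]. }
  apply (bounded_variation (fun x => sin x - x) (fun x => cos x - 1)). intros t Ht. split.
  - auto_derive; [exact I|ring].
  - rewrite !Rminus_0_r in Ht. eapply Rle_trans; [|exact Ht].
    pose proof (cos_lipschitz t 0) as L. rewrite cos_0, Rminus_0_r in L. exact L.
Qed.

Lemma cos_second_order x : Rabs (2 - 2 * cos x - x ^ 2) <= Rabs x ^ 3.
Proof.
  replace (2 - 2 * cos x) with (2 - 2 * cos (2 * (x / 2))) by (do 3 f_equal; field).
  rewrite two_minus_two_cos. set (s := sin (x / 2)).
  replace ((2 * s) ^ 2 - x ^ 2) with (2 * (s - x / 2) * (2 * s + x)) by field.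
  pose proof (sin_sub_id (x / 2)) as H1. pose proof (sin_le_abs (x / 2)) as H2.
  fold s in H1, H2. rewrite !Rabs_mult, (Rabs_pos_eq 2) by lra.
  assert (H3 : Rabs (x / 2) = Rabs x / 2).
  { unfold Rdiv. rewrite Rabs_mult, (Rabs_pos_eq (/ 2)); lra. }
  rewrite H3 in H2.
  assert (H4 : Rabs (2 * s + x) <= 2 * Rabs x).
  { eapply Rle_trans; [apply Rabs_triang|]. rewrite Rabs_mult, (Rabs_pos_eq 2); lra. }
  assert (H5 : 2 * Rabs (s - x / 2) <= Rabs x ^ 2 / 2).
  { rewrite pow2_abs. replace (x ^ 2 / 2) with (2 * (x / 2) ^ 2) by field. lra. }
  replace (Rabs x ^ 3) with ((Rabs x ^ 2 / 2) * (2 * Rabs x)) by field.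
  apply Rmult_le_compat; auto; [|apply Rabs_pos].
  apply Rmult_le_pos; [lra|apply Rabs_pos].
Qed.

Lemma two_minus_two_cos_le x : 0 <= 2 - 2 * cos x <= x ^ 2.
Proof.
  replace (2 - 2 * cos x) with (2 - 2 * cos (2 * (x / 2))) by (do 3 f_equal; field).
  rewrite two_minus_two_cos. split; [apply pow2_ge_0|].
  rewrite <- pow2_abs, <- (pow2_abs x). apply pow_incr. split; [apply Rabs_pos|].
  pose proof (sin_le_abs (x / 2)) as H. unfold Rdiv in *.
  rewrite Rabs_mult, (Rabs_pos_eq (/ 2)) in H by lra.
  rewrite Rabs_mult, (Rabs_pos_eq 2) by lra. lra.
Qed.

Definition e_ (i j : nat) : R := if Nat.eqb j i then 1 else 0.

Lemma eigen_wave_scaled c th a :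
  eigen (fun n => cos (c - th * td n a)) (sumL (seq 0 d) (fun j => 2 - 2 * cos (th * a j))).
Proof.
  pose proof PI_RGT_0 as HPI.
  pose proof (eigen_wave c (fun j => th / (2 * PI) * a j)) as H. rewrite F_terms in H.
  rewrite (sumL_ext _ _ (fun j => 2 - 2 * cos (th * a j))) in H.
  - eapply eigen_ext; [|exact H]. intros n. simpl. do 2 f_equal.
    rewrite !td_sum, <- !sumL_scal. apply sumL_ext. intros j _. field. lra.
  - intros j _. do 3 f_equal. field. lra.
Qed.

Lemma td_unit_vector n i : (i < d)%nat -> td n (e_ i) = IZR (co n i).
Proof.
  intros Hi. rewrite td_sum.
  rewrite <- (sumL_single Nat.eq_dec (seq 0 d) i (fun j => IZR (co n j)));
    [|apply seq_NoDup|apply in_seq; lia].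
  apply sumL_ext. intros j _. unfold e_.
  destruct (Nat.eqb_spec j i), (Nat.eq_dec i j); try congruence; ring.
Qed.

Lemma td_comb n a b x y : td n (fun j => x * a j + y * b j) = x * td n a + y * td n b.
Proof.
  rewrite !td_sum, <- !sumL_scal, <- sumL_plus. apply sumL_ext. intros; ring.
Qed.

Lemma sum_symbol_unit th i : (i < d)%nat ->
  sumL (seq 0 d) (fun j => 2 - 2 * cos (th * e_ i j)) = 2 - 2 * cos th.
Proof.
  intros Hi.
  rewrite <- (sumL_single Nat.eq_dec (seq 0 d) i (fun _ => 2 - 2 * cos th));
    [|apply seq_NoDup|apply in_seq; lia].
  apply sumL_ext. intros j _. unfold e_.
  destruct (Nat.eqb_spec j i), (Nat.eq_dec i j); try congruence.
  - rewrite Rmult_1_r. reflexivity.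
  - rewrite Rmult_0_r, cos_0. ring.
Qed.

Lemma sum_symbol_pair th i j s : (i < d)%nat -> (j < d)%nat -> i <> j -> s = 1 \/ s = -1 ->
  sumL (seq 0 d) (fun l => 2 - 2 * cos (th * (1 * e_ i l + s * e_ j l))) = 4 - 4 * cos th.
Proof.
  intros Hi Hj Hij Hs.
  replace (4 - 4 * cos th) with ((2 - 2 * cos th) + (2 - 2 * cos th)) by ring.
  rewrite <- (sum_symbol_unit th i Hi) at 1. rewrite <- (sum_symbol_unit th j Hj) at 1.
  rewrite <- sumL_plus. apply sumL_ext. intros l _. unfold e_.
  destruct (Nat.eqb_spec l i), (Nat.eqb_spec l j); subst; try congruence.
  - replace (th * (1 * 1 + s * 0)) with th by ring.
    replace (th * 1) with th by ring. rewrite Rmult_0_r, cos_0. ring.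
  - replace (th * 1) with th by ring. replace (th * 0) with 0 by ring.
    rewrite cos_0. destruct Hs as [-> | ->].
    + replace (th * (1 * 0 + 1 * 1)) with th by ring. ring.
    + replace (th * (1 * 0 + -1 * 1)) with (- th) by ring. rewrite cos_neg. ring.
  - replace (th * (1 * 0 + s * 0)) with 0 by ring. rewrite Rmult_0_r, cos_0. ring.
Qed.

Context (g : W) (v : pt -> R) (Hv : ell1 d v)
  (Hg : forall n, length n = d -> act (fLap d) v n = IZR (coef (wv g) n)).

(** Constants have eigenvalue 0; the factor th^2 only brings them to the required order. *)
Lemma moment_0 : ev (wv g) (fun _ => 1) = 0.
Proof.
  apply (moment_vanishes g v (fun th _ => th ^ 2) (fun _ => 0) (fun _ => 1) (fun _ => 1) 0);
    auto; try lra.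
  intros th Hth. split; [|split].
  - pose proof (eigen_wave_scaled 0 0 (fun _ => 0)) as H.
    rewrite (sumL_zero (seq 0 d)) in H.
    + pose proof (eigen_lin _ _ _ (th ^ 2) 0 H H) as H'.
      eapply eigen_ext; [|exact H']. intros n. cbv beta.
      replace (0 - 0 * td n (fun _ => 0)) with 0 by ring. rewrite cos_0. ring.
    + intros j _. rewrite Rmult_0_l, cos_0. ring.
  - rewrite Rabs_R0. nra.
  - intros n. assert (0 <= th ^ 2 <= th) by nra. assert (0 <= th ^ 3) by (apply pow_le; lra).
    rewrite (Rabs_pos_eq (th ^ 2)) by lra. repeat split; try lra.
    replace (th ^ 2 - th ^ 2 * 1) with 0 by ring. rewrite Rabs_R0. lra.
Qed.

(** The phase PI/2 turns the wave into a sine, of first order in th; the extra factor th raises it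
    to second order. *)
Lemma moment_1 i : (i < d)%nat -> ev (wv g) (fun n => IZR (co n i)) = 0.
Proof.
  intros Hi.
  apply (moment_vanishes g v (fun th n => th * sin (th * IZR (co n i)))
    (fun th => 2 - 2 * cos th) _ (fun n => 1 + IZR (co n i) ^ 2) 1); auto; try lra.
  intros th Hth. split; [|split].
  - pose proof (eigen_wave_scaled (PI / 2) th (e_ i)) as H.
    rewrite (sum_symbol_unit th i Hi) in H.
    pose proof (eigen_lin _ _ _ th 0 H H) as H'.
    eapply eigen_ext; [|exact H']. intros n. cbv beta.
    rewrite td_unit_vector, cos_shift by exact Hi. ring.
  - pose proof (two_minus_two_cos_le th). rewrite Rabs_pos_eq; lra.
  - intros n. set (x := IZR (co n i)). pose proof (Rabs_sin_le1 (th * x)) as S1.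
    pose proof (sin_sub_id (th * x)) as S2. pose proof (pow2_ge_0 x).
    assert (0 <= th ^ 3) by (apply pow_le; lra).
    replace (th * sin (th * x) - th ^ 2 * x) with (th * (sin (th * x) - th * x)) by ring.
    rewrite !Rabs_mult, (Rabs_pos_eq th) by lra. repeat split; nra.
Qed.

(** The waves in the directions e_i + e_j and e_i - e_j have the same eigenvalue 4 - 4 cos th, so
    half their difference, the product of the two sines, is again an eigenfunction. *)
Lemma moment_2_off i j : (i < d)%nat -> (j < d)%nat -> i <> j ->
  ev (wv g) (fun n => IZR (co n i) * IZR (co n j)) = 0.
Proof.
  intros Hi Hj Hij.
  apply (moment_vanishes g v (fun th n => sin (th * IZR (co n i)) * sin (th * IZR (co n j)))
    (fun th => 4 - 4 * cos th) _ (fun n => Rabs (IZR (co n i)) +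
      (IZR (co n i) ^ 2 * Rabs (IZR (co n j)) + Rabs (IZR (co n i)) * IZR (co n j) ^ 2)) 2);
    auto; try lra.
  intros th Hth. split; [|split].
  - pose proof (eigen_wave_scaled 0 th (fun l => 1 * e_ i l + -1 * e_ j l)) as H1.
    cbv beta in H1. rewrite (sum_symbol_pair th i j (-1)) in H1 by auto.
    pose proof (eigen_wave_scaled 0 th (fun l => 1 * e_ i l + 1 * e_ j l)) as H2.
    cbv beta in H2. rewrite (sum_symbol_pair th i j 1) in H2 by auto.
    pose proof (eigen_lin _ _ _ (/ 2) (- / 2) H1 H2) as H'.
    eapply eigen_ext; [|exact H']. intros n. cbv beta.
    rewrite !td_comb, !td_unit_vector by assumption.
    set (x := IZR (co n i)). set (y := IZR (co n j)).
    replace (0 - th * (1 * x + -1 * y)) with (th * y - th * x) by ring.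
    replace (0 - th * (1 * x + 1 * y)) with (- (th * y + th * x)) by ring.
    rewrite cos_neg, cos_plus, cos_minus. field.
  - pose proof (two_minus_two_cos_le th). rewrite Rabs_pos_eq; lra.
  - intros n. set (x := IZR (co n i)). set (y := IZR (co n j)).
    pose proof (Rabs_sin_le1 (th * x)). pose proof (Rabs_sin_le1 (th * y)).
    pose proof (sin_le_abs (th * x)) as L1. pose proof (sin_le_abs (th * y)) as L2.
    pose proof (sin_sub_id (th * x)) as S1. pose proof (sin_sub_id (th * y)) as S2.
    pose proof (Rabs_pos (sin (th * x))). pose proof (Rabs_pos (sin (th * y))).
    pose proof (Rabs_pos x). pose proof (Rabs_pos y).
    pose proof (pow2_ge_0 x). pose proof (pow2_ge_0 y).
    assert (0 <= th ^ 3) by (apply pow_le; lra).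
    rewrite Rabs_mult in L1, L2. rewrite (Rabs_pos_eq th) in L1, L2 by lra.
    assert (N : 0 <= x ^ 2 * Rabs y + Rabs x * y ^ 2) by nra.
    rewrite Rabs_mult. split; [nra|]. split.
    + apply Rle_trans with (th * Rabs x); [nra|]. apply Rmult_le_compat_l; lra.
    + replace (sin (th * x) * sin (th * y) - th ^ 2 * (x * y)) with
        ((sin (th * x) - th * x) * sin (th * y) + (th * x) * (sin (th * y) - th * y)) by ring.
      eapply Rle_trans; [apply Rabs_triang|]. rewrite !Rabs_mult, (Rabs_pos_eq th) by lra.
      apply Rle_trans with ((th * x) ^ 2 * (th * Rabs y) + th * Rabs x * (th * y) ^ 2).
      * apply Rplus_le_compat.
        -- apply Rmult_le_compat; auto using Rabs_pos.
        -- apply Rmult_le_compat_l; [nra|exact S2].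
      * replace ((th * x) ^ 2 * (th * Rabs y) + th * Rabs x * (th * y) ^ 2) with
          (th ^ 3 * (x ^ 2 * Rabs y + Rabs x * y ^ 2)) by ring.
        apply Rmult_le_compat_l; lra.
Qed.

(** The waves in directions e_i and e_j share an eigenvalue, and their constant terms cancel in the
    difference. Only differences of squares are reached: 1 and cos(th n_i) have different
    eigenvalues, and indeed the second moments of f itself do not vanish. *)
Lemma moment_2_diag i j : (i < d)%nat -> (j < d)%nat ->
  ev (wv g) (fun n => IZR (co n i) ^ 2) = ev (wv g) (fun n => IZR (co n j) ^ 2).
Proof.
  intros Hi Hj.
  assert (Z : ev (wv g) (fun n => / 2 * (IZR (co n i) ^ 2 - IZR (co n j) ^ 2)) = 0).
  2:{ rewrite ev_scal, ev_minus in Z. lra. }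
  apply (moment_vanishes g v (fun th n => cos (th * IZR (co n j)) - cos (th * IZR (co n i)))
    (fun th => 2 - 2 * cos th) _ (fun n => Rabs (IZR (co n i)) + Rabs (IZR (co n j)) +
      (Rabs (IZR (co n i)) ^ 3 + Rabs (IZR (co n j)) ^ 3)) 1); auto; try lra.
  intros th Hth. split; [|split].
  - pose proof (eigen_wave_scaled 0 th (e_ j)) as H1.
    rewrite (sum_symbol_unit th j Hj) in H1.
    pose proof (eigen_wave_scaled 0 th (e_ i)) as H2.
    rewrite (sum_symbol_unit th i Hi) in H2.
    pose proof (eigen_lin _ _ _ 1 (-1) H1 H2) as H'.
    eapply eigen_ext; [|exact H']. intros n. cbv beta.
    rewrite !td_unit_vector by assumption. rewrite !Rminus_0_l, !cos_neg. ring.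
  - pose proof (two_minus_two_cos_le th). rewrite Rabs_pos_eq; lra.
  - intros n. set (x := IZR (co n i)). set (y := IZR (co n j)).
    pose proof (Rabs_pos x) as Px. pose proof (Rabs_pos y) as Py.
    pose proof (pow_le _ 3 Px). pose proof (pow_le _ 3 Py).
    split; [|split].
    + pose proof (COS_bound (th * x)). pose proof (COS_bound (th * y)). apply Rabs_le. lra.
    + eapply Rle_trans; [apply cos_lipschitz|]. rewrite <- Rmult_minus_distr_l, Rabs_mult.
      rewrite (Rabs_pos_eq th) by lra. apply Rmult_le_compat_l; [lra|].
      pose proof (Rabs_triang y (- x)) as T. rewrite Rabs_Ropp in T. unfold Rminus. lra.
    + pose proof (cos_second_order (th * x)) as C1. pose proof (cos_second_order (th * y)) as C2.
      assert (E : forall z, Rabs (th * z) ^ 3 = th ^ 3 * Rabs z ^ 3).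
      { intros z. rewrite Rabs_mult, (Rabs_pos_eq th) by lra. ring. }
      rewrite E in C1, C2.
      assert (T3 : 0 <= th ^ 3) by (apply pow_le; lra).
      apply Rabs_le_between in C1. apply Rabs_le_between in C2.
      assert (0 <= th ^ 3 * (Rabs x + Rabs y)) by (apply Rmult_le_pos; lra).
      apply Rabs_le. nra.
Qed.

End Moments.

(** * The cube of the augmentation ideal *)

Section CubeOfAugmentation.
Context {d : nat}.
Notation W := (W d).
Add Ring Wring4 : (@W_ring d) (setoid (@weq_equiv d) (@W_ring_ext d)).

Notation "x == y" := (weq x y) (at level 70).
Notation "x +: y" := (wadd x y) (at level 50, left associativity).
Notation "x -: y" := (wsub x y) (at level 50, left associativity).
Notation "x *: y" := (wmul x y) (at level 40, left associativity).
Notation one := (@w1 d).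

Definition aug (x : W) : Prop := ev (wv x) (fun _ => 1) = 0.
Definition I3 (x : W) : Prop := augI3 d (wv x).

Lemma aug_augI x : aug x <-> augI d (wv x).
Proof.
  unfold aug, augI. rewrite <- eval1_ev. split.
  - intros H. split; [apply wwf|apply eq_IZR, H].
  - intros [_ ->]. reflexivity.
Qed.

Lemma aug_add x y : aug x -> aug y -> aug (x +: y).
Proof. unfold aug. intros Hx Hy. rewrite ev_wadd, Hx, Hy. ring. Qed.

Lemma aug_mul x y : aug y -> aug (x *: y).
Proof. unfold aug. intros Hy. rewrite ev_wmul, Hy. apply ev_0. Qed.

Lemma aug_diff f : aug (mono f -: one).
Proof. unfold aug, w1. rewrite ev_wsub, ev_mono, ev_wcst. ring. Qed.

Lemma ev_triples (T : list (LP * LP * LP)) phi :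
  ev (fold_right (fun '(x, y, z) acc => LPmul (LPmul x y) z ++ acc) [] T) phi =
  sumL T (fun '(x, y, z) => ev (LPmul (LPmul x y) z) phi).
Proof.
  induction T as [|[[x y] z] T IH]; [reflexivity|].
  simpl fold_right. rewrite ev_app, IH. reflexivity.
Qed.

Global Instance I3_proper : Proper (weq ==> iff) I3.
Proof.
  intros x y E. unfold I3, augI3.
  split; intros [T [HT Hx]]; exists T; (split; [exact HT|]); rewrite LPeq_ev in *;
    intros phi; rewrite <- Hx; [symmetry|]; apply E.
Qed.

Lemma I3_0 : I3 w0.
Proof. exists []. split; [constructor|]. intros n. reflexivity. Qed.

Lemma I3_add x y : I3 x -> I3 y -> I3 (x +: y).
Proof.
  intros [T [HT Hx]] [U [HU Hy]]. exists (T ++ U). split; [apply Forall_app; auto|].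
  rewrite LPeq_ev in *. intros phi.
  rewrite ev_wadd, Hx, Hy, !ev_triples. symmetry. apply sumL_app.
Qed.

Lemma I3_mul q x : I3 x -> I3 (q *: x).
Proof.
  intros [T [HT Hx]]. exists (map (fun '(a, b, c) => (LPmul (wv q) a, b, c)) T). split.
  - apply Forall_map. eapply Forall_impl; [|exact HT]. intros [[a b] c] [Ha [Hb Hc]].
    split; [|split; assumption].
    apply (proj1 (aug_augI (q *: mkW a (proj1 Ha)))), aug_mul.
    apply (proj2 (aug_augI (mkW a (proj1 Ha)))), Ha.
  - rewrite LPeq_ev in *. intros phi. rewrite ev_wmul, ev_triples, sumL_map.
    rewrite (ev_ext' _ _ (fun k => sumL T (fun '(a, b, c) =>
      ev (LPmul (LPmul a b) c) (fun l => phi (vadd k l))))).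
    + rewrite (ev_ext' _ _ (fun k => sumL T (fun p =>
        ev (LPmul (LPmul (fst (fst p)) (snd (fst p))) (snd p)) (fun l => phi (vadd k l))))).
      * rewrite ev_sumL. apply sumL_ext. intros [[a b] c] _. simpl fst. simpl snd.
        rewrite (ev_mul (LPmul (LPmul (wv q) a) b)), (ev_mul (LPmul (wv q) a)), ev_mul.
        apply ev_ext'. intros k. rewrite ev_mul, ev_mul. apply ev_ext'. intros l.
        apply ev_ext'. intros m. apply ev_ext'. intros n. rewrite !vadd_assoc. reflexivity.
      * intros k. apply sumL_ext. intros [[a b] c] _. reflexivity.
    + intros k. rewrite Hx. apply ev_triples.
Qed.

Lemma I3_opp x : I3 x -> I3 (wopp x).
Proof.
  intros H. assert (E : wopp x == wopp one *: x) by ring. rewrite E. apply I3_mul, H.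
Qed.

Lemma I3_sub x y : I3 x -> I3 y -> I3 (x -: y).
Proof. intros. apply I3_add, I3_opp; assumption. Qed.

Lemma I3_triple x y z : aug x -> aug y -> aug z -> I3 (x *: y *: z).
Proof.
  intros Hx Hy Hz. exists [(wv x, wv y, wv z)]. split.
  - repeat constructor; apply aug_augI; assumption.
  - rewrite LPeq_ev. intros phi. rewrite ev_triples. unfold sumL; simpl. ring.
Qed.

Definition X (i : nat) : W := ui 1 i -: one.

Lemma aug_X i : aug (X i).
Proof. apply aug_diff. Qed.

Lemma ui_X i : ui 1 i == one +: X i.
Proof. unfold X. ring. Qed.

Definition binom2 (z : Z) : Z := (z * (z - 1) / 2)%Z.

Lemma binom2_double z : (2 * binom2 z = z * (z - 1))%Z.
Proof.
  unfold binom2. symmetry. apply Z_div_exact_2; [lia|].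
  rewrite Zmult_mod, Zminus_mod.
  destruct (Z.mod_pos_bound z 2 ltac:(lia)) as [L U].
  assert (H : (z mod 2 = 0 \/ z mod 2 = 1)%Z) by lia.
  destruct H as [-> | ->]; reflexivity.
Qed.

Lemma binom2_succ z : binom2 (z + 1) = (binom2 z + z)%Z.
Proof. pose proof (binom2_double z). pose proof (binom2_double (z + 1)). nia. Qed.

Lemma wcst_1 : @wcst d 1 = one.
Proof. reflexivity. Qed.

Lemma wcst_opp a : @wcst d (- a) == wopp (wcst a).
Proof. intros phi. rewrite ev_wopp, !ev_wcst, opp_IZR. ring. Qed.

(** The binomial expansion of (1 + X_i)^z up to degree 2, for z of either sign. *)
Definition taylor (z : Z) (i : nat) : W :=
  one +: wcst z *: X i +: wcst (binom2 z) *: (X i *: X i).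

Lemma taylor_succ z i : taylor z i *: (one +: X i) ==
  taylor (z + 1) i +: wcst (binom2 z) *: (X i *: X i *: X i).
Proof.
  unfold taylor. rewrite binom2_succ, !wcst_add, wcst_1. ring.
Qed.

Lemma I3_X3 i : I3 (X i *: X i *: X i).
Proof. apply I3_triple; apply aug_X. Qed.

(** By [taylor_succ], multiplying the expansion by u_i = 1 + X_i advances z up to a multiple of
    X_i^3. For descending z the same identity is multiplied by the inverse of u_i. *)
Lemma ui_taylor z i : I3 (ui z i -: taylor z i).
Proof.
  revert z. apply Z.peano_ind.
  - assert (E : ui 0 i -: taylor 0 i == w0).
    { rewrite ui_0. unfold taylor. change (binom2 0) with 0%Z. rewrite wcst_0. ring. }
    rewrite E. apply I3_0.
  - intros z IH. unfold Z.succ.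
    assert (E : ui (z + 1) i -: taylor (z + 1) i ==
      (one +: X i) *: (ui z i -: taylor z i) +: wcst (binom2 z) *: (X i *: X i *: X i)).
    { rewrite <- ui_mul, ui_X.
      transitivity (ui z i *: (one +: X i) -: taylor z i *: (one +: X i) +:
        wcst (binom2 z) *: (X i *: X i *: X i)); [rewrite taylor_succ|]; ring. }
    rewrite E. apply I3_add; apply I3_mul; [exact IH|apply I3_X3].
  - intros z IH. set (y := Z.pred z). replace z with (y + 1)%Z in IH by (unfold y; lia).
    assert (E : ui y i -: taylor y i ==
      ui (-1) i *: ((ui (y + 1) i -: taylor (y + 1) i) -:
                    wcst (binom2 y) *: (X i *: X i *: X i))).
    { transitivity (ui (-1) i *: ui 1 i *: (ui y i -: taylor y i)).
      - rewrite ui_inv. ring.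
      - transitivity (ui (-1) i *: (ui y i *: ui 1 i -: taylor y i *: (one +: X i))).
        + rewrite <- ui_X. ring.
        + rewrite taylor_succ, ui_mul. ring. }
    rewrite E. apply I3_mul, I3_sub; [exact IH|apply I3_mul, I3_X3].
Qed.

(* Membership in the square of the augmentation ideal enters only through [sq_like]. *)
Definition sq_like (b : W) : Prop := forall a, aug a -> I3 (b *: a).

Lemma sq_like_add b c : sq_like b -> sq_like c -> sq_like (b +: c).
Proof.
  intros Hb Hc a Ha. assert (E : (b +: c) *: a == b *: a +: c *: a) by ring.
  rewrite E. apply I3_add; auto.
Qed.

Lemma sq_like_mul q x y : aug x -> aug y -> sq_like (q *: (x *: y)).
Proof.
  intros Hx Hy a Ha. assert (E : q *: (x *: y) *: a == q *: (x *: y *: a)) by ring.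
  rewrite E. apply I3_mul, I3_triple; assumption.
Qed.

Lemma sq_like_wsum n F : (forall i, sq_like (F i)) -> sq_like (wsum n F).
Proof.
  intros H. induction n as [|n IH]; [|apply sq_like_add; auto].
  intros a _. assert (E : w0 *: a == w0) by ring. simpl wsum. rewrite E. apply I3_0.
Qed.

Lemma aug_wsum n F : (forall i, aug (F i)) -> aug (wsum n F).
Proof.
  intros H. induction n as [|n IH]; [reflexivity|apply aug_add; auto].
Qed.

Definition lin (f : nat -> Z) (r : nat) : W := wsum r (fun i => wcst (f i) *: X i).
(** The degree 2 part of the product of the (1 + X_i)^(f i), grouped by the larger index so that a
    new coordinate adds one summand. *)
Definition quad (f : nat -> Z) (r : nat) : W := wsum r (fun j =>
  wsum j (fun i => wcst (f i * f j) *: (X i *: X j)) +: wcst (binom2 (f j)) *: (X j *: X j)).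

Lemma aug_lin f r : aug (lin f r).
Proof. apply aug_wsum. intros i. apply aug_mul, aug_X. Qed.

Lemma sq_like_quad f r : sq_like (quad f r).
Proof.
  apply sq_like_wsum. intros j.
  apply sq_like_add; [apply sq_like_wsum; intros i|]; apply sq_like_mul; apply aug_X.
Qed.

Lemma lin_mul f r j :
  lin f r *: (wcst (f j) *: X j) == wsum r (fun i => wcst (f i * f j) *: (X i *: X j)).
Proof.
  unfold lin. induction r as [|r IH]; [simpl; ring|]. simpl wsum.
  rewrite <- IH, wcst_mul. ring.
Qed.

Lemma mono_taylor f : I3 (mono f -: (one +: lin f d +: quad f d)).
Proof.
  rewrite <- (mono_trunc_d f).
  assert (G : forall r, I3 (mono (trunc r f) -: (one +: lin f r +: quad f r))).
  2:{ apply G. }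
  induction r as [|r IH].
  - rewrite (mono_trunc_0 f). unfold lin, quad; simpl wsum.
    assert (E : one -: (one +: w0 +: w0) == w0) by ring. rewrite E. apply I3_0.
  - rewrite mono_trunc_S. set (u := mono (trunc r f)) in *. set (y := ui (f r) r).
    pose proof (ui_taylor (f r) r) as Hy. fold y in Hy.
    set (a := lin f r) in *. set (b := quad f r) in *.
    set (a' := wcst (f r) *: X r). set (b' := wcst (binom2 (f r)) *: (X r *: X r)).
    assert (Ea : lin f (S r) == a +: a') by reflexivity.
    assert (Eb : quad f (S r) == b +: (a *: a' +: b')).
    { unfold quad. simpl wsum. unfold a, a'. rewrite lin_mul. reflexivity. }
    rewrite Ea, Eb.
    assert (Et : taylor (f r) r == one +: a' +: b') by reflexivity. rewrite Et in Hy.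
    assert (Ha : aug a) by apply aug_lin. assert (Hb : sq_like b) by apply sq_like_quad.
    assert (Ha' : aug a') by apply aug_mul, aug_X.
    assert (Hb' : sq_like b') by (apply sq_like_mul; apply aug_X).
    assert (Hb'' : aug b') by (apply aug_mul, aug_mul, aug_X).
    (* In the product of 1 + a + b and 1 + a' + b' the terms a b', b a' and b b' have degree at
       least 3 and go to the error. *)
    assert (E : u *: y -: (one +: (a +: a') +: (b +: (a *: a' +: b'))) ==
      y *: (u -: (one +: a +: b)) +: (one +: a +: b) *: (y -: (one +: a' +: b')) +:
      (b' *: a +: (b *: a' +: b *: b'))) by ring.
    rewrite E. apply I3_add; [apply I3_add; apply I3_mul; assumption|].
    apply I3_add; [apply Hb', Ha|]. apply I3_add; [apply Hb, Ha'|apply Hb, Hb''].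
Qed.

(** The linear extension of k -> Y k to formal sums; it replaces every monomial of g by its
    expansion at once. *)
Fixpoint expand (h : LP) (Y : pt -> W) : W :=
  match h with [] => w0 | p :: h => wcst (fst p) *: Y (snd p) +: expand h Y end.

Lemma ev_expand h Y phi : ev (wv (expand h Y)) phi = ev h (fun k => ev (wv (Y k)) phi).
Proof.
  induction h as [|p h IH]; [reflexivity|]. simpl expand.
  rewrite ev_wadd, ev_wcst_mul, IH. reflexivity.
Qed.

Lemma I3_expand h Y Z : (forall k, I3 (Y k -: Z k)) -> I3 (expand h Y -: expand h Z).
Proof.
  intros H. induction h as [|p h IH]; simpl expand.
  - assert (E : @w0 d -: w0 == w0) by ring. rewrite E. apply I3_0.
  - assert (E : wcst (fst p) *: Y (snd p) +: expand h Y -: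
      (wcst (fst p) *: Z (snd p) +: expand h Z) ==
      wcst (fst p) *: (Y (snd p) -: Z (snd p)) +: (expand h Y -: expand h Z)) by ring.
    rewrite E. apply I3_add; [apply I3_mul, H|exact IH].
Qed.

Lemma expand_mono (g : W) : expand (wv g) (fun k => mono (co k)) == g.
Proof.
  intros phi. rewrite ev_expand. apply (ev_ext d); [apply wwf|]. intros k Hk.
  rewrite ev_mono, mk_co by exact Hk. reflexivity.
Qed.

(** Moments are real numbers, but the multiple of f to be split off must have an integer
    coefficient. *)
Lemma ev_integer h (z : pt -> Z) : exists c : Z, ev h (fun k => IZR (z k)) = IZR c.
Proof.
  induction h as [|p h [c IH]]; [exists 0%Z; reflexivity|].
  exists (fst p * z (snd p) + c)%Z. unfold ev in *. simpl. rewrite IH, plus_IZR, mult_IZR.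
  reflexivity.
Qed.

(** 2 - u - u^(-1) = -u^(-1) X^2 for X = u - 1, so adding X^2 leaves -(u^(-1) - 1) X^2, a product of
    three elements of the augmentation ideal. *)
Lemma lap_squares : I3 (lap +: wsum d (fun i => X i *: X i)).
Proof.
  assert (G : forall r, I3 (wsum r (fun i => wcst 2 -: ui 1 i -: ui (-1) i) +:
                            wsum r (fun i => X i *: X i))).
  { induction r as [|r IH]; simpl wsum.
    - assert (E : @w0 d +: w0 == w0) by ring. rewrite E. apply I3_0.
    - set (s := wsum r _) in *. set (t := wsum r (fun i => X i *: X i)) in *.
      assert (E : s +: (wcst 2 -: ui 1 r -: ui (-1) r) +: (t +: X r *: X r) ==
        (s +: t) -: (ui (-1) r -: one) *: X r *: X r).
      { assert (K : (ui (-1) r -: one) *: X r *: X r ==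
          (ui (-1) r *: ui 1 r) *: ui 1 r -: (ui (-1) r *: ui 1 r) -:
          (ui (-1) r *: ui 1 r) +: ui (-1) r -: X r *: X r) by (unfold X; ring).
        rewrite K, ui_inv, two_ones. ring. }
      rewrite E. apply I3_sub; [exact IH|]. apply I3_triple; [apply aug_diff| |]; apply aug_X. }
  rewrite lap_wsum. apply G.
Qed.

(** In the expansion of g modulo the cube, the coefficients of 1, X_i and X_i X_j with i <> j are
    vanishing moments. That of X_i^2 is the pairing with n_i (n_i - 1)/2, half the second moment as
    the first one is 0; it has the same value c for all i, read off at i = 0. *)
Lemma I3_of_moments (g : W) : (1 <= d)%nat ->
  ev (wv g) (fun _ => 1) = 0 ->
  (forall i, (i < d)%nat -> ev (wv g) (fun n => IZR (co n i)) = 0) ->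
  (forall i j, (i < d)%nat -> (j < d)%nat -> i <> j ->
     ev (wv g) (fun n => IZR (co n i) * IZR (co n j)) = 0) ->
  (forall i j, (i < d)%nat -> (j < d)%nat ->
     ev (wv g) (fun n => IZR (co n i) ^ 2) = ev (wv g) (fun n => IZR (co n j) ^ 2)) ->
  exists c, I3 (g +: wcst c *: lap).
Proof.
  intros Hd M0 M1 M2 M3.
  destruct (ev_integer (wv g) (fun k => binom2 (co k 0))) as [c Hc]. exists c.
  assert (HB : forall i, (i < d)%nat -> ev (wv g) (fun k => IZR (binom2 (co k i))) = IZR c).
  { assert (D : forall i, (i < d)%nat -> 2 * ev (wv g) (fun k => IZR (binom2 (co k i))) =
      ev (wv g) (fun n => IZR (co n i) ^ 2)).
    { intros i Hi. rewrite <- (Rminus_0_r (ev (wv g) (fun n => IZR (co n i) ^ 2))).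
      rewrite <- (M1 i Hi), <- ev_scal, <- ev_minus. apply ev_ext'. intros k.
      rewrite <- mult_IZR, binom2_double, mult_IZR, minus_IZR. ring. }
    intros i Hi. pose proof (D i Hi). pose proof (D 0%nat Hd).
    rewrite (M3 i 0%nat Hi Hd) in H. lra. }
  assert (E : expand (wv g) (fun k => one +: lin (co k) d +: quad (co k) d) ==
              wcst c *: wsum d (fun i => X i *: X i)).
  { intros phi. rewrite ev_expand, ev_wcst_mul, ev_wsum.
    rewrite (ev_ext' _ _ (fun k => (ev (wv one) phi * 1 +
      sumL (seq 0 d) (fun i => ev (wv (X i)) phi * IZR (co k i))) +
      sumL (seq 0 d) (fun j =>
        sumL (seq 0 j) (fun i => ev (wv (X i *: X j)) phi * (IZR (co k i) * IZR (co k j))) +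
        ev (wv (X j *: X j)) phi * IZR (binom2 (co k j))))).
    - rewrite !ev_plus, ev_scal, M0, !ev_sumL.
      rewrite (sumL_zero (seq 0 d) (fun i => ev (wv g) (fun k => ev (wv (X i)) phi * IZR (co k i)))).
      + rewrite Rmult_0_r, !Rplus_0_l, <- sumL_scal. apply sumL_ext. intros j Hj.
        apply in_seq in Hj. rewrite ev_plus, ev_sumL, (sumL_zero (seq 0 j)).
        * rewrite ev_scal, HB by lia. ring.
        * intros i Hi. apply in_seq in Hi. rewrite ev_scal, M2 by lia. ring.
      + intros i Hi. apply in_seq in Hi. rewrite ev_scal, M1 by lia. ring.
    - intros k. rewrite !ev_wadd. f_equal; [f_equal; [ring|]|].
      + unfold lin. rewrite ev_wsum. apply sumL_ext. intros i _. rewrite ev_wcst_mul. ring.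
      + unfold quad. rewrite ev_wsum. apply sumL_ext. intros j _.
        rewrite ev_wadd, ev_wsum, ev_wcst_mul. f_equal; [|ring].
        apply sumL_ext. intros i _. rewrite ev_wcst_mul, mult_IZR. ring. }
  assert (E2 : g +: wcst c *: lap ==
    (expand (wv g) (fun k => mono (co k)) -:
     expand (wv g) (fun k => one +: lin (co k) d +: quad (co k) d)) +:
    wcst c *: (lap +: wsum d (fun i => X i *: X i))).
  { rewrite E, expand_mono. ring. }
  rewrite E2. apply I3_add.
  - apply I3_expand. intros k. apply mono_taylor.
  - apply I3_mul, lap_squares.
Qed.

Lemma decomposition (x y z : W) : x == y *: wopp z +: (x +: z *: y).
Proof. ring. Qed.

End CubeOfAugmentation.

Theorem theorem2p4 (d : nat) (Hd : (2 <= d)%nat) (g : LP) (Hg : wfLP d g) :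
  Id d g <->
  exists a b : LP, wfLP d a /\ wfLP d b /\ augI3 d b /\
    LPeq g (LPadd (LPmul (fLap d) a) b).
Proof.
  split.
  - intros [_ Hell]. set (G := mkW g Hg). set (v := act g (wgreen d)) in *.
    (* f v = f (g w) = g (f w) = g. *)
    assert (Hv : forall n, length n = d -> act (fLap d) v n = IZR (coef (wv G) n)).
    { intros n Hn. unfold v. rewrite act_comm, <- (act_dirac (d := d)) by assumption.
      apply (act_ext (d := d)); [exact Hg|exact Hn|].
      intros m Hm. apply lap_wgreen; assumption. }
    destruct (I3_of_moments G ltac:(lia) (moment_0 G v Hell Hv) (moment_1 G v Hell Hv)
      (moment_2_off G v Hell Hv) (moment_2_diag G v Hell Hv)) as [c Hc].
    exists (wv (@wcst d (- c))), (wv (wadd G (wmul (wcst c) lap))).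
    split; [apply wwf|]. split; [apply wwf|]. split; [exact Hc|].
    rewrite LPeq_ev. intros phi. unfold LPadd. rewrite ev_app.
    change (LPmul (fLap d) (wv (wcst (- c)))) with (wv (wmul (@lap d) (wcst (- c)))).
    assert (K : weq G (wadd (wmul lap (wcst (- c))) (wadd G (wmul (wcst c) lap)))).
    { rewrite wcst_opp. apply decomposition. }
    change (ev g phi) with (ev (wv G) phi). rewrite (K phi). apply ev_wadd.
  - intros [a [b [Ha [Hb [HI E]]]]]. split; [exact Hg|].
    apply ell1_ext with (fun n => act (LPmul (fLap d) a) (wgreen d) n + act b (wgreen d) n).
    + intros n _. rewrite !act_ev. rewrite LPeq_ev in E. rewrite E. symmetry. apply ev_app.
    + apply ell1_add; [apply ell1_lap_multiple; assumption|apply ell1_aug_cube; assumption].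
Qed.
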